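(* Let $t\in\mathbb{R}$, let $k\ge2$ be an integer, let $\phi\in\Sigma'$ be a building block smooth up to the boundary, and let $\psi=\phi^{-1}$. Let $R>1$ be such that $D_R\subset\psi^k(D_R)$, where $D_R=\{z:1<|z|<R\}$. Let $\lambda$ be the maximal eigenvalue on the interval $[1,R]$ of the operator $$P\nu(r)=r^{1-\frac{(k-1)t}{k}}\int_0^{2\pi}\frac{\nu\big(|\phi(r^{1/k}e^{i\theta})|\big)}{|\phi(r^{1/k}e^{i\theta})|}\,\big|\phi'(r^{1/k}e^{i\theta})\big|^t\,\frac{d\theta}{2\pi}.$$ Then the average integral means spectrum of the random conformal snowflake defined by $\phi$ and $k$ satisfies $\bar\beta(t)\ge\log\lambda/\log k$.
   Context: Let $\mathbb{D}_-=\{z\in\mathbb{C}:|z|>1\}\cup\{\infty\}$. $\Sigma'$ is the class of univalent functions $\phi:\mathbb{D}_-\to\mathbb{D}_-$ with $\phi(\infty)=\infty$ and expansion $\phi(z)=b_1z+\dots$ at infinity, where $b_1=\phi'(\infty)>0$. For $\phi\in\Sigma'$ and $\theta\in\mathbb{R}/2\pi\mathbb{Z}$ put $\phi_\theta(z)=e^{i\theta}\phi(e^{-i\theta}z)$. The Koebe $n$-root transform of $\phi\in\Sigma'$ is $(K_n\phi)(z)=\sqrt[n]{\phi(z^n)}$, with the branch chosen so that $K_n\phi\in\Sigma'$. Conformal snowflake: given $\phi\in\Sigma'$ (the building block), an integer $k\ge2$ and angles $\theta_0,\theta_1,\dots$, let $\Phi_j=K_{k^j}\phi_{\theta_j}$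 and $f_n=\Phi_0\circ\Phi_1\circ\cdots\circ\Phi_n$. The snowflake $f\in\Sigma'$ is the locally uniform limit of $f_n$ on $\mathbb{D}_-$. The random conformal snowflake is obtained when the $\theta_n$ are independent and uniformly distributed on the circle. Average integral means spectrum of a random $f$: $$\bar\beta(t)=\inf\Big\{\beta:\int_1(r-1)^{\beta-1}\int_0^{2\pi}\mathbb{E}\big[|f'(re^{i\theta})|^t\big]\,d\theta\,dr<\infty\Big\},$$ where $\int_1$ denotes integration over a right neighbourhood $(1,r_0)$ of $1$. Here $\psi^k(z)=(\psi(z))^k$ is the $k$-th power (not an iterate), defined for $z\in\phi(\mathbb{D}_-)$. The inclusion $D_R\subset\psi^k(D_R)$ is understood with multiplicity: every $k$-th root $u$ of every $w\in D_R$ has the form $u=\psi(z)$ with $z\in D_R\cap\phi(\mathbb{D}_-)$, i.e. $|\phi(u)|<R$ whenever $1<|u|<R^{1/k}$; thus $P$ acts on bounded functions $\nu$ on $[1,R]$. *)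

(* Defs.v *)
From HB Require Import structures.
From mathcomp Require Export all_boot all_order all_algebra.
From mathcomp Require Export all_classical all_reals all_analysis.
From mathcomp Require Export complex.
Export Order.TTheory GRing.Theory Num.Theory.
Export numFieldNormedType.Exports.

Set Implicit Arguments.
Unset Strict Implicit.
Unset Printing Implicit Defensive.

Local Open Scope classical_set_scope.
Local Open Scope ring_scope.
Local Open Scope complex_scope.

(* R[i] as a normed space over itself, so that [derivable] and [derive1] are
   complex differentiability and the complex derivative. *)
HB.instance Definition _ (R : rcfType) := NormedModule.copy R[i] R[i]^o.

(* The order of R[i] is partial and its norm is R[i]-valued, so radii are
   compared through the R-valued modulus. *)
Definition cmod {R : realType} (z : R[i]) : R := complex.Re `|z|.

Definition expi {R : realType} (x : R) : R[i] := cos x +i* sin x.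

(* The finite part of D_-.  The point at infinity is not represented: it only
   enters through the normalisation in [Sigma']. *)
Definition Dminus {R : realType} : set R[i] := [set z | 1 < cmod z].

Definition DR {R : realType} (rad : R) : set R[i] :=
  [set z | 1 < cmod z < rad].

(* w * phi (1 / w) tends to b_1 as w -> 0: this says at the same time that
   phi(oo) = oo, that phi is holomorphic and injective near oo (simple pole),
   and that b_1 = phi'(oo). *)
Definition Sigma' {R : realType} (phi : R[i] -> R[i]) : Prop :=
  [/\ forall z, Dminus z -> derivable phi z 1,
      {in Dminus &, injective phi},
      forall z, Dminus z -> Dminus (phi z) &
      exists2 b1 : R, 0 < b1 & w * phi w^-1 @[w --> 0^'] --> b1%:C].

(* Smooth up to the boundary: every complex derivative has a continuous
   extension to the closed exterior of the disk. *)
Definition smooth_up_to_boundary {R : realType} (phi : R[i] -> R[i]) : Prop :=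
  forall n : nat, exists2 g : R[i] -> R[i],
    {within [set z | 1 <= cmod z], continuous g} &
    forall z, Dminus z -> g z = (phi^`(n))%classic z.

Definition rotate {R : realType} (phi : R[i] -> R[i]) (theta : R) :
    R[i] -> R[i] :=
  fun z => expi theta * phi (expi (- theta) * z).

(* g = K_n phi on D_-; the requirement [Sigma' g] selects the branch, so g is
   unique on D_-. *)
Definition is_koebe_transform {R : realType} (n : nat)
    (phi g : R[i] -> R[i]) : Prop :=
  Sigma' g /\ forall z, Dminus z -> g z ^+ n = phi (z ^+ n).

Fixpoint iter_comp {R : realType} (Phi : nat -> R[i] -> R[i]) (n : nat) :
    R[i] -> R[i] :=
  if n is m.+1 then iter_comp Phi m \o Phi m.+1 else Phi 0%N.

(* Locally uniform convergence on the finite part of D_-.  For maps in Sigma'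
   convergence near oo follows, by the maximum principle for f_n(z) / z. *)
Definition locally_uniform_limit {R : realType}
    (F : nat -> R[i] -> R[i]) (f : R[i] -> R[i]) : Prop :=
  forall z, Dminus z ->
    exists2 U, nbhs z U & {uniform U, F @ \oo --> f}.

Definition is_snowflake {R : realType} (phi : R[i] -> R[i]) (k : nat)
    (theta : nat -> R) (f : R[i] -> R[i]) : Prop :=
  exists Phi : nat -> R[i] -> R[i],
    [/\ forall j, is_koebe_transform (k ^ j) (rotate phi (theta j)) (Phi j),
        Sigma' f &
        locally_uniform_limit (iter_comp Phi) f].

Section RandomAngles.
Context {R : realType} {d : measure_display} {Omega : measurableType d}.
Variable (Pr : probability Omega R).

(* The product rule for all initial segments; taking some A j to be the whole
   line gives it for every finite subfamily. *)
Definition mutually_independent (X : nat -> {RV Pr >-> R}) : Prop :=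
  forall (n : nat) (A : nat -> set R), (forall j, measurable (A j)) ->
    Pr (\bigcap_(j < n) (X j @^-1` A j)) =
    (\prod_(j < n) Pr (X j @^-1` A j))%E.

Lemma lt0_2pi : 0 < 2 * pi :> R.
Proof. by rewrite mulr_gt0 ?pi_gt0. Qed.

Definition iid_uniform_angles (theta : nat -> {RV Pr >-> R}) : Prop :=
  mutually_independent theta /\
  forall j A, measurable A ->
    distribution Pr (theta j) A = uniform_prob lt0_2pi A.

Definition integral_means (t : R) (f : Omega -> R[i] -> R[i]) (r : R) :
    \bar R :=
  (\int[lebesgue_measure]_(x in `[0%R, (2 * pi)%R]%classic)
     'E_Pr[fun omega => (cmod ((f omega)^`()%classic (r%:C * expi x)) `^ t)%R])%E.

Definition avg_spectrum (t : R) (f : Omega -> R[i] -> R[i]) : \bar R :=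
  ereal_inf [set beta%:E | beta in [set beta : R |
    exists2 r0 : R, 1 < r0 &
      (\int[lebesgue_measure]_(r in `]1%R, r0[%classic)
         (((r - 1) `^ (beta - 1))%R%:E * integral_means t f r) < +oo)%E]].

End RandomAngles.

Section Operator.
Context {R : realType}.
Variables (phi : R[i] -> R[i]) (k : nat) (t : R).

Definition opP (nu : R -> R) (r : R) : R :=
  let u x := (r `^ k%:R^-1)%:C * expi x in
  r `^ (1 - k.-1%:R * t / k%:R) *
  \int[lebesgue_measure]_(x in `[0, 2 * pi]%classic)
    (nu (cmod (phi (u x))) / cmod (phi (u x)) * cmod (phi^`()%classic (u x)) `^ t
       / (2 * pi)).

(* Bounded functions are taken modulo null sets, i.e. P acts on L^oo([1, rad]).
   In particular r = 1, where P involves the boundary values of phi and phi',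
   plays no role.  Pointwise there would be a spurious eigenfunction: if phi
   maps an arc A of the unit circle into the circle, then nu = 1_{r = 1} would
   have as eigenvalue the integral of |phi'|^t over A (with d theta / 2 pi),
   which for large t may exceed k ^ t, hence also k ^ (avg_spectrum).
   A continuous eigenfunction is in particular an eigenfunction in the present
   sense. *)
Definition opP_eigenvalue (rad lam : R) : Prop :=
  exists nu : R -> R,
    [/\ measurable_fun `[1, rad] nu,
        exists M : R, forall r, r \in `[1, rad] -> `|nu r| <= M,
        ~ {ae lebesgue_measure, forall r : R, r \in `[1, rad] -> nu r = 0} &
        {ae lebesgue_measure, forall r : R, r \in `[1, rad] ->
           opP nu r = lam * nu r}].

Definition opP_max_eigenvalue (rad lam : R) : Prop :=
  opP_eigenvalue rad lam /\ forall mu, opP_eigenvalue rad mu -> mu <= lam.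

End Operator.

(* Main.v *)
Require Import Defs.
From mathcomp Require Import ring lra measurable_realfun.

(* Let [f_n] be the partial compositions of the snowflake.  Since
   [|Phi_j(z)|^(k^j) = |phi_theta(z^(k^j))|], averaging over the innermost angle
   shows that [E |f_n'(z)|^t = |z|^(-t) r^(t-1) (P^n id)(r)], [r = |z|^(k^n)].
   As [phi'] does not vanish, [theta |-> |phi(r^(1/k) e^(i theta))|] pulls null
   sets back to null sets for almost every [r], and the positive operator [P] is
   well defined modulo null sets; so an eigenfunction [nu] bounded by [M]
   satisfies [lam^n |nu| <= M P^n id] almost everywhere on [1, rad].  Koebe
   distortion carries this bound from a single point [r] to a compact range of
   [r], and the positivity of [P] makes it persist under further compositions.
   In the limit, [E |f'(z)|^t >= c lam^n] on the annulus [2 <= |z|^(k^n) <= 3],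
   whose width and distance to the unit circle are of order [k^(-n)]: if the
   integral defining the spectrum is finite for [beta], then
   [(lam / k^beta)^n] is bounded, that is, [lam <= k^beta]. *)

Set Implicit Arguments.
Unset Strict Implicit.
Unset Printing Implicit Defensive.

Local Open Scope classical_set_scope.
Local Open Scope ring_scope.
Local Open Scope complex_scope.

(** * Complex moduli and limits *)

(** An eigenfunction is known only almost everywhere, while distortion compares values at points:
    the countably many exceptional null sets leave one radius that is good for all [n], and this
    radius alone carries the growth [lam^n]. All the rest is comparison up to factors that must not
    depend on [n], on the angles or on the number of further compositions. Their size is irrelevant,
    so a crude Koebe theorem is enough, and it is reached through the maximum principle for
    functions holomorphic off a removable point, in the role that Cauchy's formula usually has.
    Averaging over one angle at a time is done on events that constrain later angles only, so
    independence enters as a product rule and no product measure is formed. Since [f'] is the limit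
    of the [f_m'], a bound at scale [n] must hold for every [f_(n+j)'] with the same constant; this
    uniformity in [j] is what the propagation of lower bounds secures. Koebe transforms for all
    angles are rotations of one transform per level, which gives continuity, hence measurability, in
    the angles. *)

Section RealContinuity.
Context {R : realType} {T : Type} (F : set_system T) {FF : Filter F}.
Implicit Types (f g : T -> R) (l m : R).

Lemma cvgRD f g l m : f x @[x --> F] --> l -> g x @[x --> F] --> m ->
  f x + g x @[x --> F] --> l + m.
Proof. by move=> fl gm; apply: (cvgD fl gm). Qed.

Lemma cvgRB f g l m : f x @[x --> F] --> l -> g x @[x --> F] --> m ->
  f x - g x @[x --> F] --> l - m.
Proof. by move=> fl gm; apply: (cvgB fl gm). Qed.

Lemma cvgRN f l : f x @[x --> F] --> l -> - f x @[x --> F] --> - l.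
Proof. by move=> fl; apply: (cvgN fl). Qed.

Lemma cvgRM f g l m : f x @[x --> F] --> l -> g x @[x --> F] --> m ->
  f x * g x @[x --> F] --> l * m.
Proof. by move=> fl gm; apply: (cvgM fl gm). Qed.

Lemma cvgRX f l n : f x @[x --> F] --> l -> f x ^+ n @[x --> F] --> l ^+ n.
Proof.
move=> fl; elim: n => [|n IHn]; first by under eq_fun do rewrite expr0; exact: cvg_cst.
by rewrite exprS; under eq_fun do rewrite exprS; exact: cvgRM.
Qed.

Lemma cvgRV f l : l != 0 -> f x @[x --> F] --> l -> (f x)^-1 @[x --> F] --> l^-1.
Proof. by move=> l0 fl; apply: (cvgV l0 fl). Qed.

End RealContinuity.

Section ComplexModulus.
Context {R : realType}.
Implicit Types (x y z w : R[i]).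

Lemma normE z : `|z| = (cmod z)%:C.
Proof. by rewrite /cmod normc_def. Qed.

Lemma cmodE z : cmod z = Num.sqrt (complex.Re z ^+ 2 + complex.Im z ^+ 2).
Proof. by rewrite /cmod normc_def. Qed.

Lemma cmod_ge0 z : 0 <= cmod z.
Proof. by rewrite cmodE sqrtr_ge0. Qed.

Lemma cmodM z w : cmod (z * w) = cmod z * cmod w.
Proof. by apply: complexI; rewrite rmorphM/= -!normE normrM. Qed.

Lemma cmodD z w : cmod (z + w) <= cmod z + cmod w.
Proof. by rewrite -lecR rmorphD/= -!normE ler_normD. Qed.

Lemma cmodN z : cmod (- z) = cmod z.
Proof. by apply: complexI; rewrite -!normE normrN. Qed.

Lemma cmodB z w : cmod (z - w) = cmod (w - z).
Proof. by rewrite -opprB cmodN. Qed.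

Lemma cmod0 : cmod (0 : R[i]) = 0.
Proof. by apply: complexI; rewrite -!normE normr0. Qed.

Lemma cmod1 : cmod (1 : R[i]) = 1.
Proof. by apply: complexI; rewrite -!normE normr1. Qed.

Lemma cmod_eq0 z : (cmod z == 0) = (z == 0).
Proof. by rewrite -(inj_eq (@complexI R)) -normE normr_eq0. Qed.

Lemma cmod_gt0 z : (0 < cmod z) = (z != 0).
Proof. by rewrite lt_neqAle cmod_ge0 andbT eq_sym cmod_eq0. Qed.

Lemma cmodV z : cmod z^-1 = (cmod z)^-1.
Proof. by apply: complexI; rewrite fmorphV/= -!normE normfV. Qed.

Lemma cmodX z n : cmod (z ^+ n) = cmod z ^+ n.
Proof. by apply: complexI; rewrite rmorphXn/= -!normE normrX. Qed.

Lemma cmodR (r : R) : cmod r%:C = `|r|.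
Proof. by rewrite cmodE /= expr0n addr0 sqrtr_sqr. Qed.

Lemma cmod_sqr z : cmod z ^+ 2 = complex.Re z ^+ 2 + complex.Im z ^+ 2.
Proof. by rewrite cmodE sqr_sqrtr // addr_ge0 ?sqr_ge0. Qed.

Lemma Re_le_cmod z : `|complex.Re z| <= cmod z.
Proof. by rewrite cmodE -sqrtr_sqr ler_wsqrtr // lerDl sqr_ge0. Qed.

Lemma Im_le_cmod z : `|complex.Im z| <= cmod z.
Proof. by rewrite cmodE -sqrtr_sqr ler_wsqrtr // lerDr sqr_ge0. Qed.

Lemma cmod_le_ReIm z : cmod z <= `|complex.Re z| + `|complex.Im z|.
Proof.
rewrite -(ler_pXn2r (n:=2)) ?nnegrE ?cmod_ge0 ?addr_ge0 ?normr_ge0 //.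
rewrite cmod_sqr -(real_normK (num_real (complex.Re z))) -(real_normK (num_real (complex.Im z))).
have := normr_ge0 (complex.Re z); have := normr_ge0 (complex.Im z); nra.
Qed.

Lemma cmod_leD z w : cmod z <= cmod w + cmod (z - w).
Proof. by rewrite -{1}(subrK w z) addrC cmodD. Qed.

Lemma cmod_triangle z w v : cmod (z - v) <= cmod (z - w) + cmod (w - v).
Proof. by rewrite -(subrKA w z (- v)) cmodD. Qed.

Lemma ReB z w : complex.Re (z - w) = complex.Re z - complex.Re w.
Proof. by case: z w => [? ?] [? ?]. Qed.

Lemma ImB z w : complex.Im (z - w) = complex.Im z - complex.Im w.
Proof. by case: z w => [? ?] [? ?]. Qed.

Lemma ReD z w : complex.Re (z + w) = complex.Re z + complex.Re w.
Proof. by case: z w => [? ?] [? ?]. Qed.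

Lemma ImD z w : complex.Im (z + w) = complex.Im z + complex.Im w.
Proof. by case: z w => [? ?] [? ?]. Qed.

Lemma ReM z w : complex.Re (z * w) =
  complex.Re z * complex.Re w - complex.Im z * complex.Im w.
Proof. by case: z w => [? ?] [? ?]. Qed.

Lemma ImM z w : complex.Im (z * w) =
  complex.Re z * complex.Im w + complex.Im z * complex.Re w.
Proof. by case: z w => [? ?] [? ?]. Qed.

Lemma cmod_expi (a : R) : cmod (expi a) = 1.
Proof. by rewrite cmodE /= cos2Dsin2 sqrtr1. Qed.

Lemma expiD (a b : R) : expi (a + b) = expi a * expi b.
Proof.
apply/eqP; rewrite /expi eq_complex /= cosD sinD.
by apply/andP; split; apply/eqP => //; rewrite addrC.
Qed.

Lemma expi0 : expi 0 = 1 :> R[i].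
Proof. by rewrite /expi cos0 sin0. Qed.

Lemma expi_neq0 (a : R) : expi a != 0.
Proof. by rewrite -cmod_eq0 cmod_expi oner_eq0. Qed.

Lemma expiX (a : R) n : expi a ^+ n = expi (n%:R * a).
Proof.
elim: n => [|n IHn]; first by rewrite expr0 mul0r expi0.
by rewrite exprSr IHn -expiD mulrSr mulrDl mul1r.
Qed.

Lemma expi_2pi (a : R) : expi (a + 2 * pi) = expi a.
Proof. by rewrite /expi mulr_natl cosD2pi sinD2pi. Qed.

Lemma expi_surj z : cmod z = 1 -> exists2 a : R, - pi <= a <= pi & z = expi a.
Proof.
case: z => x y; move=> /(congr1 (fun r => r ^+ 2)); rewrite cmod_sqr /= expr1n => xy1.
have x1 : -1 <= x <= 1 by apply/andP; split; nra.
have cx : cos (acos x) = x by rewrite acosK// in_itv.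
have sx : sin (acos x) = `|y|.
  by rewrite sin_acos// -[in LHS]xy1 addrAC subrr add0r sqrtr_sqr.
have a0 := acos_ge0 x1; have api := acos_lepi x1; have p0 := pi_ge0 R.
have [y0|y0] := lerP 0 y.
  exists (acos x); first by apply/andP; split; lra.
  by rewrite /expi cx sx ger0_norm.
exists (- acos x); first by apply/andP; split; lra.
by rewrite /expi cosN sinN cx sx ltr0_norm// opprK.
Qed.

Lemma polar z : exists2 a : R, - pi <= a <= pi & z = (cmod z)%:C * expi a.
Proof.
have [->|z0] := eqVneq z 0.
  by exists 0; rewrite ?cmod0 ?rmorph0 ?mul0r// pi_ge0 oppr_le0 pi_ge0.
have cz0 : (cmod z)%:C != 0 by rewrite -cmod_eq0 cmodR ger0_norm ?cmod_ge0 // cmod_eq0.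
have /expi_surj[a ab za] : cmod (z / (cmod z)%:C) = 1.
  by rewrite cmodM cmodV cmodR ger0_norm ?cmod_ge0// divff// cmod_eq0.
by exists a => //; rewrite -za mulrC divfK.
Qed.

End ComplexModulus.

(* Limits are taken in terms of the real-valued modulus, along [cnbhs z]
   (equal to [nbhs z] by [cnbhsE]): unification of the many canonical
   topologies of [R[i]] is avoided this way. *)
Section ComplexLimits.
Context {R : realType}.

Definition cnbhs (z : R[i]) : set_system R[i] :=
  filter_from [set e : R | 0 < e] (fun e => [set w | cmod (w - z) < e]).

Definition cnbhs' (z : R[i]) := within [set w | w != z] (cnbhs z).

Definition ctends {T : Type} (F : set_system T) (f : T -> R[i]) (l : R[i]) :=
  forall e : R, 0 < e -> \forall x \near F, cmod (f x - l) < e.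

Definition ccont (f : R[i] -> R[i]) (z : R[i]) := ctends (cnbhs z) f (f z).

Global Instance cnbhs_filter (z : R[i]) : ProperFilter (cnbhs z).
Proof.
apply: filter_from_proper; last by move=> e e0; exists z; rewrite /= subrr cmod0.
apply: filter_from_filter; first by exists 1; rewrite /=.
move=> a b a0 b0; exists (Num.min a b); first by rewrite /= lt_min a0 b0.
by move=> w /=; rewrite lt_min => /andP[].
Qed.

Global Instance cnbhs'_filter (z : R[i]) : Filter (cnbhs' z).
Proof. exact: within_filter. Qed.

Lemma cnbhsE (z : R[i]) : cnbhs z = nbhs z.
Proof.
rewrite eqEsubset; split => A.
- move=> [e e0 H]; apply/nbhs_ballP; exists e%:C => /=; first by rewrite ltcR.
  by move=> w; rewrite /ball /= normE ltcR cmodB; exact: H.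
- move/nbhs_ballP => [[e e']] /= /[!ltcE] /= /andP[/eqP -> e0] H.
  exists e => // w wz; apply: H; rewrite /ball /= normE.
  by rewrite cmodB ltcR.
Qed.

Lemma cvg_ctends {T : Type} (F : set_system T) {FF : Filter F} (f : T -> R[i]) (l : R[i]) :
  f @ F --> l <-> ctends F f l.
Proof.
split.
- move=> fl e e0; have : nbhs l [set w | cmod (w - l) < e].
    by rewrite -cnbhsE; exists e.
  by move/fl.
- move=> H A; rewrite -[nbhs l]/(nbhs l) -(cnbhsE l) => -[e e0 eA].
  by apply: filterS (H e e0) => x; exact: eA.
Qed.

Lemma cnbhs_self (z : R[i]) (P : set R[i]) : (\forall w \near cnbhs z, P w) -> P z.
Proof. by move=> [e e0 H]; apply: H; rewrite /= subrr cmod0. Qed.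

Lemma cnbhs_near_near (z : R[i]) (P : set R[i]) : (\forall w \near cnbhs z, P w) ->
  \forall w \near cnbhs z, \forall v \near cnbhs w, P v.
Proof.
move=> [e e0 H]; exists e => // w /= wz; exists (e - cmod (w - z)); first by rewrite /= subr_gt0.
move=> v /= vw; apply: H => /=; apply: le_lt_trans (cmod_triangle v w z) _.
by rewrite -ltrBrDr.
Qed.

Lemma cnbhs'_neq (z : R[i]) : \forall w \near cnbhs' z, w != z.
Proof. by exists 1 => //=. Qed.

Lemma cnbhs'_cnbhs (z : R[i]) (P : set R[i]) : (\forall w \near cnbhs z, P w) ->
  \forall w \near cnbhs' z, P w.
Proof. by apply: filterS => w Pw _. Qed.

Section Rules.
Context {T : Type} (F : set_system T) {FF : Filter F}.
Implicit Types (f g : T -> R[i]) (l m : R[i]).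

Lemma ctends_cst (c : R[i]) : ctends F (fun=> c) c.
Proof. by move=> e e0; near=> x; rewrite subrr cmod0. Unshelve. all: by end_near. Qed.

Lemma ctends_near f g l : (\forall x \near F, f x = g x) -> ctends F f l -> ctends F g l.
Proof.
move=> fg fl e e0; have := fl e e0; move: fg; apply: filterS2 => x ->; exact.
Qed.

Lemma ctends_bounded f l : ctends F f l -> \forall x \near F, cmod (f x) <= cmod l + 1.
Proof.
move=> fl; have := fl 1 ltr01; apply: filterS => x /ltW h.
by apply: le_trans (cmod_leD (f x) l) _; rewrite lerD2l.
Qed.

Lemma ctendsD f g l m : ctends F f l -> ctends F g m ->
  ctends F (fun x => f x + g x) (l + m).
Proof.
move=> fl gm e e0; have e20 : 0 < e / 2 by rewrite divr_gt0.
have := fl _ e20; have := gm _ e20; apply: filterS2 => x h1 h2.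
rewrite (_ : _ - _ = (f x - l) + (g x - m)); last by ring.
by apply: le_lt_trans (cmodD _ _) _; rewrite (splitr e) ltrD.
Qed.

Lemma ctendsN f l : ctends F f l -> ctends F (fun x => - f x) (- l).
Proof.
move=> fl e e0; have := fl e e0; apply: filterS => x.
by rewrite -opprD cmodN.
Qed.

Lemma ctendsB f g l m : ctends F f l -> ctends F g m ->
  ctends F (fun x => f x - g x) (l - m).
Proof. by move=> fl gm; apply: ctendsD => //; exact: ctendsN. Qed.

Lemma ctendsM f g l m : ctends F f l -> ctends F g m ->
  ctends F (fun x => f x * g x) (l * m).
Proof.
move=> fl gm e e0; pose A := cmod l + 1; pose B := cmod m + 1.
have A0 : 0 < A by rewrite ltr_wpDl ?cmod_ge0.
have B0 : 0 < B by rewrite ltr_wpDl ?cmod_ge0.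
have e1 : 0 < e / (2 * B) by rewrite divr_gt0 ?mulr_gt0.
have e2 : 0 < e / (2 * A) by rewrite divr_gt0 ?mulr_gt0.
near=> x.
rewrite (_ : _ - _ = (f x - l) * g x + l * (g x - m)); last by ring.
apply: le_lt_trans (cmodD _ _) _; rewrite !cmodM.
have gB : cmod (g x) <= B by near: x; exact: ctends_bounded.
have h1 : cmod (f x - l) < e / (2 * B) by near: x; exact: fl.
have h2 : cmod (g x - m) < e / (2 * A) by near: x; exact: gm.
have lA : cmod l <= A by rewrite lerDl.
rewrite (_ : e = e / (2 * B) * B + A * (e / (2 * A))); last first.
  by field; rewrite !gt_eqF.
apply: ler_ltD; first by rewrite ler_pM ?cmod_ge0// ltW.
apply: (@le_lt_trans _ _ (A * cmod (g x - m))); first by rewrite ler_wpM2r ?cmod_ge0.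
by rewrite ltr_pM2l.
Unshelve. all: by end_near. Qed.

Lemma ctendsV f l : l != 0 -> ctends F f l -> ctends F (fun x => (f x)^-1) l^-1.
Proof.
move=> l0 fl e e0; pose A := cmod l.
have A0 : 0 < A by rewrite cmod_gt0.
have e1 : 0 < A / 2 by rewrite divr_gt0.
have e2 : 0 < e * (A / 2 * A) by rewrite mulr_gt0// mulr_gt0.
near=> x.
have h1 : cmod (f x - l) < A / 2 by near: x; exact: fl.
have h2 : cmod (f x - l) < e * (A / 2 * A) by near: x; exact: fl.
have fA : A / 2 < cmod (f x).
  have := cmod_leD l (f x); rewrite cmodB -/A; lra.
have fx0 : f x != 0 by rewrite -cmod_gt0; lra.
rewrite (_ : _ - _ = - (f x - l) / (f x * l)); last by field; rewrite fx0 l0.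
rewrite cmodM cmodN cmodV cmodM -/A ltr_pdivrMr ?mulr_gt0//; last by lra.
apply: lt_le_trans h2 _; rewrite ler_pM2l// ler_pM2r// ltW//.
Unshelve. all: by end_near. Qed.

Lemma ctendsX f l n : ctends F f l -> ctends F (fun x => f x ^+ n) (l ^+ n).
Proof.
move=> fl; elim: n => [|n IHn]; first by under eq_fun do rewrite expr0; exact: ctends_cst.
by rewrite exprS; under eq_fun do rewrite exprS; exact: ctendsM.
Qed.

Lemma ctends_Re f l : ctends F f l -> complex.Re (f x) @[x --> F] --> complex.Re l.
Proof.
move=> H; apply/cvgrPdist_lt => e e0; have := H e e0; apply: filterS => x.
by rewrite distrC -ReB; exact/le_lt_trans/Re_le_cmod.
Qed.

Lemma ctends_Im f l : ctends F f l -> complex.Im (f x) @[x --> F] --> complex.Im l.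
Proof.
move=> H; apply/cvgrPdist_lt => e e0; have := H e e0; apply: filterS => x.
by rewrite distrC -ImB; exact/le_lt_trans/Im_le_cmod.
Qed.

Lemma ctends_cmod f l : ctends F f l -> cmod (f x) @[x --> F] --> cmod l.
Proof.
move=> H; apply/cvgrPdist_lt => e e0; have := H e e0; apply: filterS => x h.
have := cmod_leD (f x) l; have := cmod_leD l (f x); rewrite (cmodB l).
by move=> h1 h2; rewrite ltr_norml; apply/andP; split; lra.
Qed.

Lemma ctends_ReIm f l :
  complex.Re (f x) @[x --> F] --> complex.Re l ->
  complex.Im (f x) @[x --> F] --> complex.Im l -> ctends F f l.
Proof.
move=> fr fi e e0; have e20 : 0 < e / 2 by rewrite divr_gt0.
move/cvgrPdist_lt : fr => /(_ _ e20); move/cvgrPdist_lt : fi => /(_ _ e20).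
apply: filterS2 => x h1 h2; apply: le_lt_trans (cmod_le_ReIm _) _.
by rewrite (splitr e) ReB ImB ltrD// distrC.
Qed.

Lemma ctends_RtoC (f : T -> R) (l : R) : f @ F --> l -> ctends F (fun x => (f x)%:C) l%:C.
Proof. by move=> fl; apply: ctends_ReIm => //=; exact: cvg_cst. Qed.

Lemma ctends_comp (f : T -> R[i]) l (g : R[i] -> R[i]) :
  ctends F f l -> ccont g l -> ctends F (fun x => g (f x)) (g l).
Proof.
move=> fl gc e e0; have [d d0 H] := gc e e0.
by apply: filterS (fl d d0) => x; exact: H.
Qed.

Lemma ctends_expi (f : T -> R) (l : R) : f @ F --> l -> ctends F (fun x => expi (f x)) (expi l).
Proof.
move=> fl; apply: ctends_ReIm => /=.
  by apply: (cvg_comp _ _ fl); exact: continuous_cos.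
by apply: (cvg_comp _ _ fl); exact: continuous_sin.
Qed.

End Rules.

Lemma ctends_within z (f : R[i] -> R[i]) l : ctends (cnbhs z) f l -> ctends (cnbhs' z) f l.
Proof. by move=> fl e e0; apply: cnbhs'_cnbhs; exact: fl. Qed.

Lemma ccont_id z : ccont (fun w => w) z.
Proof. by move=> e e0; exists e. Qed.

Lemma ccont_cst c z : ccont (fun=> c) z.
Proof. exact: ctends_cst. Qed.

Lemma ccont_near (f g : R[i] -> R[i]) z : (\forall w \near cnbhs z, f w = g w) ->
  ccont f z -> ccont g z.
Proof.
by move=> fg; rewrite /ccont -(cnbhs_self fg); exact: ctends_near.
Qed.

Lemma ccont_comp (f g : R[i] -> R[i]) z : ccont f z -> ccont g (f z) ->
  ccont (fun w => g (f w)) z.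
Proof. by move=> fc gc; exact: ctends_comp fc gc. Qed.

Lemma ccont_neq0 (f : R[i] -> R[i]) z : ccont f z -> f z != 0 ->
  \forall w \near cnbhs z, f w != 0.
Proof.
move=> fc fz; have := fc (cmod (f z)); rewrite cmod_gt0 => /(_ fz).
by apply: filterS => w; apply: contraTneq => ->; rewrite sub0r cmodN ltxx.
Qed.

End ComplexLimits.

(** * Complex differentiability *)

Section ComplexDerivative.
Context {R : realType}.
Implicit Types (F G : R[i] -> R[i]) (z w l m : R[i]).

(* Caratheodory's formulation: the difference quotient extends continuously. *)
Definition cderiv F z l := exists q : R[i] -> R[i],
  [/\ ccont q z, q z = l & forall w, F w - F z = q w * (w - z)].

Lemma cderiv_cont F z l : cderiv F z l -> ccont F z.
Proof.
move=> [q [qc _ qE]].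
have : ccont (fun w => F z + q w * (w - z)) z.
  apply: ctendsD; first exact: ctends_cst.
  by apply: ctendsM => //; apply: ctendsB; [exact: ccont_id|exact: ctends_cst].
by under eq_fun do rewrite -qE addrC subrK.
Qed.

Lemma cderivP F z l :
  cderiv F z l <-> ctends (cnbhs' z) (fun w => (F w - F z) / (w - z)) l.
Proof.
split=> [[q [qc ql qE]]|H].
  have : ctends (cnbhs' z) q l by rewrite -ql; exact: ctends_within.
  apply: ctends_near; near=> w.
  have wz : w != z by near: w; exact: cnbhs'_neq.
  by rewrite qE mulfK// subr_eq0.
exists (fun w => if w == z then l else (F w - F z) / (w - z)); split.
- move=> e e0; rewrite eqxx; move: (H e e0); rewrite near_withinE /=.
  apply: filterS => w; case: eqVneq => [_ _|wz]; first by rewrite subrr cmod0.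
  by apply.
- by rewrite eqxx.
- move=> w; case: eqVneq => [->|wz]; first by rewrite !subrr mulr0.
  by rewrite divfK// subr_eq0.
Unshelve. all: by end_near. Qed.

Lemma cderiv_near F G z l : (\forall w \near cnbhs z, F w = G w) ->
  cderiv F z l -> cderiv G z l.
Proof.
move=> FG /cderivP H; apply/cderivP; apply: ctends_near H.
have FGz : F z = G z by apply: cnbhs_self FG.
by apply: cnbhs'_cnbhs; apply: filterS FG => w wz; rewrite wz FGz.
Qed.

Lemma cderiv_derive1 F z l : cderiv F z l <-> derivable F z 1 /\ F^`()%classic z = l.
Proof.
have shift L : ctends (cnbhs' z) (fun w => (F w - F z) / (w - z)) L <->
    h^-1 *: (F (h + z) - F z) @[h --> 0^'] --> L.
  rewrite cvg_ctends.
  have E P : (\forall h \near 0^', P h) <-> (\forall h \near cnbhs' (0 : R[i]), P h).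
    by rewrite !near_withinE cnbhsE.
  split=> H e e0; last first.
    have /E[d d0 {}H] := H e e0; exists d => // w /= wd wz.
    have := H (w - z); rewrite /= subr0 => /(_ wd); rewrite subr_eq0 => /(_ wz).
    by rewrite subrK [_ *: _]mulrC.
  have [d d0 {}H] := H e e0; apply/E; exists d => // w /=; rewrite subr0 => wd wz.
  have := H (w + z); rewrite /= addrK => /(_ wd); rewrite -subr_eq0 addrK => /(_ wz).
  by rewrite [_ *: _]mulrC.
rewrite cderivP; split=> [/shift H|[dF <-]].
  have d : derivable F z 1.
    by apply/cvg_ex; exists l; under eq_fun do rewrite scaler1.
  split; [exact: d|exact: (cvg_lim (@norm_hausdorff _ _) H)].
apply/shift; rewrite /derive1; move: dF; rewrite /derivable.
by under eq_fun do rewrite scaler1.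
Qed.

Lemma cderiv_unique F z l m : cderiv F z l -> cderiv F z m -> l = m.
Proof. by move=> /cderiv_derive1[_ <-] /cderiv_derive1[_ <-]. Qed.

Lemma cderiv_cst c z : cderiv (fun=> c) z 0.
Proof.
exists (fun=> 0); split=> //; first exact: ctends_cst.
by move=> w; rewrite subrr mul0r.
Qed.

Lemma cderiv_id z : cderiv (fun w => w) z 1.
Proof.
exists (fun=> 1); split=> //; first exact: ctends_cst.
by move=> w; rewrite mul1r.
Qed.

Lemma cderivD F G z l m : cderiv F z l -> cderiv G z m ->
  cderiv (fun w => F w + G w) z (l + m).
Proof.
move=> [q [qc ql qE]] [p [pc pm pE]]; exists (fun w => q w + p w); split.
- by apply: ctendsD.
- by rewrite ql pm.
- by move=> w; rewrite mulrDl -qE -pE; ring.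
Qed.

Lemma cderivM F G z l m : cderiv F z l -> cderiv G z m ->
  cderiv (fun w => F w * G w) z (l * G z + F z * m).
Proof.
move=> dF dG; have Gc := cderiv_cont dG.
move: dF dG => [q [qc ql qE]] [p [pc pm pE]].
exists (fun w => q w * G w + F z * p w); split.
- by apply: ctendsD; apply: ctendsM => //; exact: ctends_cst.
- by rewrite ql pm.
- move=> w; rewrite mulrDl -(mulrA (F z)) -pE mulrAC -qE; ring.
Qed.

Lemma cderivV F z l : F z != 0 -> cderiv F z l ->
  cderiv (fun w => (F w)^-1) z (- l / F z ^+ 2).
Proof.
move=> Fz0 dF; apply/cderivP; have Fc := cderiv_cont dF.
have nF := ccont_neq0 Fc Fz0.
move/cderivP: (dF) => H.
have : ctends (cnbhs' z) (fun w => (F w - F z) / (w - z) * (- (F w)^-1 / F z))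
    (l * (- (F z)^-1 / F z)).
  apply: ctendsM => //; apply: ctends_within; apply: ctendsM; last exact: ctends_cst.
  by apply: ctendsN; exact: ctendsV.
rewrite (_ : l * _ = - l / F z ^+ 2); last by field.
apply: ctends_near; near=> w.
have Fw0 : F w != 0 by near: w; apply: cnbhs'_cnbhs.
have wz : w - z != 0 by rewrite subr_eq0; near: w; exact: cnbhs'_neq.
by field; rewrite Fw0 Fz0 wz.
Unshelve. all: by end_near. Qed.

Lemma cderiv_comp F G z l m : cderiv G z l -> cderiv F (G z) m ->
  cderiv (fun w => F (G w)) z (m * l).
Proof.
move=> dG [q [qc qm qE]]; have Gc := cderiv_cont dG.
case: dG => [p [pc pl pE]]; exists (fun w => q (G w) * p w); split.
- by apply: ctendsM => //; exact: (ctends_comp Gc).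
- by rewrite qm pl.
- by move=> w; rewrite /= qE pE mulrA.
Qed.

Lemma cderivX F z l n : cderiv F z l ->
  cderiv (fun w => F w ^+ n) z (n%:R * F z ^+ n.-1 * l).
Proof.
move=> dF; elim: n => [|n IHn].
  by rewrite !mul0r; under eq_fun do rewrite expr0; exact: cderiv_cst.
have := cderivM dF IHn.
rewrite (_ : _ + _ = n.+1%:R * F z ^+ n.+1.-1 * l); last first.
  case: n {IHn} => [|n] /=; first by rewrite expr0; ring.
  by rewrite exprS -(natr1 n.+1); ring.
by under eq_fun do rewrite -exprS.
Qed.

(** The derivative is required to be continuous: the mean value property comes from differentiation
    under the integral, which needs the derivative bounded on compact annuli. *)
Definition chol (Fil : set_system R[i]) F :=
  exists G, \forall w \near Fil, cderiv F w (G w) /\ ccont G w.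

(* Holomorphic at [z], up to a removable singularity at [z] itself. *)
Definition phol F z := ccont F z /\ chol (cnbhs' z) F.

Lemma chol_within F z : chol (cnbhs z) F -> chol (cnbhs' z) F.
Proof. by move=> [G H]; exists G; exact: cnbhs'_cnbhs. Qed.

Lemma chol_phol F z : chol (cnbhs z) F -> phol F z.
Proof.
move=> H; split; last exact: chol_within.
by case: H => G /cnbhs_self[/cderiv_cont].
Qed.

Section Rules.
Context (Fil : set_system R[i]) {FF : Filter Fil}.

Lemma chol_cst c : chol Fil (fun=> c).
Proof.
exists (fun=> 0); near=> w; split; [exact: cderiv_cst|exact: ccont_cst].
Unshelve. all: by end_near. Qed.

Lemma chol_id : chol Fil (fun w => w).
Proof.
exists (fun=> 1); near=> w; split; [exact: cderiv_id|exact: ccont_cst].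
Unshelve. all: by end_near. Qed.

Lemma cholD F G : chol Fil F -> chol Fil G -> chol Fil (fun w => F w + G w).
Proof.
move=> [f Hf] [g Hg]; exists (fun w => f w + g w).
apply: filterS2 Hf Hg => w [df cf] [dg cg]; split; first exact: cderivD.
exact: ctendsD.
Qed.

Lemma cholM F G : chol Fil F -> chol Fil G -> chol Fil (fun w => F w * G w).
Proof.
move=> [f Hf] [g Hg]; exists (fun w => f w * G w + F w * g w).
apply: filterS2 Hf Hg => w [df cf] [dg cg]; split; first exact: cderivM.
by apply: ctendsD; apply: ctendsM => //; [exact: cderiv_cont dg|exact: cderiv_cont df].
Qed.

Lemma cholN F : chol Fil F -> chol Fil (fun w => - F w).
Proof.
by move=> HF; under eq_fun do rewrite -mulN1r; apply: cholM => //; exact: chol_cst.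
Qed.

Lemma cholB F G : chol Fil F -> chol Fil G -> chol Fil (fun w => F w - G w).
Proof. by move=> HF HG; apply: cholD => //; exact: cholN. Qed.

Lemma cholV F : (\forall w \near Fil, F w != 0) -> chol Fil F ->
  chol Fil (fun w => (F w)^-1).
Proof.
move=> F0 [f Hf]; exists (fun w => - f w / F w ^+ 2).
apply: filterS2 F0 Hf => w F0 [df cf]; split; first exact: cderivV.
apply: ctendsM; first exact: ctendsN.
by apply: ctendsV; [rewrite expf_neq0|apply: ctendsX; exact: cderiv_cont df].
Qed.

End Rules.

Lemma pholD F G z : phol F z -> phol G z -> phol (fun w => F w + G w) z.
Proof. by move=> [cF hF] [cG hG]; split; [exact: ctendsD|exact: cholD]. Qed.

Lemma pholM F G z : phol F z -> phol G z -> phol (fun w => F w * G w) z.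
Proof. by move=> [cF hF] [cG hG]; split; [exact: ctendsM|exact: cholM]. Qed.

Lemma pholV F z : F z != 0 -> phol F z -> phol (fun w => (F w)^-1) z.
Proof.
move=> F0 [cF hF]; split; first exact: ctendsV.
by apply: cholV => //; apply: cnbhs'_cnbhs; exact: ccont_neq0.
Qed.

Lemma phol_cst c z : phol (fun=> c) z.
Proof. by split; [exact: ctends_cst|exact: chol_cst]. Qed.

Lemma phol_id z : phol (fun w => w) z.
Proof. by split; [exact: ccont_id|exact: chol_id]. Qed.

Lemma pholN F z : phol F z -> phol (fun w => - F w) z.
Proof. by move=> [cF hF]; split; [exact: ctendsN|exact: cholN]. Qed.

Lemma pholB F G z : phol F z -> phol G z -> phol (fun w => F w - G w) z.
Proof. by move=> hF hG; apply: pholD => //; exact: pholN. Qed.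

Lemma chol_near Fil {FF : Filter Fil} F G :
  (\forall w \near Fil, \forall v \near cnbhs w, F v = G v) -> chol Fil F -> chol Fil G.
Proof.
move=> FG [f Hf]; exists f; apply: filterS2 FG Hf => w FG [df cf]; split=> //.
exact: cderiv_near FG df.
Qed.

Lemma phol_near F G z : (\forall w \near cnbhs z, F w = G w) -> phol F z -> phol G z.
Proof.
move=> FG [cF hF]; split; first exact: ccont_near cF.
by apply: chol_near hF; apply: cnbhs'_cnbhs; exact: cnbhs_near_near.
Qed.

Definition dquot F a l w := if w == a then l else (F w - F a) / (w - a).

(** Complex differentiability of the quotient at [a] itself would amount to a second derivative of
    [F]; [phol] asks only for continuity there, and that is Caratheodory's definition of
    [cderiv]. *)
Lemma dquot_phol F a l : (\forall z \near cnbhs a, phol F z) -> cderiv F a l -> phol (dquot F a l) a.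
Proof.
move=> hF dF; split.
  case: dF => q [qc ql qE]; apply: ccont_near qc; near=> w.
  by rewrite /dquot; case: eqVneq => [->//|wa]; rewrite qE mulfK// subr_eq0.
have [_ hFa] := cnbhs_self hF.
have : chol (cnbhs' a) (fun w => (F w - F a) / (w - a)).
  apply: cholM; first by apply: cholB => //; exact: chol_cst.
  apply: cholV; last by apply: cholB; [exact: chol_id|exact: chol_cst].
  by apply: filterS (cnbhs'_neq a) => w; rewrite subr_eq0.
apply: chol_near; near=> w.
have : w != a by near: w; exact: cnbhs'_neq.
rewrite -subr_eq0 => /(ccont_neq0 (f := fun w => w - a) (z := w)) H.
have : \forall v \near cnbhs w, v - a != 0.
  by apply: H; apply: ctendsB; [exact: ccont_id|exact: ctends_cst].
by apply: filterS => v; rewrite subr_eq0 /dquot => /negbTE ->.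
Unshelve. all: by end_near. Qed.

Lemma dquot_phol_neq F a l z : z != a -> phol F z -> phol (dquot F a l) z.
Proof.
move=> za hF.
have : phol (fun w => (F w - F a) / (w - a)) z.
  apply: pholM; first by apply: pholB => //; exact: phol_cst.
  apply: pholV; first by rewrite subr_eq0.
  by apply: pholB; [exact: phol_id|exact: phol_cst].
apply: phol_near.
have /ccont_neq0 : ccont (fun w => w - a) z by apply: ctendsB; [exact: ccont_id|exact: ctends_cst].
rewrite subr_eq0 => /(_ za); apply: filterS => w.
by rewrite subr_eq0 /dquot => /negbTE ->.
Qed.

End ComplexDerivative.

(** * Mean value property and maximum principle *)

Section MeanValue.
Context {R : realType}.
Implicit Types (F G : R[i] -> R[i]) (z w l m : R[i]).
Local Notation mu := (@lebesgue_measure R).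
Local Notation D := (`[0, 2 * pi]%classic : set R).

Lemma is_derive_curve F (g : R -> R[i]) (x : R) l (a b : R) :
  is_derive x 1 (fun y => complex.Re (g y)) a ->
  is_derive x 1 (fun y => complex.Im (g y)) b ->
  cderiv F (g x) l ->
  is_derive x 1 (fun y => complex.Re (F (g y))) (complex.Re l * a - complex.Im l * b) /\
  is_derive x 1 (fun y => complex.Im (F (g y))) (complex.Re l * b + complex.Im l * a).
Proof.
move=> /is_derive1_caratheodory[ga [gaE gac gaa]] /is_derive1_caratheodory[gb [gbE gbc gbb]].
move=> [q [qc ql qE]].
have gc : ctends (nbhs x) g (g x).
  apply: ctends_ReIm.
  - have -> : (fun y => complex.Re (g y)) = (fun y => complex.Re (g x) + ga y * (y - x)).
      by apply/funext => y; rewrite -gaE addrC subrK.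
    rewrite -[X in _ --> X]addr0 -[X in _ --> _ + X](mulr0 (ga x)).
    apply: cvgD; [exact: cvg_cst|apply: cvgM => //]; rewrite -(subrr x).
    by apply: cvgB; [exact: cvg_id|exact: cvg_cst].
  - have -> : (fun y => complex.Im (g y)) = (fun y => complex.Im (g x) + gb y * (y - x)).
      by apply/funext => y; rewrite -gbE addrC subrK.
    rewrite -[X in _ --> X]addr0 -[X in _ --> _ + X](mulr0 (gb x)).
    apply: cvgD; [exact: cvg_cst|apply: cvgM => //]; rewrite -(subrr x).
    by apply: cvgB; [exact: cvg_id|exact: cvg_cst].
have qgc : ctends (nbhs x) (fun y => q (g y)) (q (g x)) by exact: ctends_comp gc qc.
have qr : complex.Re (q (g y)) @[y --> nbhs x] --> complex.Re (q (g x)) by exact: ctends_Re.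
have qi : complex.Im (q (g y)) @[y --> nbhs x] --> complex.Im (q (g x)) by exact: ctends_Im.
split; apply/is_derive1_caratheodory.
- exists (fun y => complex.Re (q (g y)) * ga y - complex.Im (q (g y)) * gb y); split.
  + by move=> y; rewrite -ReB qE ReM ReB ImB gaE gbE; ring.
  + by apply: (@cvgRB _ _ (nbhs x)); apply: (@cvgRM _ _ (nbhs x)).
  + by rewrite gaa gbb ql.
- exists (fun y => complex.Re (q (g y)) * gb y + complex.Im (q (g y)) * ga y); split.
  + by move=> y; rewrite -ImB qE ImM ReB ImB gaE gbE; ring.
  + by apply: (@cvgRD _ _ (nbhs x)); apply: (@cvgRM _ _ (nbhs x)).
  + by rewrite gaa gbb ql.
Qed.

Definition circ (z0 : R[i]) (s x : R) : R[i] := z0 + s%:C * expi x.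

Lemma cmod_circ z0 s x : cmod (circ z0 s x - z0) = `|s|.
Proof. by rewrite /circ addrAC subrr add0r cmodM cmod_expi mulr1 cmodR. Qed.

Lemma circ_surj z0 w :
  exists2 x, - pi <= x <= pi & w = circ z0 (cmod (w - z0)) x.
Proof. by have [x xpi h] := polar (w - z0); exists x => //; rewrite /circ -h addrC subrK. Qed.

Lemma ctends_circ z0 {T : Type} (Fil : set_system T) {FF : Filter Fil} (f g : T -> R) a b :
  f @ Fil --> a -> g @ Fil --> b ->
  ctends Fil (fun y => circ z0 (f y) (g y)) (circ z0 a b).
Proof.
move=> fa gb; apply: ctendsD; first exact: ctends_cst.
by apply: ctendsM; [exact: ctends_RtoC|exact: ctends_expi].
Qed.

Lemma circ_derive_s F z0 s x l : cderiv F (circ z0 s x) l ->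
  is_derive s 1 (fun y => complex.Re (F (circ z0 y x))) (complex.Re (l * expi x)).
Proof.
move=> dF.
have d1 : is_derive s 1 (fun y => complex.Re (circ z0 y x)) (cos x).
  rewrite (_ : (fun y => _) = fun y => complex.Re z0 + y * cos x); last first.
    by apply/funext => y; rewrite ReD ReM /= mul0r subr0.
  by apply: is_derive_eq; rewrite /GRing.scale /=; ring.
have d2 : is_derive s 1 (fun y => complex.Im (circ z0 y x)) (sin x).
  rewrite (_ : (fun y => _) = fun y => complex.Im z0 + y * sin x); last first.
    by apply/funext => y; rewrite ImD ImM /= mul0r addr0.
  by apply: is_derive_eq; rewrite /GRing.scale /=; ring.
by have [+ _] := is_derive_curve d1 d2 dF; rewrite ReM.
Qed.

(** Together with [circ_derive_s] this is the Cauchy-Riemann equation in polar form: the angular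
    derivative of [Im F] is [s] times the radial derivative of [Re F]. *)
Lemma circ_derive_x F z0 s x l : cderiv F (circ z0 s x) l ->
  is_derive x 1 (fun y => complex.Im (F (circ z0 s y))) (s * complex.Re (l * expi x)).
Proof.
move=> dF.
have d1 : is_derive x 1 (fun y => complex.Re (circ z0 s y)) (- (s * sin x)).
  rewrite (_ : (fun y => _) = fun y => complex.Re z0 + s * cos y); last first.
    by apply/funext => y; rewrite ReD ReM /= mul0r subr0.
  by apply: is_derive_eq; rewrite /GRing.scale /=; ring.
have d2 : is_derive x 1 (fun y => complex.Im (circ z0 s y)) (s * cos x).
  rewrite (_ : (fun y => _) = fun y => complex.Im z0 + s * sin y); last first.
    by apply/funext => y; rewrite ImD ImM /= mul0r addr0.
  by apply: is_derive_eq; rewrite /GRing.scale /=; ring.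
have [_] := is_derive_curve d1 d2 dF.
by rewrite (_ : _ + _ = s * complex.Re (l * expi x))// ReM /=; ring.
Qed.

Lemma circ_continuous (G : R[i] -> R[i]) z0 (s : R) :
  (forall x, ccont G (circ z0 s x)) ->
  forall x, ctends (nbhs x) (fun y => G (circ z0 s y)) (G (circ z0 s x)).
Proof.
move=> Gc x; apply: (ctends_comp _ (Gc x)); apply: ctends_circ; first exact: cvg_cst.
exact: cvg_id.
Qed.

Lemma pi2_gt0 : 0 < 2 * pi :> R.
Proof. by rewrite mulr_gt0// pi_gt0. Qed.

Lemma integrable_D (f : R -> R) : continuous f -> mu.-integrable D (EFin \o f).
Proof.
move=> fc; apply: continuous_compact_integrable; first exact: segment_compact.
exact: continuous_subspaceT.
Qed.

Lemma Rintegral_D_cst (c : R) : \int[mu]_(x in D) c = 2 * pi * c.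
Proof.
by rewrite Rintegral_cst//= lebesgue_measure_itv/= lte_fin pi2_gt0 -EFinD subr0 mulrC.
Qed.

Lemma mean_value F z0 (e : R) :
  ccont F z0 ->
  (exists G, forall w, 0 < cmod (w - z0) < e -> cderiv F w (G w) /\ ccont G w) ->
  forall s, 0 < s < e ->
  \int[mu]_(x in D) complex.Re (F (circ z0 s x)) = 2 * pi * complex.Re (F z0).
Proof.
move=> Fc [G HG].
have onG (s x : R) : 0 < s < e -> cderiv F (circ z0 s x) (G (circ z0 s x)) /\ ccont G (circ z0 s x).
  by move=> /andP[s0 se]; apply: HG; rewrite cmod_circ gtr0_norm// s0.
have Fcirc (s : R) : 0 < s < e -> continuous (fun x => complex.Re (F (circ z0 s x))).
  move=> se x; apply: ctends_Re; apply: circ_continuous => y.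
  by have [/cderiv_cont] := onG s y se.
pose A s := \int[mu]_(x in D) complex.Re (F (circ z0 s x)).
have dA (s : R) : 0 < s < e -> is_derive s 1 A 0.
  move=> /[dup] se /andP[s0 s_e].
  (* A compact annulus around the radius [s] inside the punctured disc; the maximum [M] of the
     derivative on it serves as the dominating function. *)
  pose u := s / 2; pose v := (s + e) / 2.
  have uv x : x \in `]u, v[ -> 0 < x < e.
    by rewrite in_itv/= /u /v => /andP[? ?]; apply/andP; split; lra.
  pose K := (`[u, v] `*` D : set (R * R)%type).
  have cK : compact K by apply: compact_setX; exact: segment_compact.
  have [M HM] : exists M, forall x y, x \in `[u, v] -> y \in `[0, 2 * pi]%R -> cmod (G (circ z0 x y)) <= M.
    have K0 : K !=set0.
      exists (s, 0); split => /=; rewrite in_itv/=; last by rewrite lexx ltW// pi2_gt0.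
      by rewrite /u /v; apply/andP; split; lra.
    have [|c _ Hc] := @compact_EVT_max _ R (fun p => cmod (G (circ z0 p.1 p.2))) K K0 cK.
      apply/subspace_continuousP => -[x y] [/= xuv yD].
      apply: cvg_within_filter; apply: ctends_cmod.
      apply: (ctends_comp (f := fun p : R * R => circ z0 p.1 p.2)).
        by apply: ctends_circ; [exact: cvg_fst|exact: cvg_snd].
      have : 0 < x < e by move: xuv; rewrite in_itv/= /u /v => /andP[? ?]; apply/andP; split; lra.
      by move=> /(onG x y)[].
    exists (cmod (G (circ z0 c.1 c.2))) => x y xuv yD.
    by apply: (Hc (x, y)); rewrite inE.
  pose f x y := complex.Re (F (circ z0 x y)).
  have df (x y : R) : 0 < x < e -> is_derive x 1 (f ^~ y) (complex.Re (G (circ z0 x y) * expi y)).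
    by move=> xe; apply: circ_derive_s; have [] := onG x y xe.
  have suv : `]u, v[%classic s by rewrite /= in_itv/= /u /v; apply/andP; split; lra.
  have intf x : `]u, v[%classic x -> mu.-integrable D (EFin \o f x).
    by move=> xuv; apply: integrable_D; apply: Fcirc; exact: uv.
  have derf x y : `]u, v[%classic x -> D y -> derivable (f ^~ y) x 1.
    by move=> xuv _; have := df x y (uv _ xuv); case.
  have d1f (x y : R) : 0 < x < e -> partial1of2 f x y = complex.Re (G (circ z0 x y) * expi y).
    by move=> xe; rewrite partial1of2E; apply: derive_val; exact: df.
  have M0 : 0 <= M.
    apply: le_trans (HM s 0 _ _); first exact: cmod_ge0.
      by rewrite in_itv/= /u /v; apply/andP; split; lra.
    by rewrite in_itv/= lexx ltW// pi2_gt0.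
  have ubf x y : `]u, v[%classic x -> D y -> `|partial1of2 f x y| <= M.
    move=> xuv yD; rewrite d1f; last exact: uv.
    apply: le_trans (Re_le_cmod _) _; rewrite cmodM cmod_expi mulr1.
    apply: HM => //; move: xuv; rewrite /= !in_itv/= => /andP[? ?]; apply/andP; split; lra.
  have intM : mu.-integrable D (EFin \o (fun=> M)).
    by apply: integrable_D => x; exact: cvg_cst.
  have mD : measurable D by [].
  have drv := @derivable_under_integral R _ _ mu f D mD s u v suv intf derf (fun=> M) (fun=> M0) intM ubf.
  have dvl := @differentiation_under_integral R _ _ mu f D mD s u v suv intf derf (fun=> M) (fun=> M0) intM ubf.
  have -> : 0 = A^`()%classic s; last by rewrite derive1E; exact: DeriveDef drv erefl.
  rewrite /A dvl.
  pose P y := complex.Im (F (circ z0 s y)).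
  have dP (y : R) : is_derive y 1 P (s * complex.Re (G (circ z0 s y) * expi y)).
    by apply: circ_derive_x; have [] := onG s y se.
  have Gc : continuous (fun y : R => s * complex.Re (G (circ z0 s y) * expi y)).
    move=> y; apply: cvgM; first exact: cvg_cst.
    apply: ctends_Re; apply: ctendsM; last by apply: ctends_expi; exact: cvg_id.
    by apply: circ_continuous => x; have [] := onG s x se.
  have P0 : P (2 * pi) = P 0.
    by rewrite /P /circ -[2 * pi]add0r expi_2pi.
  have Pc : continuous P.
    by move=> y; apply: differentiable_continuous; apply/derivable1_diffP; case: (dP y).
  have FTC := @continuous_FTC2 R _ P 0 (2 * pi) pi2_gt0 (continuous_subspaceT Gc).
  have E : (\int[mu]_(x in D) (s * complex.Re (G (circ z0 s x) * expi x))%:E = 0)%E.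
    rewrite FTC; first by rewrite P0 subee.
    - split; first by move=> y _; case: (dP y).
      + by apply: cvg_at_right_filter; exact: Pc.
      + by apply: cvg_at_left_filter; exact: Pc.
    - by move=> y _; rewrite derive1E; apply: derive_val; exact: dP.
  transitivity (\int[mu]_(y in D) (s^-1 * (s * complex.Re (G (circ z0 s y) * expi y)))); last first.
    by apply: eq_Rintegral => y _; rewrite d1f// mulKf// gt_eqF.
  rewrite RintegralZl//; last exact: integrable_D.
  by rewrite /Rintegral E /= mulr0.
have Acst (s1 s2 : R) : 0 < s1 -> s1 < s2 -> s2 < e -> A s2 = A s1.
  move=> s10 s12 s2e.
  have dA' x : x \in `]s1, s2[ -> is_derive x 1 A 0.
    by rewrite in_itv/= => /andP[? ?]; apply: dA; apply/andP; split; lra.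
  have Ac : {within `[s1, s2], continuous A}.
    apply/continuous_in_subspaceT => x; rewrite inE /= in_itv/= => /andP[? ?].
    apply: differentiable_continuous; apply/derivable1_diffP.
    have : 0 < x < e by apply/andP; split; lra.
    by case/dA.
  have [c _] := MVT s12 dA' Ac.
  by rewrite mul0r => /eqP; rewrite subr_eq0 => /eqP.
move=> s /andP[s0 se].
apply/eqP; rewrite -subr_eq0 -normr_le0; apply/ler_addgt0Pl => eps eps0.
rewrite addr0.
have eps1 : 0 < eps / (2 * pi) by rewrite divr_gt0// pi2_gt0.
have [d /= d0 Hd] := Fc _ eps1.
pose s1 := Num.min (s / 2) (d / 2).
have s10 : 0 < s1 by rewrite lt_min !divr_gt0.
have s1s : s1 < s by rewrite /s1 gt_min; apply/orP; left; lra.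
have s1d : s1 < d by rewrite /s1 gt_min; apply/orP; right; lra.
have s1e : 0 < s1 < e by rewrite s10 /=; lra.
rewrite -/(A s) (Acst s1 s)//.
have -> : 2 * pi * complex.Re (F z0) = \int[mu]_(x in D) (complex.Re (F z0)).
  by rewrite Rintegral_D_cst.
have ic (c : R) : mu.-integrable D (EFin \o (fun=> c)) by apply: integrable_D => x; exact: cvg_cst.
have iF := integrable_D (Fcirc _ s1e).
rewrite -RintegralB//.
have iFB : mu.-integrable D (EFin \o (fun x => complex.Re (F (circ z0 s1 x)) - complex.Re (F z0))).
  by apply: integrable_D => x; apply: cvgB; [exact: Fcirc|exact: cvg_cst].
apply: le_trans (le_normr_Rintegral _ iFB) _ => //.
have -> : eps = \int[mu]_(x in D) (eps / (2 * pi)).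
  by rewrite Rintegral_D_cst mulrC divfK// gt_eqF// pi2_gt0.
apply: le_Rintegral => //.
- apply: integrable_D => x; apply: cvg_norm.
  by apply: cvgB; [exact: Fcirc|exact: cvg_cst].
- move=> x _; rewrite -ReB; apply: le_trans (Re_le_cmod _) _; apply: ltW; apply: Hd.
  by rewrite /= cmod_circ gtr0_norm.
Qed.

End MeanValue.

Section MaximumPrinciple.
Context {R : realType}.
Implicit Types (F G : R[i] -> R[i]) (z w l m : R[i]).

(** Polar coordinates pull the closed annulus back to a compact rectangle; [a = 0] gives a disc and
    [a = b] a circle. *)
Lemma circ_attains_max (g : R[i] -> R) z0 (a b : R) : 0 <= a <= b ->
  (forall z, a <= cmod (z - z0) <= b -> g w @[w --> cnbhs z] --> g z) ->
  exists2 c, a <= cmod (c - z0) <= b & forall z, a <= cmod (z - z0) <= b -> g z <= g c.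
Proof.
move=> /andP[a0 ab] gc.
pose K := (`[a, b] `*` `[- pi, pi] : set (R * R)%type).
have cK : compact K by apply: compact_setX; exact: segment_compact.
have K0 : K !=set0.
  exists (a, 0); split; rewrite /= in_itv/= ?lexx ?ab//.
  by rewrite oppr_le0 pi_ge0.
have incl (x y : R) : a <= x <= b -> a <= cmod (circ z0 x y - z0) <= b.
  by move=> /andP[ax xb]; rewrite cmod_circ ger0_norm ?ax// (le_trans a0).
have [|c] := @compact_EVT_max _ R (fun p => g (circ z0 p.1 p.2)) K K0 cK.
  apply/subspace_continuousP => -[x y] [/= + yD]; rewrite in_itv/= => xab.
  apply: cvg_within_filter.
  have H : ctends (nbhs (x, y)) (fun p : R * R => circ z0 p.1 p.2) (circ z0 x y).
    by apply: ctends_circ; [exact: cvg_fst|exact: cvg_snd].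
  move=> A /= /(gc _ (incl x y xab)) [e e0 eA].
  by apply: filterS (H e e0) => p /eA.
rewrite inE => -[/= + _]; rewrite in_itv/= => c1 Hc.
exists (circ z0 c.1 c.2); first exact: incl.
move=> z zab; have [x xpi ->] := circ_surj z0 z.
by apply: (Hc (cmod (z - z0), x)); rewrite inE; split; rewrite /= in_itv.
Qed.

Lemma circ_attains_min (g : R[i] -> R) z0 (a b : R) : 0 <= a <= b ->
  (forall z, a <= cmod (z - z0) <= b -> g w @[w --> cnbhs z] --> g z) ->
  exists2 c, a <= cmod (c - z0) <= b & forall z, a <= cmod (z - z0) <= b -> g c <= g z.
Proof.
move=> ab gc; have [|c cab H] := @circ_attains_max (fun z => - g z) z0 a b ab.
  by move=> z zab; apply: (@cvgRN _ _ (cnbhs z)); exact: gc.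
by exists c => // z /H; rewrite lerN2.
Qed.

Lemma phol_chol F z : phol F z -> exists2 e : R, 0 < e &
  exists G, forall w, 0 < cmod (w - z) < e -> cderiv F w (G w) /\ ccont G w.
Proof.
move=> [_ [G [e /= e0 H]]]; exists e => //; exists G => w /andP[wz we].
by apply: H => //=; rewrite -subr_eq0 -cmod_gt0.
Qed.

(* [eps |z - z0|^2] makes [|F|^2] strictly submean, so that its maximum on the
   disc cannot be interior. *)
Lemma max_principle F z0 (rho M : R) : 0 < rho ->
  (forall z, cmod (z - z0) <= rho -> phol F z) ->
  (forall z, cmod (z - z0) = rho -> cmod (F z) <= M) ->
  forall z, cmod (z - z0) <= rho -> cmod (F z) <= M.
Proof.
move=> rho0 hF FM.
have M0 : 0 <= M.
  apply: le_trans (FM (circ z0 rho 0) _); first exact: cmod_ge0.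
  by rewrite cmod_circ gtr0_norm.
suff H (eps : R) : 0 < eps -> forall z, cmod (z - z0) <= rho ->
    cmod (F z) ^+ 2 <= M ^+ 2 + eps * rho ^+ 2.
  move=> z zr; rewrite -(ler_pXn2r (n := 2)) ?nnegrE ?cmod_ge0//.
  apply/ler_addgt0Pl => e e0.
  have e1 : 0 < e / rho ^+ 2 by rewrite divr_gt0// exprn_gt0.
  have := H _ e1 z zr; rewrite divfK; first by rewrite addrC.
  by rewrite expf_neq0// gt_eqF.
move=> eps0.
pose g w := cmod (F w) ^+ 2 + eps * cmod (w - z0) ^+ 2.
have [|z|c /andP[_ crho] Hc] := @circ_attains_max g z0 0 rho; first by rewrite lexx ltW.
  move=> /andP[_ zr]; have [Fc _] := hF z zr.
  have c1 : cmod (F w) @[w --> cnbhs z] --> cmod (F z) by exact: ctends_cmod.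
  have c2 : cmod (w - z0) @[w --> cnbhs z] --> cmod (z - z0).
    by apply: ctends_cmod; apply: ctendsB; [exact: ccont_id|exact: ctends_cst].
  apply: (@cvgRD _ _ (cnbhs z)); first exact: (@cvgRX _ _ (cnbhs z)).
  apply: (@cvgRM _ _ (cnbhs z)); first exact: cvg_cst.
  exact: (@cvgRX _ _ (cnbhs z)).
suff cr : cmod (c - z0) = rho.
  move=> z zr; have := Hc z; rewrite cmod_ge0 => /(_ zr).
  rewrite /g cr => gz; apply: le_trans (le_trans gz _).
    by rewrite lerDl mulr_ge0 ?sqr_ge0// ltW.
  by rewrite lerD2r ler_pXn2r ?nnegrE ?cmod_ge0// FM.
apply/eqP; rewrite eq_le crho leNgt; apply/negP => clt.
have [e e0 [dF HF]] := phol_chol (hF c crho).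
(* [H] linearises [g] at its maximum [c]: with [2 Re (conj (F c) F w) <= |F w|^2 + |F c|^2] and the
   expansion of [|w - z0|^2] at [c], maximality gives [HE]. But [H] is holomorphic, so the mean of
   [Re H] over a small circle is [Re (H c)], whereas [HE] makes it smaller by [eps s^2]. *)
pose H w := (2 : R)%:C * (conjc (F c) * F w) + (2 * eps)%:C * (conjc (c - z0) * (w - c)).
have HE w : cmod (w - z0) <= rho -> complex.Re (H w) <= 2 * cmod (F c) ^+ 2 - eps * cmod (w - c) ^+ 2.
  move=> wr; have := Hc w; rewrite cmod_ge0 => /(_ wr); rewrite /g.
  rewrite /H ReD !ReM !ImM !cmod_sqr !ReB !ImB /=.
  clear Hc hF HF FM dF wr clt crho H g.
  move: w z0 c (F w) (F c) => [w1 w2] [p1 p2] [c1 c2] [a2 b2] [a1 b1] /=.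
  by have := sqr_ge0 (a1 - a2); have := sqr_ge0 (b1 - b2); nra.
have Hcc : complex.Re (H c) = 2 * cmod (F c) ^+ 2.
  rewrite /H subrr !mulr0 addr0 cmod_sqr !ReM /=; case: (F c) => a b /=; ring.
pose s := Num.min (e / 2) (rho - cmod (c - z0)).
have s0 : 0 < s by rewrite lt_min divr_gt0// subr_gt0.
have se : s < e by rewrite gt_min; apply/orP; left; lra.
have srho : s <= rho - cmod (c - z0) by rewrite ge_min lexx orbT.
have [Fc _] := hF c crho.
have Hcont : ccont H c.
  apply: ctendsD; apply: ctendsM; try exact: ctends_cst.
    by apply: ctendsM => //; exact: ctends_cst.
  apply: ctendsM; first exact: ctends_cst.
  by apply: ctendsB; [exact: ccont_id|exact: ctends_cst].
have Hhol : exists G, forall w, 0 < cmod (w - c) < e -> cderiv H w (G w) /\ ccont G w.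
  exists (fun w => (0 * (conjc (F c) * F w) + (2 : R)%:C * (0 * F w + conjc (F c) * dF w)) +
     (0 * (conjc (c - z0) * (w - c)) + (2 * eps)%:C * (0 * (w - c) + conjc (c - z0) * (1 + - 0)))).
  move=> w /HF[dw cw]; have Fw := cderiv_cont dw; split.
    apply: cderivD; apply: cderivM; try exact: cderiv_cst.
      by apply: cderivM => //; exact: cderiv_cst.
    apply: cderivM; first exact: cderiv_cst.
    apply: cderivD; first exact: cderiv_id.
    rewrite oppr0; exact: cderiv_cst.
  have cw' : ccont (fun w => w - c) w by apply: ctendsB; [exact: ccont_id|exact: ctends_cst].
  apply: ctendsD.
    apply: ctendsD; apply: ctendsM; try exact: ctends_cst.
      by apply: ctendsM; [exact: ctends_cst|exact: Fw].
    by apply: ctendsD; apply: ctendsM; first [exact: ctends_cst|exact: Fw|exact: cw].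
  apply: ctendsD; apply: ctendsM; try exact: ctends_cst.
    by apply: ctendsM; [exact: ctends_cst|exact: cw'].
  by apply: ctendsD; apply: ctendsM; first [exact: ctends_cst|exact: cw'].
have mv := mean_value Hcont Hhol (s := s); rewrite s0 se Hcc in mv; have {}mv := mv isT.
have : \int[lebesgue_measure]_(x in `[0, 2 * pi]) complex.Re (H (circ c s x)) <=
       \int[lebesgue_measure]_(x in `[0, 2 * pi]) (2 * cmod (F c) ^+ 2 - eps * s ^+ 2).
  apply: le_Rintegral => //.
  - apply: integrable_D => x; apply: ctends_Re; apply: circ_continuous => y.
    case: Hhol => dH /(_ (circ c s y)); rewrite cmod_circ gtr0_norm// s0 se => /(_ isT)[].
    by move/cderiv_cont.
  - by apply: integrable_D => x; exact: cvg_cst.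
  move=> x _; have := HE (circ c s x); rewrite cmod_circ gtr0_norm//; apply.
  apply: le_trans (cmod_triangle _ c _) _; rewrite cmod_circ gtr0_norm//.
  by rewrite -lerBrDr.
rewrite mv Rintegral_D_cst ler_pM2l ?pi2_gt0// lerBrDr gerDl => /(lt_le_trans _).
by move=> /(_ _ (mulr_gt0 eps0 (exprn_gt0 2 s0))); rewrite ltxx.
Qed.

(** Schwarz's lemma in the form used below: the difference quotient has only a removable point at
    [a], so a bound on the circle spreads inwards, to its value [l] at [a] as well. *)
Lemma dquot_bound F a l z0 (rho B : R) : 0 < rho -> cmod (a - z0) < rho ->
  (forall z, cmod (z - z0) <= rho -> phol F z) -> cderiv F a l ->
  (forall z, cmod (z - z0) = rho -> cmod (F z - F a) <= B * cmod (z - a)) ->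
  forall z, cmod (z - z0) <= rho -> cmod (dquot F a l z) <= B.
Proof.
move=> rho0 ar hF dF FB; apply: max_principle => //.
  move=> z zr; have [->|za] := eqVneq z a; last first.
    by apply: dquot_phol_neq => //; exact: hF.
  apply: dquot_phol => //; exists (rho - cmod (a - z0)); first by rewrite /= subr_gt0.
  move=> w /= wa; apply: hF; apply: le_trans (cmod_triangle w a z0) _.
  by rewrite -lerBrDr ltW.
move=> z zr; have za : z != a by apply: contraTneq ar => <-; rewrite zr ltxx.
rewrite /dquot (negbTE za) cmodM cmodV ler_pdivrMr; first exact: FB.
by rewrite cmod_gt0 subr_eq0.
Qed.

(** On the outer circle [|F z - F a| <= 2 M] and [|z - a| >= rho - rho']; [dquot_bound] carries the
    ratio inside. *)
Lemma cauchy_estimate F a l z0 c (rho rho' M : R) : 0 < rho' -> rho' < rho ->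
  cmod (a - z0) <= rho' ->
  (forall z, cmod (z - z0) <= rho -> phol F z) -> cderiv F a l ->
  (forall z, cmod (z - z0) <= rho -> cmod (F z - c) <= M) ->
  cmod l <= 2 * M / (rho - rho') /\
  forall z, cmod (z - z0) <= rho -> cmod (F z - F a) <= 2 * M / (rho - rho') * cmod (z - a).
Proof.
move=> r'0 r'r ar hF dF FM; have rho0 : 0 < rho by lra.
have rr0 : 0 < rho - rho' by rewrite subr_gt0.
have M0 : 0 <= M by apply: le_trans (FM z0 _); rewrite ?cmod_ge0// subrr cmod0 ltW.
have ar' : cmod (a - z0) < rho by exact: le_lt_trans r'r.
have H := dquot_bound (B := 2 * M / (rho - rho')) rho0 ar' hF dF.
have {}H : forall z, cmod (z - z0) <= rho -> cmod (dquot F a l z) <= 2 * M / (rho - rho').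
  apply: H => z zr; apply: (@le_trans _ _ (2 * M)).
    apply: le_trans (cmod_triangle (F z) c (F a)) _.
    have := FM z; rewrite zr => /(_ (lexx _)); have := FM a (ltW ar').
    by rewrite (cmodB c); lra.
  rewrite mulrAC ler_pdivlMr// ler_wpM2l ?mulr_ge0//.
  have := cmod_triangle z a z0; rewrite zr; lra.
split; first by have := H a (ltW ar'); rewrite /dquot eqxx.
move=> z zr; have := H z zr; rewrite /dquot; case: eqVneq => [->|za].
  by rewrite !subrr cmod0 mulr0.
by rewrite cmodM cmodV ler_pdivrMr// cmod_gt0 subr_eq0.
Qed.

End MaximumPrinciple.

(** * Koebe distortion *)

Section SquareRoot.
Context {R : realType}.
Implicit Types (F G S : R[i] -> R[i]) (z w l m : R[i]).

(** The principal root: [w + |w|] has half the argument of [w], and the denominator corrects its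
    modulus to the square root of [|w|]. *)
Definition psqrt (w : R[i]) : R[i] :=
  (w + (cmod w)%:C) / (Num.sqrt (2 * (cmod w + complex.Re w)))%:C.

Lemma psqrtK w : 0 < complex.Re w -> psqrt w ^+ 2 = w.
Proof.
move=> w0; have c0 : 0 < cmod w + complex.Re w by rewrite ltr_wpDl ?cmod_ge0.
rewrite /psqrt expr_div_n -rmorphXn /= sqr_sqrtr; last by rewrite ltW// mulr_gt0.
have nz : (2 * (cmod w + complex.Re w))%:C != 0 :> R[i].
  by rewrite -cmod_eq0 cmodR normr_eq0 gt_eqF// mulr_gt0.
apply: (mulIf nz); rewrite divfK//.
have := cmod_sqr w; move: (cmod w) => c.
case: w {w0 c0 nz} => a b /= h; apply/eqP; rewrite eq_complex /=.
by apply/andP; split; apply/eqP; ring: h.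
Qed.

Lemma psqrt1 : psqrt 1 = 1.
Proof.
have e : 2 * (1 + 1) = 2 ^+ 2 :> R by ring.
rewrite /psqrt cmod1 /= e sqrtr_sqr ger0_norm// -[1%:C]/(1 : R[i]).
have -> : (2 : R)%:C = 1 + 1 by rewrite -[2]/(1 + 1) rmorphD rmorph1.
by rewrite divff// (pnatr_eq0 _ 2).
Qed.

Lemma psqrt_cont w : 0 < complex.Re w -> ccont psqrt w.
Proof.
move=> w0; have c0 : 0 < cmod w + complex.Re w by rewrite ltr_wpDl ?cmod_ge0.
have hc : cmod v @[v --> cnbhs w] --> cmod w.
  by apply: ctends_cmod; exact: ccont_id.
have hr : complex.Re v @[v --> cnbhs w] --> complex.Re w.
  by apply: ctends_Re; exact: ccont_id.
apply: ctendsM; first by apply: ctendsD; [exact: ccont_id|exact: ctends_RtoC].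
apply: ctendsV.
  by rewrite -cmod_eq0 cmodR normr_eq0 gt_eqF// sqrtr_gt0 mulr_gt0.
apply: ctends_RtoC; apply: (cvg_comp _ _ (G := nbhs (2 * (cmod w + complex.Re w)))).
  by apply: (@cvgRM _ _ (cnbhs w)); [exact: cvg_cst|exact: (@cvgRD _ _ (cnbhs w))].
exact: sqrt_continuous.
Qed.

(** The segment from [z0] to [z] is cut into [N] equal pieces, so short that successive ratios of
    [F] lie in the right half-plane, where [psqrt] is continuous. The product of the roots of these
    ratios squares to a telescoping product. Continuity in [z] follows because one [N] serves the
    whole disc. *)
Lemma continuous_sqrt_exists F z0 (rho r : R) : 0 < r -> r < rho ->
  (forall z, cmod (z - z0) <= rho -> phol F z) ->
  (forall z, cmod (z - z0) <= r -> exists l, cderiv F z l) ->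
  (forall z, cmod (z - z0) <= r -> F z != 0) -> F z0 = 1 ->
  exists S, [/\ S z0 = 1, forall z, cmod (z - z0) <= r -> S z ^+ 2 = F z &
     forall z, cmod (z - z0) <= r -> ccont S z].
Proof.
move=> r0 rr hF dF F0 F1.
have cF z : 0 <= cmod (z - z0) <= rho -> cmod (F w) @[w --> cnbhs z] --> cmod (F z).
  by move=> /andP[_ /hF[Fc _]]; exact: ctends_cmod.
have ab : 0 <= (0 : R) <= rho by rewrite lexx /=; lra.
have [cM _ HM] := circ_attains_max ab cF.
have cF' z : 0 <= cmod (z - z0) <= r -> cmod (F w) @[w --> cnbhs z] --> cmod (F z).
  by move=> /andP[? ?]; apply: cF; apply/andP; split=> //; lra.
have ab' : 0 <= (0 : R) <= r by rewrite lexx ltW.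
have [cm /andP[_ cmr] Hm] := circ_attains_min ab' cF'.
pose m := cmod (F cm); have m0 : 0 < m by rewrite cmod_gt0 F0.
pose L := 2 * cmod (F cM) / (rho - r).
have L0 : 0 <= L by rewrite divr_ge0 ?mulr_ge0 ?cmod_ge0// subr_ge0 ltW.
have lip z w : cmod (z - z0) <= r -> cmod (w - z0) <= r -> cmod (F z - F w) <= L * cmod (z - w).
  move=> zr wr; have [l dl] := dF w wr.
  have [|_] := @cauchy_estimate _ F w l z0 0 rho r (cmod (F cM)) r0 rr wr hF dl.
    by move=> v vr; rewrite subr0; apply: HM; rewrite cmod_ge0.
  by apply; lra.
(* [L] is a Lipschitz constant and [m] the minimum of [|F|] on the disc: consecutive values of [F]
   then differ by at most [m / 2], which puts each ratio within 1/2 of 1. *)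
pose N := (Num.truncn (2 * L * r / m)).+1.
have NE : L * (r / N%:R) <= m / 2.
  have : 2 * L * r / m < N%:R by rewrite truncnS_gt.
  rewrite ltr_pdivrMr// => /ltW h.
  have N0 : 0 < N%:R :> R by rewrite ltr0n.
  rewrite mulrA ler_pdivrMr//; lra.
pose p z (j : nat) := z0 + (j%:R / N%:R : R)%:C * (z - z0).
have N0 : N%:R != 0 :> R by rewrite pnatr_eq0.
have p0 z : p z 0 = z0 by rewrite /p mul0r rmorph0 mul0r addr0.
have pN z : p z N = z by rewrite /p divff// rmorph1 mul1r addrC subrK.
have pr z (j : nat) : (j <= N)%N -> cmod (z - z0) <= r -> cmod (p z j - z0) <= r.
  move=> jN zr; rewrite /p addrAC subrr add0r cmodM cmodR ger0_norm ?divr_ge0//.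
  apply: le_trans zr; rewrite ler_piMl ?cmod_ge0// ler_pdivrMr ?ltr0n// mul1r ler_nat//.
have pd z (j : nat) : cmod (z - z0) <= r -> cmod (p z j.+1 - p z j) <= r / N%:R.
  move=> zr; rewrite (_ : p z j.+1 - p z j = (N%:R^-1 : R)%:C * (z - z0)).
    rewrite cmodM cmodR ger0_norm ?invr_ge0// mulrC ler_wpM2r// invr_ge0//.
  rewrite /p -[N%:R^-1]mul1r -natr1 mulrDl rmorphD/=; ring.
have pc j z : ccont (p ^~ j) z.
  apply: ctendsD; first exact: ctends_cst.
  apply: ctendsM; first exact: ctends_cst.
  by apply: ctendsB; [exact: ccont_id|exact: ctends_cst].
pose q z j := F (p z j.+1) / F (p z j).
have qre z (j : nat) : (j < N)%N -> cmod (z - z0) <= r -> 0 < complex.Re (q z j).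
  move=> jN zr; have F0j := F0 _ (pr z j (ltnW jN) zr).
  have h : cmod (q z j - 1) <= 1 / 2.
    rewrite /q (_ : _ - 1 = (F (p z j.+1) - F (p z j)) / F (p z j)); last by field.
    rewrite cmodM cmodV ler_pdivrMr ?cmod_gt0//.
    apply: (@le_trans _ _ (m / 2)); last first.
      have := Hm (p z j); rewrite -/m cmod_ge0 pr 1?ltnW// => /(_ isT); lra.
    apply: le_trans NE; apply: le_trans (lip _ _ _ _) _; rewrite ?pr// 1?ltnW//.
    by rewrite ler_wpM2l// pd.
  have := Re_le_cmod (q z j - 1); rewrite ReB /= => h2.
  have := le_trans h2 h; rewrite ler_norml; lra.
pose S z := \prod_(j < N) psqrt (q z j).
exists S; split.
- rewrite /S big1// => j _; rewrite /q.
  have pz0 i : p z0 i = z0 by rewrite /p subrr mulr0 addr0.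
  by rewrite !pz0 F1 divr1 psqrt1.
- move=> z zr; rewrite /S -prodrXl.
  under eq_bigr => j _ do rewrite psqrtK ?qre//.
  suff H n : (n <= N)%N -> \prod_(j < n) q z j = F (p z n) by rewrite H// pN.
  elim: n => [|n IHn] nN; first by rewrite big_ord0 p0 F1.
  rewrite big_ord_recr /= IHn 1?ltnW// /q mulrC divfK//.
  by apply: F0; apply: pr => //; rewrite ltnW.
- move=> z zr.
  suff H (n : nat) : (n <= N)%N -> ccont (fun z => \prod_(j < n) psqrt (q z j)) z by exact: H.
  elim: n => [|n IHn] nN.
    by under eq_fun do rewrite big_ord0; exact: ctends_cst.
  rewrite /ccont big_ord_recr /=; under eq_fun do rewrite big_ord_recr /=.
  apply: ctendsM; first by apply: IHn; rewrite ltnW.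
  have Fcp i : (i <= N)%N -> ccont (fun z => F (p z i)) z.
    move=> iN; apply: ccont_comp; first exact: pc.
    by have [] := hF (p z i) (le_trans (pr z i iN zr) (ltW rr)).
  apply: (ccont_comp (f := q ^~ n)); last by apply: psqrt_cont; exact: qre.
  apply: ctendsM; first exact: Fcp.
  by apply: ctendsV; [apply: F0; apply: pr => //; exact: ltnW|apply: Fcp; exact: ltnW].
Qed.

End SquareRoot.

Section ZeroDerivative.
Context {R : realType}.
Implicit Types (F G : R[i] -> R[i]) (z w l m : R[i]).

Lemma Re_cst_of_deriv0 F z0 (x a b : R) : a <= b ->
  (forall s, a <= s <= b -> cderiv F (circ z0 s x) 0) ->
  complex.Re (F (circ z0 a x)) = complex.Re (F (circ z0 b x)).
Proof.
move=> ab dF.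
pose f (s : R) := complex.Re (F (circ z0 s x)).
have df (s : R) : a <= s <= b -> is_derive s 1 f 0.
  by move=> /dF /circ_derive_s; rewrite mul0r.
have df' (s : R) : s \in `]a, b[ -> is_derive s 1 f 0.
  by rewrite in_itv /= => /andP[? ?]; apply: df; rewrite !ltW.
have fc : {within `[a, b], continuous f}.
  apply/continuous_in_subspaceT => s; rewrite inE /= in_itv/= => sab.
  by apply: differentiable_continuous; apply/derivable1_diffP; case: (df s sab).
have [c _] := MVT_segment ab df' fc.
by rewrite mul0r => /eqP; rewrite subr_eq0 => /eqP.
Qed.

Lemma cst_of_deriv0 F z0 (x a b : R) : a <= b ->
  (forall s, a <= s <= b -> cderiv F (circ z0 s x) 0) ->
  F (circ z0 a x) = F (circ z0 b x).
Proof.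
move=> ab dF; have re := Re_cst_of_deriv0 ab dF.
have dF' s : a <= s <= b -> cderiv (fun w => - 'i%C * F w) (circ z0 s x) 0.
  move=> sab; rewrite -[X in cderiv _ _ X](_ : 0 * F (circ z0 s x) + - 'i%C * 0 = 0); last by ring.
  by apply: cderivM; [exact: cderiv_cst|exact: dF].
have := Re_cst_of_deriv0 ab dF'.
rewrite !ReM /= !oppr0 !mul0r !sub0r !mulN1r !opprK => im.
by apply/eqP; rewrite eq_complex re im !eqxx.
Qed.

End ZeroDerivative.

Section Koebe.
Context {R : realType}.
Variables (h dh : R[i] -> R[i]) (z0 : R[i]) (d : R).
Hypothesis d0 : 0 < d.
Hypothesis dhP : forall z, cmod (z - z0) < d -> cderiv h z (dh z) /\ ccont dh z.
Hypothesis hinj : forall z w, cmod (z - z0) < d -> cmod (w - z0) < d -> h z = h w -> z = w.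

Let chol_h z : cmod (z - z0) < d -> chol (cnbhs z) h.
Proof.
move=> zd; exists dh; exists (d - cmod (z - z0)); first by rewrite /= subr_gt0.
move=> w /= wz; apply: dhP; apply: le_lt_trans (cmod_triangle w z z0) _.
by rewrite -ltrBrDr.
Qed.

Let phol_h z : cmod (z - z0) < d -> phol h z.
Proof. by move=> /chol_h; exact: chol_phol. Qed.

Let cont_h c z : cmod (z - z0) < d -> cmod (h w - c) @[w --> cnbhs z] --> cmod (h z - c).
Proof.
move=> zd; apply: ctends_cmod; apply: ctendsB; last exact: ctends_cst.
by have [] := phol_h zd.
Qed.

Let s := d / 2.
Let s0 : 0 < s. Proof. by rewrite divr_gt0. Qed.
Let sd : s < d. Proof. by rewrite /s; have := d0; lra. Qed.

Lemma circle_min : exists z1, [/\ cmod (z1 - z0) = s, 0 < cmod (h z1 - h z0) &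
  forall z, cmod (z - z0) = s -> cmod (h z1 - h z0) <= cmod (h z - h z0)].
Proof.
have [||z1 /andP[z1a z1b] H] := @circ_attains_min _ (fun z => cmod (h z - h z0)) z0 s s.
- by rewrite ltW// lexx.
- by move=> z /andP[_ zs]; apply: cont_h; apply: le_lt_trans sd.
exists z1; have z1s : cmod (z1 - z0) = s by apply/eqP; rewrite eq_le z1a z1b.
split=> //; last by move=> z zs; apply: H; rewrite zs lexx.
rewrite cmod_gt0 subr_eq0; apply/eqP => /(hinj _ _) z10.
have := z10; rewrite z1s subrr cmod0 sd d0 => /(_ isT isT) z1z0.
by have := s0; rewrite -z1s z1z0 subrr cmod0 ltxx.
Qed.

(* [z - a] over [h z - h a] is holomorphic across [a] once [h' a <> 0]. *)
Lemma deriv_lower_bound (a : R[i]) (mu : R) : 0 < mu -> cmod (a - z0) < s -> dh a != 0 ->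
  (forall z, cmod (z - z0) = s -> mu <= cmod (h z - h a)) -> mu <= 2 * s * cmod (dh a).
Proof.
move=> mu0 as0 dha Hmu.
have ad : cmod (a - z0) < d by exact: lt_trans sd.
have [da _] := dhP ad.
pose Q := dquot h a (dh a).
have Q0 z : cmod (z - z0) <= s -> Q z != 0.
  move=> zs; rewrite /Q /dquot; case: (eqVneq z a) => [//|za].
  apply: mulf_neq0; last by rewrite invr_eq0 subr_eq0.
  rewrite subr_eq0; apply: contra_neq za => /hinj; apply=> //; exact: le_lt_trans sd.
have hQ z : cmod (z - z0) <= s -> phol (fun w => (Q w)^-1) z.
  move=> zs; apply: pholV; first exact: Q0.
  have zd : cmod (z - z0) < d by exact: le_lt_trans sd.
  have [->|za] := eqVneq z a; last by apply: dquot_phol_neq => //; exact: phol_h.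
  apply: dquot_phol => //; exists (d - cmod (a - z0)); first by rewrite /= subr_gt0.
  move=> w /= wa; apply: phol_h; apply: le_lt_trans (cmod_triangle w a z0) _.
  by rewrite -ltrBrDr.
have as1 : cmod (a - z0) <= s by exact: ltW.
have bd z : cmod (z - z0) = s -> cmod (Q z)^-1 <= 2 * s / mu.
  move=> zs; have za : z != a by apply: contraTneq as0 => <-; rewrite zs ltxx.
  rewrite /Q /dquot (negbTE za) cmodV cmodM cmodV invfM invrK mulrC.
  rewrite ler_pM ?cmod_ge0 ?invr_ge0 ?cmod_ge0//.
    by have := cmod_triangle z z0 a; rewrite zs (cmodB z0 a); have := as0; lra.
  by rewrite lef_pV2 ?posrE//; [exact: Hmu|apply: lt_le_trans mu0 (Hmu z zs)].
have := max_principle s0 hQ bd as1.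
rewrite /Q /dquot eqxx cmodV => h1.
have dh0 : 0 < cmod (dh a) by rewrite cmod_gt0.
move: h1; rewrite -(ler_pM2l dh0) mulfV ?gt_eqF// mulrA ler_pdivlMr// mul1r; lra.
Qed.

(** If [dh z0 = 0], then [|dh| < mu / (8 s)] near [z0] by continuity, whereas [deriv_lower_bound]
    gives [|dh a| >= mu / (4 s)] at every nearby [a] with [dh a <> 0]. Hence [dh] vanishes near [z0]
    and [h] is constant along a short ray, against injectivity. *)
Lemma deriv_neq0_center : dh z0 != 0.
Proof.
have [z1 [z1s mu0 Hmu]] := circle_min; set mu := cmod (h z1 - h z0) in mu0 Hmu.
have z00 : cmod (z0 - z0) < d by rewrite subrr cmod0.
have [dz cz] := dhP z00; apply/eqP => dh0.
have e1 : 0 < mu / (8 * s) by rewrite divr_gt0// mulr_gt0.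
have [r1 /= r10 H1] := cz _ e1.
have [hc _] := phol_h z00.
have [r2 /= r20 H2] := hc (mu / 2) (divr_gt0 mu0 (ltr0Sn _ 1)).
pose r := Num.min s (Num.min r1 r2) / 2.
have r0 : 0 < r by rewrite divr_gt0// !lt_min s0 r10.
have rs : r < s /\ r < r1 /\ r < r2.
  have : Num.min s (Num.min r1 r2) <= s by rewrite ge_min lexx.
  have : Num.min s (Num.min r1 r2) <= r1 by rewrite !ge_min lexx orbT.
  have : Num.min s (Num.min r1 r2) <= r2 by rewrite !ge_min lexx !orbT.
  by move: r0; rewrite /r; lra.
have dh_0 a : cmod (a - z0) <= r -> dh a = 0.
  move=> ar; apply/eqP/negPn/negP => dha.
  have := @deriv_lower_bound a (mu / 2) _ _ dha.
  have m2 : 0 < mu / 2 by rewrite divr_gt0.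
  have as0 : cmod (a - z0) < s by lra.
  move=> /(_ m2 as0) H.
  have {}H : mu / 2 <= 2 * s * cmod (dh a).
    apply: H => z zs; have := Hmu z zs.
    have := cmod_triangle (h z) (h a) (h z0); have := H2 a; rewrite /=.
    have ar2 : cmod (a - z0) < r2 by lra.
    move=> /(_ ar2); lra.
  have := H1 a; rewrite /= dh0 subr0; have ar1 : cmod (a - z0) < r1 by lra.
  move=> /(_ ar1); rewrite ltr_pdivlMr ?mulr_gt0//; lra.
have ab : (0 : R) <= r by exact: ltW.
have := @cst_of_deriv0 _ h z0 0 0 r ab.
have H t : 0 <= t <= r -> cderiv h (circ z0 t 0) 0.
  move=> /andP[t0 tr]; rewrite -(dh_0 (circ z0 t 0)); last by rewrite cmod_circ ger0_norm.
  by apply dhP; rewrite cmod_circ ger0_norm//; have := sd; lra.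
move=> /(_ H) /hinj; rewrite !cmod_circ normr0 gtr0_norm// d0.
have rd : r < d by have := sd; lra.
rewrite rd => /(_ isT isT) /(congr1 (fun z => cmod (z - z0))).
by rewrite !cmod_circ normr0 gtr0_norm// => r00; move: r0; rewrite -r00 ltxx.
Qed.

End Koebe.

Section KoebeDistortion.
Context {R : realType}.
Variables (h dh : R[i] -> R[i]) (z0 : R[i]) (d : R).
Hypothesis d0 : 0 < d.
Hypothesis dhP : forall z, cmod (z - z0) < d -> cderiv h z (dh z) /\ ccont dh z.
Hypothesis hinj : forall z w, cmod (z - z0) < d -> cmod (w - z0) < d -> h z = h w -> z = w.

End KoebeDistortion.

Section SqrtHolomorphic.
Context {R : realType}.

Lemma cderiv_of_sqr (S F : R[i] -> R[i]) z l :
  (\forall w \near cnbhs z, S w ^+ 2 = F w) -> ccont S z -> S z != 0 ->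
  cderiv F z l -> cderiv S z (l / (2 * S z)).
Proof.
move=> SF Sc S0 [q [qc ql qE]].
have SFz := cnbhs_self SF.
have S20 : S z + S z != 0 by rewrite -mulr2n mulrn_eq0.
have c2 : ccont (fun w => S w + S z) z by apply: ctendsD => //; exact: ctends_cst.
apply/cderivP.
have : ctends (cnbhs' z) (fun w => q w / (S w + S z)) (l / (2 * S z)).
  rewrite (_ : 2 * S z = S z + S z); last by ring.
  by rewrite -ql; apply: ctends_within; apply: ctendsM => //; exact: ctendsV.
apply: ctends_near; near=> w.
have wz : w - z != 0 by rewrite subr_eq0; near: w; exact: cnbhs'_neq.
have Sw : S w + S z != 0.
  by near: w; apply: cnbhs'_cnbhs; exact: (ccont_neq0 c2).
have SFw : S w ^+ 2 = F w by near: w; exact: cnbhs'_cnbhs.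
have h : (S w - S z) * (S w + S z) = q w * (w - z) by rewrite -qE -SFw -SFz; ring.
apply: (mulIf Sw); rewrite divfK//; apply: (mulIf wz).
by rewrite -h; field.
Unshelve. all: by end_near. Qed.

End SqrtHolomorphic.

Section Koebe.
Context {R : realType}.
Variables (h dh : R[i] -> R[i]) (z0 : R[i]) (d : R).
Hypothesis d0 : 0 < d.
Hypothesis dhP : forall z, cmod (z - z0) < d -> cderiv h z (dh z) /\ ccont dh z.
Hypothesis hinj : forall z w, cmod (z - z0) < d -> cmod (w - z0) < d -> h z = h w -> z = w.

Let chol_h z : cmod (z - z0) < d -> chol (cnbhs z) h.
Proof.
move=> zd; exists dh; exists (d - cmod (z - z0)); first by rewrite /= subr_gt0.
move=> w /= wz; apply: dhP; apply: le_lt_trans (cmod_triangle w z z0) _.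
by rewrite -ltrBrDr.
Qed.

Let phol_h z : cmod (z - z0) < d -> phol h z.
Proof. by move=> /chol_h; exact: chol_phol. Qed.

Let s := d / 2.
Let s0 : 0 < s. Proof. by rewrite divr_gt0. Qed.
Let sd : s < d. Proof. by rewrite /s; have := d0; lra. Qed.

(* If [v] is the value of [h - h z0] of least modulus on the circle of radius
   [s], then [F = 1 - (h - h z0) / v] omits 0 inside, and its square root [S]
   omits a neighbourhood of -1: values near 1 are taken by [S] (maximum
   principle for [1 / (S - sigma)]) and [S z = - S w] would contradict
   injectivity. *)
Lemma koebe_growth (mu : R) z1 : cmod (z1 - z0) = s -> mu = cmod (h z1 - h z0) -> 0 < mu ->
  (forall z, cmod (z - z0) = s -> mu <= cmod (h z - h z0)) ->
  forall z, cmod (z - z0) <= s / 132 -> cmod (h z - h z0) <= 10 * mu.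
Proof.
move=> z1s muE mu0 Hmu.
pose v := h z1 - h z0; have v0 : v != 0 by rewrite -cmod_gt0 -muE.
pose F z := 1 + - v^-1 * (h z - h z0).
have FE z : h z - h z0 = v * (1 - F z) by rewrite /F; field.
have Fz0 : F z0 = 1 by rewrite /F subrr mulr0 addr0.
have Finj z w : cmod (z - z0) < d -> cmod (w - z0) < d -> F z = F w -> z = w.
  move=> zd wd Fzw; apply: hinj => //.
  by apply: (@addIr _ (- h z0)); rewrite !FE Fzw.
have F0 z : cmod (z - z0) < s -> F z != 0.
  move=> zs; apply/eqP => Fz.
  have : z = z1; last by move=> zz1; move: zs; rewrite zz1 z1s ltxx.
  apply: Finj; [exact: lt_trans sd|by rewrite z1s|].
  by rewrite Fz /F -/v mulNr mulVf// subrr.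
have dF z : cmod (z - z0) < d -> cderiv F z (0 + (0 * (h z - h z0) + - v^-1 * (dh z + 0))).
  move=> zd; apply: cderivD; first exact: cderiv_cst.
  apply: cderivM; first exact: cderiv_cst.
  by apply: cderivD; [apply dhP|exact: cderiv_cst].
have hF z : cmod (z - z0) < d -> phol F z.
  move=> zd; apply: pholD; first exact: phol_cst.
  apply: pholM; first exact: phol_cst.
  by apply: pholD; [exact: phol_h|exact: phol_cst].
have cF z : cmod (z - z0) < d -> chol (cnbhs z) F.
  move=> zd; apply: cholD; first exact: chol_cst.
  apply: cholM; first exact: chol_cst.
  by apply: cholD; [exact: chol_h|exact: chol_cst].
(* [F] vanishes at [z1], on the circle of radius [s], so its root is only available strictly inside.
   On that circle [|1 - F| >= 1], and a Lipschitz bound on [h] leaves at least 1/2 on a slightly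
   smaller one. *)
have [r /andP[r0 rs] Hr] : exists2 r : R, s / 2 <= r < s &
    forall z, cmod (z - z0) = r -> 1 / 2 <= cmod (1 - F z).
  have cc z : 0 <= cmod (z - z0) <= s -> cmod (h w - h z0) @[w --> cnbhs z] --> cmod (h z - h z0).
    move=> /andP[_ zs]; apply: ctends_cmod; apply: ctendsB; last exact: ctends_cst.
    by have [] := phol_h (le_lt_trans zs sd).
  pose t := (s + d) / 2.
  have st : s < t by rewrite /t; have := sd; lra.
  have td : t < d by rewrite /t; have := sd; lra.
  have ct z : 0 <= cmod (z - z0) <= t -> cmod (h w - h z0) @[w --> cnbhs z] --> cmod (h z - h z0).
    move=> /andP[_ zs]; apply: ctends_cmod; apply: ctendsB; last exact: ctends_cst.
    by have [] := phol_h (le_lt_trans zs td).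
  have t0 : 0 <= (0 : R) <= t by rewrite lexx /=; have := s0; lra.
  have [cM _ HM] := circ_attains_max t0 ct.
  pose M := cmod (h cM - h z0).
  pose L := 2 * M / (t - s).
  have L0 : 0 <= L by rewrite divr_ge0 ?mulr_ge0 ?cmod_ge0// subr_ge0 ltW.
  have lip z w : cmod (z - z0) <= s -> cmod (w - z0) <= s -> cmod (h z - h w) <= L * cmod (z - w).
    move=> zs ws; have [dw _] := dhP (le_lt_trans ws sd).
    have hF' u : cmod (u - z0) <= t -> phol h u by move=> ut; apply: phol_h; exact: le_lt_trans td.
    have hM u : cmod (u - z0) <= t -> cmod (h u - h z0) <= M.
      by move=> ut; apply: HM; rewrite cmod_ge0.
    have [_] := cauchy_estimate s0 st ws hF' dw hM; apply; lra.
  pose e := Num.min (s / 2) (mu / (2 * L + 2)).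
  have e0 : 0 < e by rewrite lt_min !divr_gt0//; lra.
  have es : e <= s / 2 by rewrite ge_min lexx.
  have eL : L * e <= mu / 2.
    have : e <= mu / (2 * L + 2) by rewrite ge_min lexx orbT.
    rewrite ler_pdivlMr; last by lra.
    by move=> H; have := mulr_ge0 L0 (ltW e0); lra.
  exists (s - e); first by apply/andP; split; lra.
  move=> z zr; have [x _ zx] := circ_surj z0 z; rewrite zr in zx.
  pose w := circ z0 s x.
  have ws : cmod (w - z0) = s by rewrite cmod_circ gtr0_norm.
  have wz : cmod (z - w) = e.
    rewrite zx /w /circ (_ : _ - _ = (- e)%:C * expi x); last by rewrite rmorphB rmorphN/=; ring.
    by rewrite cmodM cmod_expi mulr1 cmodR normrN gtr0_norm.
  have h1 : mu / 2 <= cmod (h z - h z0).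
    have := Hmu w ws; have := cmod_triangle (h w) (h z) (h z0); rewrite (cmodB (h w) (h z)).
    have : cmod (h z - h w) <= L * cmod (z - w) by apply: lip; lra.
    rewrite wz; lra.
  by move: h1; rewrite FE cmodM /v -muE => h1; rewrite -(ler_pM2l mu0); lra.
pose s1 := (r + s) / 2.
have rs1 : r < s1 by rewrite /s1; lra.
have s1s : s1 < s by rewrite /s1; lra.
have rr0 : 0 < r by have := s0; lra.
have s10 : 0 < s1 by lra.
have [||||S [S0 S2 Sc]] := @continuous_sqrt_exists _ F z0 s s1 s10 s1s.
- by move=> z zs; apply: hF; exact: le_lt_trans sd.
- by move=> z zs; eexists; apply: dF; have := sd; lra.
- by move=> z zs; apply: F0; exact: le_lt_trans s1s.
- by [].
have Sn0 z : cmod (z - z0) <= s1 -> S z != 0.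
  move=> zs; have : F z != 0 by apply: F0; exact: le_lt_trans s1s.
  by rewrite -S2// expf_eq0.
have near_disc z : cmod (z - z0) < s1 -> \forall w \near cnbhs z, cmod (w - z0) < s1.
  move=> zs; exists (s1 - cmod (z - z0)); first by rewrite /= subr_gt0.
  by move=> w /= wz; apply: le_lt_trans (cmod_triangle w z z0) _; rewrite -ltrBrDr.
have dS z l : cmod (z - z0) < s1 -> cderiv F z l -> cderiv S z (l / (2 * S z)).
  move=> zs; apply: cderiv_of_sqr; [|by apply: Sc; exact: ltW|by apply: Sn0; exact: ltW].
  by apply: filterS (near_disc _ zs) => w ws; apply: S2; exact: ltW.
have hS z : cmod (z - z0) < s1 -> phol S z.
  move=> zs; apply: chol_phol.
  have zd : cmod (z - z0) < d by have := sd; lra.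
  have [G HG] := cF z zd; exists (fun w => G w / (2 * S w)).
  apply: filterS2 (near_disc _ zs) HG => w ws [dw cw]; split; first exact: dS.
  apply: ctendsM => //; apply: ctendsV.
    by rewrite mulf_neq0 ?pnatr_eq0// Sn0// ltW.
  by apply: ctendsM; [exact: ctends_cst|apply: Sc; exact: ltW].
have Sinj z w : cmod (z - z0) <= s1 -> cmod (w - z0) <= s1 -> S z = - S w -> False.
  move=> zs ws SS; have zw : z = w.
    apply: Finj; [by have := sd; lra|by have := sd; lra|].
    by rewrite -!S2// SS sqrrN.
  move/eqP: SS; rewrite zw -addr_eq0 -mulr2n mulrn_eq0 /=.
  by rewrite (negbTE (Sn0 w ws)).
have Sfar z : cmod (z - z0) <= r -> 1 / 16 <= cmod (S z + 1).
  move=> zr; rewrite leNgt; apply/negP => lt16.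
  pose sg := - S z.
  have sg1 : cmod (1 - sg) < 1 / 16 by rewrite /sg opprK addrC.
  have nz w : cmod (w - z0) <= r -> S w - sg != 0.
    by move=> wr; rewrite subr_eq0; apply/eqP => /Sinj; apply; lra.
  have hV w : cmod (w - z0) <= r -> phol (fun u => (S u - sg)^-1) w.
    move=> wr; apply: pholV; first exact: nz.
    by apply: pholB; [apply: hS; lra|exact: phol_cst].
  have bd w : cmod (w - z0) = r -> cmod (S w - sg)^-1 <= 16.
    move=> wr; have wr' : cmod (w - z0) <= s1 by lra.
    have n0 : 0 < cmod (S w - sg) by rewrite cmod_gt0 nz// wr.
    rewrite cmodV -[16]invrK lef_pV2 ?posrE ?invr_gt0//.
    (* Why 1/16 is small enough: [S w] within 1/16 of [sg] lies within 1/8 of 1, so that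
       [|1 - F w| = |S w - 1| |S w + 1|] is below [17 / 64 < 1 / 2], against the choice of [r]. *)
    rewrite leNgt; apply/negP => lt.
    have a1 : cmod (S w - 1) < 1 / 8.
      have := cmod_triangle (S w) sg 1; rewrite (cmodB sg 1); lra.
    have a2 : cmod (S w + 1) < 17 / 8.
      rewrite (_ : S w + 1 = (S w - 1) + (1 + 1)); last by ring.
      have := cmodD (S w - 1) (1 + 1); have := cmodD (1 : R[i]) 1; rewrite cmod1; lra.
    have := Hr w wr; rewrite -S2// (_ : 1 - _ = - ((S w - 1) * (S w + 1))); last by ring.
    rewrite cmodN cmodM; have := cmod_ge0 (S w - 1); have := cmod_ge0 (S w + 1); nra.
  have z0r : cmod (z0 - z0) <= r by rewrite subrr cmod0 ltW.
  have := max_principle rr0 hV bd z0r; rewrite S0 cmodV.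
  have n0 : 0 < cmod (1 - sg) by rewrite -S0 cmod_gt0 nz.
  by rewrite -[16]invrK lef_pV2 ?posrE ?invr_gt0//; lra.
(* This Moebius map sends [S z0 = 1] to 0, and [Sfar] gives [|G| <= 1 + 2 * 16 = 33]. By Schwarz,
   [|G z| <= 33 |z - z0| / r], which is at most 1/2 when [|z - z0| <= s / 132 <= r / 66]; then
   [|S z| <= 3] and [|1 - F z| <= 1 + 9]. *)
pose G z := (S z - 1) / (S z + 1).
have Sp z : cmod (z - z0) <= r -> S z + 1 != 0.
  by move=> zr; rewrite -cmod_gt0; have := Sfar z zr; lra.
have hG z : cmod (z - z0) <= r -> phol G z.
  move=> zr; have hSz : phol S z by apply: hS; lra.
  apply: pholM; first by apply: pholB => //; exact: phol_cst.
  by apply: pholV; [exact: Sp|apply: pholD => //; exact: phol_cst].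
have z0r : cmod (z0 - z0) <= r by rewrite subrr cmod0 ltW.
have G0 : G z0 = 0 by rewrite /G S0 subrr mul0r.
have [l dG] : exists l, cderiv G z0 l.
  have z0d : cmod (z0 - z0) < d by rewrite subrr cmod0.
  have z0s : cmod (z0 - z0) < s1 by lra.
  have dSz := dS _ _ z0s (dF _ z0d).
  eexists; apply: cderivM; first by apply: cderivD; [exact: dSz|exact: cderiv_cst].
  by apply: cderivV; [exact: Sp|apply: cderivD; [exact: dSz|exact: cderiv_cst]].
have GB z : cmod (z - z0) = r -> cmod (G z - G z0) <= 33 / r * cmod (z - z0).
  move=> zr; rewrite zr divfK ?gt_eqF// G0 subr0.
  have zr' : cmod (z - z0) <= r by rewrite zr.
  have := Sfar z zr' => far.
  rewrite /G cmodM cmodV ler_pdivrMr; last by lra.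
  rewrite (_ : S z - 1 = (S z + 1) + - (1 + 1)); last by ring.
  have := cmodD (S z + 1) (- (1 + 1)); rewrite cmodN; have := cmodD (1 : R[i]) 1; rewrite cmod1; lra.
have z0r' : cmod (z0 - z0) < r by rewrite subrr cmod0.
have Gb := dquot_bound rr0 z0r' hG dG GB.
move=> z zs.
have zr : cmod (z - z0) <= r by have := s0; lra.
have Gh : cmod (G z) <= 1 / 2.
  have := Gb z zr; rewrite /dquot; case: (eqVneq z z0) => [-> _|zz0].
    by rewrite G0 cmod0; lra.
  rewrite G0 subr0 cmodM cmodV ler_pdivrMr ?cmod_gt0 ?subr_eq0// => H.
  apply: le_trans H _; rewrite mulrAC ler_pdivrMr//; have := s0; lra.
have S3 : cmod (S z) <= 3.
  have e1 : S z = 1 + (G z + G z * S z).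
    by rewrite /G; field; exact: Sp.
  have := cmodD 1 (G z + G z * S z); rewrite -e1 cmod1.
  have := cmodD (G z) (G z * S z); rewrite cmodM.
  have := cmod_ge0 (S z); have := cmod_ge0 (G z); nra.
rewrite FE cmodM /v -muE mulrC ler_pM2r//.
have zs1 : cmod (z - z0) <= s1 by lra.
rewrite -S2//; have := cmodD 1 (- (S z ^+ 2)); rewrite cmod1 cmodN cmodX.
have := cmod_ge0 (S z); nra.
Qed.

(** The Cauchy estimate between the radii [s / 264] and [s / 132] turns the growth bound [10 mu]
    into [|dh w| <= 20 mu * 264 / s], and [mu <= 2 s |dh z0|] gives the factor 10560, rounded up.
    The radius [d / 600] is below [s / 264 = d / 528]. *)
Lemma koebe_distortion_half w : cmod (w - z0) <= d / 600 -> cmod (dh w) <= 12000 * cmod (dh z0).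
Proof.
move=> wd.
have [z1 [z1s mu0 Hmu]] := circle_min d0 dhP hinj.
have dh0 := deriv_neq0_center d0 dhP hinj.
have z00 : cmod (z0 - z0) < s by rewrite subrr cmod0.
have low := deriv_lower_bound d0 dhP hinj mu0 z00 dh0 Hmu.
have gr := koebe_growth z1s erefl mu0 Hmu.
pose rho := s / 132; pose rho' := s / 264.
have sE : s = d / 2 by [].
have r0 : 0 < rho' by rewrite /rho'; have := s0; lra.
have rr : rho' < rho by rewrite /rho /rho'; have := s0; lra.
have wr : cmod (w - z0) <= rho' by apply: le_trans wd _; rewrite /rho' sE; have := d0; lra.
have hh z : cmod (z - z0) <= rho -> phol h z.
  by move=> zr; apply: phol_h; apply: le_lt_trans zr _; rewrite /rho sE; have := d0; lra.
have dw : cderiv h w (dh w).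
  by apply dhP; apply: le_lt_trans wd _; have := d0; lra.
have [H _] := cauchy_estimate r0 rr wr hh dw gr.
apply: le_trans H _; rewrite ler_pdivrMr ?subr_gt0//.
have -> : rho - rho' = s / 264 by rewrite /rho /rho'; have := s0; lra.
have -> : 12000 * cmod (dh z0) * (s / 264) = (12000 / 264) * (s * cmod (dh z0)) by field.
move: low; have : 0 <= s * cmod (dh z0) by rewrite mulr_ge0 ?cmod_ge0// ltW.
rewrite -/s -!mulrA; lra.
Qed.

End Koebe.

(** * Univalent maps of the exterior disk *)

Section RealPowers.
Context {R : realType}.
Implicit Types x y A t : R.

Lemma powR_ratio x y A t : 0 < x -> 0 < y -> 1 <= A -> x <= A * y -> y <= A * x ->
  x `^ t <= A `^ `|t| * y `^ t.
Proof.
move=> x0 y0 A1 xy yx; have A0 : 0 < A by lra.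
have [t0|t0] := lerP 0 t.
  rewrite ger0_norm// -powRM ?(ltW A0) ?(ltW x0) ?(ltW y0)//.
  by apply: ge0_ler_powR => //; rewrite nnegrE; [exact: ltW|apply: mulr_ge0; exact: ltW].
have [u u0 ->] : exists2 u, 0 <= u & t = - u.
  by exists (- t); rewrite ?opprK// oppr_ge0 ltW.
rewrite normrN (ger0_norm u0).
rewrite !powRN ler_pdivlMr ?powR_gt0// mulrC ler_pdivrMr ?powR_gt0//.
rewrite -powRM ?(ltW A0) ?(ltW x0) ?(ltW y0)//.
by apply: ge0_ler_powR => //; rewrite nnegrE; [exact: ltW|apply: mulr_ge0; exact: ltW].
Qed.

Lemma powR_bounds x c C t : 0 < c -> c <= x <= C ->
  (Num.max C c^-1 + 1) `^ (- `|t|) <= x `^ t <= (Num.max C c^-1 + 1) `^ `|t|.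
Proof.
move=> c0 /andP[cx xC]; set A := _ + 1.
have x0 : 0 < x by lra.
have m1 : C <= Num.max C c^-1 by rewrite le_max lexx.
have m2 : c^-1 <= Num.max C c^-1 by rewrite le_max lexx orbT.
have A1 : 1 <= A by rewrite /A; lra.
have xA : x <= A * 1 by rewrite /A; lra.
have Ax : 1 <= A * x.
  apply: (@le_trans _ _ (c^-1 * c)); first by rewrite mulVf// gt_eqF.
  by rewrite ler_pM// ?invr_ge0 ?(ltW c0)//; rewrite /A; lra.
have := powR_ratio t x0 ltr01 A1 xA Ax; rewrite powR1 mulr1 => ->; rewrite andbT.
have Ax' : x <= A * 1 by [].
have := powR_ratio t ltr01 x0 A1; rewrite powR1 => /(_ Ax xA).
by rewrite powRN -div1r ler_pdivrMr ?powR_gt0 1?mulrC//; lra.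
Qed.

End RealPowers.

Section Exterior.
Context {R : realType}.
Implicit Types (h dh : R[i] -> R[i]) (z w : R[i]).

Definition univalent_ext h dh :=
  (forall z, 1 < cmod z -> cderiv h z (dh z) /\ ccont dh z) /\
  (forall z w, 1 < cmod z -> 1 < cmod w -> h z = h w -> z = w).

Lemma ext_disc z w : cmod (w - z) < cmod z - 1 -> 1 < cmod w.
Proof. by move=> wz; have := cmod_leD z w; rewrite cmodB; lra. Qed.

Definition koebe_const : R := 12000.
Definition koebe_step : R := 1 / 600.

Lemma koebe_const_gt0 : 0 < koebe_const.
Proof. exact: ltr0Sn. Qed.

Lemma koebe_step_gt0 : 0 < koebe_step.
Proof. by rewrite /koebe_step divr_gt0 ?ltr01 ?ltr0Sn. Qed.

Lemma ext_distortion h dh z w : univalent_ext h dh -> 1 < cmod z ->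
  cmod (w - z) <= (cmod z - 1) * koebe_step -> cmod (dh w) <= koebe_const * cmod (dh z).
Proof.
move=> [dhP inj] z1; rewrite /koebe_step mul1r => wz.
apply: koebe_distortion_half wz; first by rewrite subr_gt0.
  by move=> v /ext_disc; exact: dhP.
by move=> v u /ext_disc v1 /ext_disc u1; exact: inj.
Qed.

Lemma ext_deriv_neq0 h dh z : univalent_ext h dh -> 1 < cmod z -> dh z != 0.
Proof.
move=> [dhP inj] z1.
have d0 : 0 < cmod z - 1 by lra.
apply: (@deriv_neq0_center _ h dh z (cmod z - 1)) => //.
  by move=> v /ext_disc; exact: dhP.
by move=> v u /ext_disc v1 /ext_disc u1; exact: inj.
Qed.

(** A step that multiplies [|z| - 1] by [1 + koebe_step] stays within the distortion disc of its
    starting point. The constant thus depends on the number of steps only, neither on [h] nor on the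
    distance to the unit circle. *)
Lemma ext_chain h dh (n : nat) (x a b : R) : univalent_ext h dh -> 1 < a -> a <= b ->
  b - 1 <= (1 + koebe_step) ^+ n * (a - 1) ->
  cmod (dh (circ 0 b x)) <= koebe_const ^+ n * cmod (dh (circ 0 a x)) /\
  cmod (dh (circ 0 a x)) <= koebe_const ^+ n * cmod (dh (circ 0 b x)).
Proof.
move=> uh a1; elim: n b => [|n IHn] b ab.
  rewrite expr0 mul1r => ba; have -> : b = a by apply/eqP; rewrite eq_le ab andbT -(lerD2r (- 1)).
  by rewrite expr0 mul1r.
have s0 := koebe_step_gt0; have q0 : 0 < 1 + koebe_step by rewrite addr_gt0.
(* One distortion step below [b], but not below [a]. *)
move=> bn; pose c := Num.max a (1 + (b - 1) / (1 + koebe_step)).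
have ac : a <= c by rewrite le_max lexx.
have a10 : 0 < a - 1 by rewrite subr_gt0.
have b10 : 0 <= b - 1 by rewrite subr_ge0 (le_trans (ltW a1)).
have cb : c <= b.
  rewrite ge_max ab /= addrC -lerBrDr ler_pdivrMr// mulrDr mulr1 lerDl mulr_ge0//.
  exact: ltW.
have c2 : b - 1 <= (c - 1) * (1 + koebe_step).
  by rewrite -ler_pdivrMr// lerBrDr addrC le_max lexx orbT.
have cn : c - 1 <= (1 + koebe_step) ^+ n * (a - 1).
  rewrite /c; have [_|_] := leP a (1 + (b - 1) / (1 + koebe_step)).
    by rewrite addrAC subrr add0r ler_pdivrMr// mulrC mulrA -exprS.
  by rewrite ler_peMl ?(ltW a10)// exprn_ege1// lerDl ltW.
have [h1 h2] := IHn c ac cn.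
have cm (r : R) : 0 <= r -> cmod (circ 0 r x) = r.
  by move=> r0; rewrite /circ add0r cmodM cmod_expi mulr1 cmodR ger0_norm.
have c1 : 1 < c by exact: lt_le_trans ac.
have b1 : 1 < b by exact: lt_le_trans cb.
have mb := cm b (ltW (lt_trans ltr01 b1)); have mc := cm c (ltW (lt_trans ltr01 c1)).
have dist : cmod (circ 0 b x - circ 0 c x) = b - c.
  by rewrite /circ !add0r -mulrBl -rmorphB cmodM cmod_expi mulr1 cmodR ger0_norm// subr_ge0.
have bc : b - c <= (c - 1) * koebe_step.
  by rewrite lerBlDr; move: c2; rewrite mulrDr mulr1 lerBlDr addrAC subrK addrC.
have e1 : cmod (dh (circ 0 b x)) <= koebe_const * cmod (dh (circ 0 c x)).
  by apply: ext_distortion uh _ _; rewrite ?dist mc.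
have e2 : cmod (dh (circ 0 c x)) <= koebe_const * cmod (dh (circ 0 b x)).
  apply: ext_distortion uh _ _; rewrite 1?cmodB ?dist mb//.
  by apply: le_trans bc _; rewrite ler_wpM2r ?(ltW s0)// lerD2r.
have C0 := koebe_const_gt0.
have p0 : 0 <= koebe_const ^+ n by rewrite exprn_ge0 ?ltW.
rewrite exprS; split.
  by apply: le_trans e1 _; rewrite -mulrA ler_pM2l.
by apply: le_trans h2 _; rewrite [koebe_const * _]mulrC -mulrA ler_wpM2l.
Qed.

(** The class in which constants are uniform: for [B = rad ^+ 2] it contains every [Phi j x] and
    every partial composition, whatever its length and angles. *)
Definition good (B : R) h dh :=
  univalent_ext h dh /\ forall z, 1 < cmod z -> cmod z <= cmod (h z) <= B * cmod z.

Lemma ext_phol h dh z : univalent_ext h dh -> 1 < cmod z -> phol h z.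
Proof.
move=> [dhP _] z1; apply: chol_phol; exists dh; exists (cmod z - 1); first by rewrite /= subr_gt0.
by move=> w /= /ext_disc; exact: dhP.
Qed.

Lemma good_deriv_le B h dh z : good B h dh -> 1 < cmod z ->
  cmod (dh z) <= 16 * B * cmod z / (cmod z - 1).
Proof.
move=> [uh hB] z1; pose rho := (cmod z - 1) / 2.
have r0 : 0 < rho / 2 by rewrite /rho; lra.
have rr : rho / 2 < rho by lra.
have zz : cmod (z - z) <= rho / 2 by rewrite subrr cmod0; lra.
have disc w : cmod (w - z) <= rho -> 1 < cmod w.
  by move=> wr; apply: (@ext_disc z w); rewrite /rho in wr; lra.
have hh w : cmod (w - z) <= rho -> phol h w.
  by move=> /disc; exact: (ext_phol uh).
have [dhP _] := uh; have [dz _] := dhP z z1.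
have B0 : 0 <= B.
  have /andP[] := hB z z1; have := cmod_ge0 z => H h1 h2.
  by rewrite -(@pmulr_lge0 _ (cmod z)); lra.
have hM w : cmod (w - z) <= rho -> cmod (h w - 0) <= B * (2 * cmod z).
  move=> wr; rewrite subr0; have /andP[_ H] := hB w (disc w wr).
  apply: le_trans H _; rewrite ler_wpM2l//.
  by have := cmod_leD w z; rewrite /rho in wr; lra.
have [H _] := cauchy_estimate r0 rr zz hh dz hM.
apply: le_trans H _; rewrite (_ : rho - rho / 2 = (cmod z - 1) / 4); last by rewrite /rho; field.
by rewrite invfM invrK le_eqVlt; apply/orP; left; apply/eqP; field; rewrite subr_eq0 gt_eqF.
Qed.

Lemma ray_mean_value h dh (x a b L : R) : a <= b ->
  (forall s, a <= s <= b -> cderiv h (circ 0 s x) (dh (circ 0 s x))) ->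
  (forall s, a <= s <= b -> cmod (dh (circ 0 s x)) <= L) ->
  cmod (h (circ 0 b x) - h (circ 0 a x)) <= L * (b - a).
Proof.
move=> ab dhP dL; pose D := h (circ 0 b x) - h (circ 0 a x).
rewrite -/D; have [->|D0] := eqVneq D 0.
  rewrite cmod0 mulr_ge0 ?subr_ge0//.
  by apply: le_trans (dL a _); rewrite ?cmod_ge0// lexx.
have D0' : 0 < cmod D by rewrite cmod_gt0.
(* Projecting on the direction of the increment [D] reduces the estimate to the real mean value
   theorem. *)
pose F w := conjc D * h w.
have dF (s : R) : a <= s <= b ->
    is_derive s 1 (fun y => complex.Re (F (circ 0 y x))) (complex.Re (conjc D * dh (circ 0 s x) * expi x)).
  move=> sab; apply: circ_derive_s.
  rewrite -[conjc D * dh _](_ : 0 * h (circ 0 s x) + conjc D * dh (circ 0 s x) = _); last by ring.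
  by apply: cderivM; [exact: cderiv_cst|exact: dhP].
have dF' (s : R) : s \in `]a, b[ -> is_derive s 1 (fun y => complex.Re (F (circ 0 y x))) (complex.Re (conjc D * dh (circ 0 s x) * expi x)).
  by rewrite in_itv /= => /andP[? ?]; apply: dF; rewrite !ltW.
have fc : {within `[a, b], continuous (fun y => complex.Re (F (circ 0 y x)))}.
  apply/continuous_in_subspaceT => s; rewrite inE /= in_itv/= => sab.
  by apply: differentiable_continuous; apply/derivable1_diffP; case: (dF s sab).
have [c] := MVT_segment ab dF' fc.
rewrite in_itv /= => cab.
rewrite -ReB /F -mulrBr -/D (_ : complex.Re (conjc D * D) = cmod D ^+ 2); last first.
  by rewrite cmod_sqr ReM; case: D {D0 D0' F dF dF' fc} => u v /=; ring.
move=> e; rewrite -(ler_pM2l D0') -expr2 e.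
rewrite mulrA ler_wpM2r ?subr_ge0//; apply: le_trans (ler_norm _) _.
apply: le_trans (Re_le_cmod _) _; rewrite !cmodM cmod_expi mulr1.
rewrite (_ : cmod (conjc D) = cmod D); last by rewrite !cmodE; case: (D) => u v /=; rewrite sqrrN.
by rewrite ler_wpM2l ?cmod_ge0// dL.
Qed.

Lemma bernoulli_unbounded (q M : R) : 1 < q -> exists n : nat, M <= q ^+ n.
Proof.
move=> q1; pose n := (Num.truncn (`|M| / (q - 1))).+1; exists n.
have q0 : 0 < q - 1 by lra.
have h : `|M| / (q - 1) < n%:R by rewrite truncnS_gt.
have bern (m : nat) : 1 + m%:R * (q - 1) <= q ^+ m.
  elim: m => [|m IHm]; first by rewrite mul0r addr0 expr0.
  have m0 : 0 <= m%:R :> R by [].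
  have h1 : q * (1 + m%:R * (q - 1)) <= q * q ^+ m by rewrite ler_wpM2l//; lra.
  have h2 : 0 <= m%:R * (q - 1) ^+ 2 by rewrite mulr_ge0 ?sqr_ge0.
  rewrite exprS -natr1; move: h1 h2; move: (q ^+ m) (m%:R) => u v; lra.
move: h; rewrite ltr_pdivrMr// => h; have := bern n; have := ler_norm M; lra.
Qed.

(** A small derivative at [z] stays small along the ray up to any fixed radius [T], by [n]
    distortion steps. But [|h| >= T] at radius [T] and [|h z| <= B b], so for [T = B b + b + 1] the
    increment of [h] is at least 1, and the mean value bound forces [|dh z|] up. *)
Lemma good_deriv_ge (B a b : R) : 1 < a -> a <= b -> 0 <= B -> exists2 c : R, 0 < c &
  forall h dh, good B h dh -> forall z, a <= cmod z <= b -> c <= cmod (dh z).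
Proof.
move=> a1 ab B0; pose T := B * b + b + 1.
have Bb0 : 0 <= B * b by apply: mulr_ge0 => //; lra.
have TE : T = B * b + b + 1 by [].
clearbody T; have bT : b + 1 <= T by lra.
have q1 : 1 < 1 + koebe_step by rewrite ltrDl koebe_step_gt0.
have [n Hn] := @bernoulli_unbounded (1 + koebe_step) ((T - 1) / (a - 1)) q1.
have p0 : 0 < koebe_const ^+ n by apply: exprn_gt0; exact: koebe_const_gt0.
have T0 : 0 < T by lra.
exists ((koebe_const ^+ n * T)^-1); first by rewrite invr_gt0 mulr_gt0.
move=> h dh [uh hB] z /andP[az zb].
have [x _ zx] := circ_surj 0 z; rewrite subr0 in zx.
set r := cmod z in az zb zx *.
have cm (s : R) : 0 <= s -> cmod (circ 0 s x) = s.
  by move=> s0; rewrite /circ add0r cmodM cmod_expi mulr1 cmodR ger0_norm.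
have rT : r <= T by lra.
have [dhP _] := uh.
have H := @ray_mean_value h dh x r T (koebe_const ^+ n * cmod (dh z)) rT.
have {}H : cmod (h (circ 0 T x) - h (circ 0 r x)) <= koebe_const ^+ n * cmod (dh z) * (T - r).
  apply: H => s /andP[rs sT].
    by apply dhP; rewrite cm; lra.
  rewrite zx; apply: (proj1 (@ext_chain h dh n x r s uh _ rs _)); first by lra.
  have : T - 1 <= (1 + koebe_step) ^+ n * (a - 1) by rewrite -ler_pdivrMr//; lra.
  have : (1 + koebe_step) ^+ n * (a - 1) <= (1 + koebe_step) ^+ n * (r - 1).
    by rewrite ler_wpM2l ?exprn_ge0 ?(ltW (lt_trans ltr01 q1))//; lra.
  lra.
have T1 : 1 < cmod (circ 0 T x) by rewrite cm; lra.
have r1 : 1 < cmod (circ 0 r x) by rewrite cm; lra.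
have /andP[h1 _] := hB _ T1; have /andP[_ h2] := hB _ r1.
rewrite cm in h1; last by lra.
rewrite cm in h2; last by lra.
have Br : B * r <= B * b by rewrite ler_wpM2l.
have := cmod_leD (h (circ 0 T x)) (h (circ 0 r x)) => h3.
have e1 : 1 <= koebe_const ^+ n * cmod (dh z) * (T - r) by lra.
rewrite -div1r ler_pdivrMr ?mulr_gt0//; apply: le_trans e1 _.
rewrite mulrA [cmod _ * _]mulrC ler_wpM2l ?mulr_ge0 ?cmod_ge0 ?ltW//; lra.
Qed.

(* The difference quotients of a uniformly bounded family are equi-Lipschitz. *)
Lemma good_deriv_cvg B (h dh : nat -> R[i] -> R[i]) (f : R[i] -> R[i]) z l :
  (forall m, good B (h m) (dh m)) -> 1 < cmod z ->
  (forall w, 1 < cmod w -> ctends \oo (fun m => h m w) (f w)) ->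
  cderiv f z l -> ctends \oo (fun m => dh m z) l.
Proof.
move=> hg z1 hf /cderivP df.
pose rho := (cmod z - 1) / 2; have r0 : 0 < rho by rewrite /rho; lra.
have disc w : cmod (w - z) <= rho -> 1 < cmod w.
  by move=> wr; apply: (@ext_disc z w); rewrite /rho in wr; lra.
pose M := B * (2 * cmod z).
have hM m w : cmod (w - z) <= rho -> cmod (h m w - 0) <= M.
  move=> wr; rewrite subr0; have [uh hB] := hg m; have /andP[_ H] := hB w (disc w wr).
  have B0 : 0 <= B.
    have /andP[] := hB z z1; have := cmod_ge0 z => H' h1 h2.
    by rewrite -(@pmulr_lge0 _ (cmod z)); lra.
  apply: le_trans H _; rewrite ler_wpM2l//.
  by have := cmod_leD w z; rewrite /rho in wr; lra.
pose Q m := dquot (h m) z (dh m z).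
pose L1 := 2 * M / (rho - rho / 2).
have rr : rho / 2 < rho by lra.
have r20 : 0 < rho / 2 by lra.
have hph m w : cmod (w - z) <= rho -> phol (h m) w.
  by move=> /disc; exact: (ext_phol (hg m).1).
have dhz m : cderiv (h m) z (dh m z) by have [[dhP _] _] := hg m; apply dhP.
have zz : cmod (z - z) <= rho / 2 by rewrite subrr cmod0 ltW.
have QL m w : cmod (w - z) <= rho -> cmod (Q m w - 0) <= L1.
  move=> wr; rewrite subr0; have [H1 H2] := cauchy_estimate r20 rr zz (hph m) (dhz m) (hM m).
  rewrite /Q /dquot; case: (eqVneq w z) => // wz.
  by rewrite cmodM cmodV ler_pdivrMr ?cmod_gt0 ?subr_eq0//; exact: H2.
have Qph m w : cmod (w - z) <= rho -> phol (Q m) w.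
  move=> wr; have [->|wz] := eqVneq w z; last by apply: dquot_phol_neq => //; exact: hph.
  apply: dquot_phol => //; exists rho => // v /= vr; apply: hph; exact: ltW.
pose L := 2 * L1 / (rho - rho / 2).
have Qlip m w : w != z -> cmod (w - z) <= rho / 2 -> cmod (Q m z - Q m w) <= L * cmod (z - w).
  move=> wz wr; have [dhP _] := (hg m).1.
  have wr' : cmod (w - z) <= rho by lra.
  have [dw _] := dhP w (disc w wr').
  have dQ : cderiv (Q m) w ((dh m w + - 0) * (w - z)^-1 + (h m w - h m z) * (- (1 + - 0) / (w - z) ^+ 2)).
    have : cderiv (fun v => (h m v - h m z) * (v - z)^-1) w ((dh m w + - 0) * (w - z)^-1 + (h m w - h m z) * (- (1 + - 0) / (w - z) ^+ 2)).
      apply: cderivM; first by apply: cderivD => //; rewrite oppr0; exact: cderiv_cst.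
      apply: cderivV; first by rewrite subr_eq0.
      by apply: cderivD; [exact: cderiv_id|rewrite oppr0; exact: cderiv_cst].
    apply: cderiv_near.
    have : ccont (fun v => v - z) w by apply: ctendsB; [exact: ccont_id|exact: ctends_cst].
    move=> /ccont_neq0; rewrite subr_eq0 => /(_ wz); apply: filterS => v.
    by rewrite subr_eq0 /Q /dquot => /negbTE ->.
  have [_ H] := cauchy_estimate r20 rr wr (Qph m) dQ (QL m).
  by apply: H; rewrite subrr cmod0 ltW.
move=> e e0; have e30 : 0 < e / 4 by rewrite divr_gt0.
have L0 : 0 <= L.
  have L10 : 0 <= L1 by apply: le_trans (QL 0%N z _); rewrite ?cmod_ge0// subrr cmod0 ltW.
  by apply: divr_ge0; [exact: mulr_ge0|lra].
have [r1 /= r10 H1] := df _ e30.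
(* Small enough that two errors are at most [e / 4]: the Lipschitz error [L r] of [Q m] between [w]
   and [z], uniform in [m], and the error of the difference quotient of [f] against [l]. The third
   one, from convergence at [w], is left to large [m]. *)
pose r := Num.min (rho / 2) (Num.min (r1 / 2) (e / (4 * (L + 1)))).
have L40 : 0 < 4 * (L + 1) by lra.
have rp : 0 < r by rewrite !lt_min r20 !divr_gt0.
have rle1 : r <= rho / 2 by rewrite /r ge_min lexx.
have rle2 : r <= r1 / 2 by rewrite /r !ge_min lexx orbT.
have rle3 : r <= e / (4 * (L + 1)) by rewrite /r !ge_min lexx !orbT.
pose w := circ z r 0.
have wzr : cmod (w - z) = r by rewrite /w cmod_circ gtr0_norm.
have wz : w != z by rewrite -subr_eq0 -cmod_gt0 wzr.
have D1 : cmod ((f w - f z) / (w - z) - l) < e / 4.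
  by apply: H1 => //=; rewrite wzr; lra.
have w1 : 1 < cmod w by apply: disc; rewrite wzr; lra.
have D2 : ctends \oo (fun m => (h m w - h m z) / (w - z)) ((f w - f z) / (w - z)).
  by apply: ctendsM; [apply: ctendsB; exact: hf|exact: ctends_cst].
have := D2 _ e30; apply: filterS => m hm.
have D3 : cmod (Q m z - Q m w) <= e / 4.
  have := Qlip m w wz; rewrite wzr => /(_ rle1); rewrite (cmodB z) wzr => H.
  have : L * r <= e / 4.
    move: rle3; rewrite ler_pdivlMr; last by lra.
    by move=> h3; have := mulr_ge0 L0 (ltW rp); lra.
  lra.
have QE : Q m w = (h m w - h m z) / (w - z) by rewrite /Q /dquot (negbTE wz).
have Qz : Q m z = dh m z by rewrite /Q /dquot eqxx.
rewrite -Qz; have := cmod_triangle (Q m z) (Q m w) l; rewrite QE in D3 *.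
have := cmod_triangle ((h m w - h m z) / (w - z)) ((f w - f z) / (w - z)) l.
lra.
Qed.

End Exterior.

(** * The class Sigma' and behaviour at infinity *)

Section SigmaPrime.
Context {R : realType}.
Implicit Types (F G : R[i] -> R[i]) (z w : R[i]).

Lemma derivable_cderiv F z : derivable F z 1 -> cderiv F z (F^`()%classic z).
Proof. by move=> dF; apply/cderiv_derive1. Qed.

Lemma cnbhs'E z : cnbhs' z = z^'.
Proof. by rewrite /cnbhs' /dnbhs cnbhsE. Qed.

Lemma cvg_ctends' (F : R[i] -> R[i]) z l : F w @[w --> z^'] --> l <-> ctends (cnbhs' z) F l.
Proof. by rewrite cnbhs'E; exact: cvg_ctends. Qed.

Lemma Dminus_near z : 1 < cmod z -> \forall w \near cnbhs z, 1 < cmod w.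
Proof.
by move=> z1; exists (cmod z - 1); [rewrite /= subr_gt0|move=> w /= /ext_disc].
Qed.

(** This is [F z / z] in the coordinate [w = 1 / z], completed at infinity by the leading
    coefficient: on the unit disc it is open to the maximum principle. *)
Definition at_infinity F (b : R[i]) w := if w == 0 then b else w * F w^-1.

Lemma cmodV_gt1 w : w != 0 -> cmod w < 1 -> 1 < cmod w^-1.
Proof. by rewrite -cmod_gt0 => w0 w1; rewrite cmodV invf_gt1. Qed.

Lemma at_infinity_phol F dF b w :
  (forall z, 1 < cmod z -> cderiv F z (dF z) /\ ccont dF z) ->
  ctends (cnbhs' 0) (fun w => w * F w^-1) b -> cmod w < 1 -> phol (at_infinity F b) w.
Proof.
move=> dFP Fb w1.
have H (v : R[i]) : v != 0 -> cmod v < 1 ->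
    cderiv (fun u => u * F u^-1) v (1 * F v^-1 + v * (dF v^-1 * (- 1 / v ^+ 2))) /\
    ccont (fun v => 1 * F v^-1 + v * (dF v^-1 * (- 1 / v ^+ 2))) v.
  move=> v0 v1; have [d c] := dFP _ (cmodV_gt1 v0 v1).
  have dV : cderiv (fun u : R[i] => u^-1) v (- 1 / v ^+ 2).
    by apply: (cderivV v0); exact: cderiv_id.
  split.
    apply: cderivM; first exact: cderiv_id.
    exact: (cderiv_comp dV d).
  have cV := cderiv_cont dV.
  apply: ctendsD; apply: ctendsM; try exact: ctends_cst; try exact: ccont_id.
    by apply: (ccont_comp cV); exact: cderiv_cont d.
  apply: ctendsM; first exact: (ccont_comp cV).
  apply: ctendsM; first exact: ctends_cst.
  by apply: ctendsV; [rewrite expf_neq0|apply: ctendsX; exact: ccont_id].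
have near0 (v : R[i]) : v != 0 -> \forall u \near cnbhs v, u != 0.
  by move=> v0; apply: ccont_neq0 v0; exact: ccont_id.
have nearE (v : R[i]) : v != 0 -> \forall u \near cnbhs v, u * F u^-1 = at_infinity F b u.
  by move=> /near0; apply: filterS => u u0; rewrite /at_infinity (negbTE u0).
have near1 (v : R[i]) : cmod v < 1 -> \forall u \near cnbhs v, cmod u < 1.
  move=> v1; exists (1 - cmod v); first by rewrite /= subr_gt0.
  by move=> u /= uv; have := cmod_leD u v; lra.
have [->|w0] := eqVneq w 0.
  split.
    move=> e e0; rewrite /at_infinity eqxx; move: (Fb e e0); rewrite near_withinE.
    by apply: filterS => v; case: eqVneq => [_ _|v0]; [rewrite subrr cmod0|apply].
  eexists; exists 1; first by rewrite /= ltr01.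
  move=> v /=; rewrite subr0 => v1 v0.
  have [d c] := H v v0 v1; split; last exact: c.
  exact: cderiv_near (nearE v v0) d.
apply: (phol_near (nearE w w0)); apply: chol_phol.
exists (fun v => 1 * F v^-1 + v * (dF v^-1 * (- 1 / v ^+ 2))).
by apply: filterS2 (near0 w w0) (near1 w w1) => v; exact: H.
Qed.

Lemma at_infinity_bound F dF b (s B : R) :
  (forall z, 1 < cmod z -> cderiv F z (dF z) /\ ccont dF z) ->
  ctends (cnbhs' 0) (fun w => w * F w^-1) b -> 1 < s ->
  (forall z, cmod z = s -> cmod (F z) <= B * s) ->
  forall z, s <= cmod z -> cmod (F z) <= B * cmod z.
Proof.
move=> dFP Fb s1 FB z sz.
have s0 : 0 < s by lra.
have sV0 : 0 < s^-1 by rewrite invr_gt0.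
have sV1 : s^-1 < 1 by rewrite invf_lt1.
have hF w : cmod (w - 0) <= s^-1 -> phol (at_infinity F b) w.
  by rewrite subr0 => ws; apply: (at_infinity_phol dFP Fb); lra.
have bd w : cmod (w - 0) = s^-1 -> cmod (at_infinity F b w) <= B.
  rewrite subr0 => ws; have w0 : w != 0 by rewrite -cmod_gt0 ws.
  rewrite /at_infinity (negbTE w0) cmodM ws mulrC ler_pdivrMr//.
  by apply: FB; rewrite cmodV ws invrK.
have z0 : z != 0 by rewrite -cmod_gt0; lra.
have zs : cmod (z^-1 - 0) <= s^-1 by rewrite subr0 cmodV lef_pV2 ?posrE//; lra.
have := max_principle sV0 hF bd zs.
rewrite /at_infinity invr_eq0 (negbTE z0) invrK cmodM cmodV mulrC ler_pdivrMr//.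
by rewrite cmod_gt0.
Qed.

(** Schwarz's lemma at infinity: the maximum principle bounds [z / F z] by [s] outside the circle of
    radius [s], because [|F| > 1] on it; then [s] tends to 1. *)
Lemma at_infinity_ge F dF (b : R) :
  (forall z, 1 < cmod z -> cderiv F z (dF z) /\ ccont dF z) ->
  (forall z, 1 < cmod z -> 1 < cmod (F z)) -> 0 < b ->
  ctends (cnbhs' 0) (fun w => w * F w^-1) b%:C ->
  forall z, 1 < cmod z -> cmod z <= cmod (F z).
Proof.
move=> dFP F1 b0 Fb z z1.
have bn0 : b%:C != 0 :> R[i] by rewrite -cmod_eq0 cmodR normr_eq0 gt_eqF.
suff H (s : R) : 1 < s -> s <= cmod z -> cmod z <= s * cmod (F z).
  apply/ler_addgt0Pl => e e0.
  have Fz0 : 0 < cmod (F z) by apply: lt_trans (F1 z z1).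
  pose s := Num.min (cmod z) (1 + e / cmod (F z)).
  have s1 : 1 < s by rewrite lt_min z1 ltrDl divr_gt0.
  have := H s s1; rewrite ge_min lexx => /(_ isT) h; apply: le_trans h _.
  have : s <= 1 + e / cmod (F z) by rewrite ge_min lexx orbT.
  rewrite -(ler_pM2r Fz0) mulrDl divfK ?gt_eqF//; lra.
move=> s1 sz; have s0 : 0 < s by lra.
have sV0 : 0 < s^-1 by rewrite invr_gt0.
have sV1 : s^-1 < 1 by rewrite invf_lt1.
have n0 w : cmod w < 1 -> at_infinity F b%:C w != 0.
  move=> w1; rewrite /at_infinity; case: (eqVneq w 0) => // w0.
  apply: mulf_neq0 => //; rewrite -cmod_gt0; apply: lt_trans (F1 _ (cmodV_gt1 w0 w1)) => //.
have hF w : cmod (w - 0) <= s^-1 -> phol (fun w => (at_infinity F b%:C w)^-1) w.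
  rewrite subr0 => ws; have w1 : cmod w < 1 by lra.
  by apply: pholV; [exact: n0|exact: (at_infinity_phol dFP Fb)].
have bd w : cmod (w - 0) = s^-1 -> cmod (at_infinity F b%:C w)^-1 <= s.
  rewrite subr0 => ws; have w0 : w != 0 by rewrite -cmod_gt0 ws.
  have w1 : cmod w < 1 by rewrite ws.
  have F1w := F1 _ (cmodV_gt1 w0 w1).
  rewrite /at_infinity (negbTE w0) cmodV cmodM ws invfM invrK.
  by rewrite ler_piMr ?ltW// invf_lt1//; lra.
have z0 : z != 0 by rewrite -cmod_gt0; lra.
have zs : cmod (z^-1 - 0) <= s^-1 by rewrite subr0 cmodV lef_pV2 ?posrE//; lra.
have := max_principle sV0 hF bd zs.
rewrite /at_infinity invr_eq0 (negbTE z0) invrK cmodV cmodM cmodV invfM invrK.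
by rewrite ler_pdivrMr// (lt_trans _ (F1 z z1)).
Qed.

Lemma smooth_deriv_cont F z : smooth_up_to_boundary F -> 1 < cmod z -> ccont (F^`())%classic z.
Proof.
move=> /(_ 1%N) [g gc gE] z1.
move/subspace_continuousP : gc => /(_ z (ltW z1)) /cvg_ctends gc.
have : ccont g z.
  move=> e e0; have := gc e e0; rewrite near_withinE -cnbhsE => H.
  by apply: filterS2 H (Dminus_near z1) => w Hw w1; apply: Hw; exact: ltW.
by apply: ccont_near; apply: filterS (Dminus_near z1) => w; exact: gE.
Qed.

Lemma Sigma'_univalent F : Sigma' F -> smooth_up_to_boundary F -> univalent_ext F (F^`())%classic.
Proof.
move=> [dF iF _ _] sF; split=> [z z1|z w z1 w1].
  by split; [apply/cderiv_derive1; split=> //; exact: dF|exact: smooth_deriv_cont].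
by move=> /iF; apply; rewrite inE.
Qed.

Lemma rotate_Sigma' F a : Sigma' F -> Sigma' (rotate F a).
Proof.
move=> [dF iF DF [b b0 Fb]].
have rm z : cmod (expi (- a) * z) = cmod z by rewrite cmodM cmod_expi mul1r.
split.
- move=> z z1; have z1' : 1 < cmod (expi (- a) * z) by rewrite rm.
  have d := derivable_cderiv (dF _ z1').
  suff [l /cderiv_derive1[]] : exists l, cderiv (rotate F a) z l by [].
  eexists; apply: cderivM; first exact: cderiv_cst.
  apply: (cderiv_comp (G := fun u => expi (- a) * u)); last exact: d.
  by apply: cderivM; [exact: cderiv_cst|exact: cderiv_id].
- move=> z w; rewrite !inE => z1 w1 /(mulfI (expi_neq0 a)) /iF.
  rewrite !inE /Dminus /= !rm => /(_ z1 w1); exact/mulfI/expi_neq0.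
- move=> z z1; rewrite /Dminus /= cmodM cmod_expi mul1r; apply: DF.
  by rewrite /Dminus /= rm.
- exists b => //; apply/cvg_ctends' => e e0; move/cvg_ctends' : Fb => /(_ e e0) [d d0 H].
  exists d => // w /=; rewrite subr0 => wd w0.
  have e1 : expi a * expi (- a) = 1 :> R[i] by rewrite -expiD subrr expi0.
  have V : (expi a * w)^-1 = expi (- a) * w^-1.
    by rewrite invfM; congr (_ * _); apply: (mulfI (expi_neq0 a)); rewrite e1 divff// expi_neq0.
  have := H (expi a * w); rewrite /= subr0 cmodM cmod_expi mul1r => /(_ wd).
  rewrite mulf_neq0// ?expi_neq0// => /(_ isT); rewrite V.
  by rewrite /rotate mulrA [w * _]mulrC.
Qed.

End SigmaPrime.

Section KoebeTransform.
Context {R : realType}.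
Implicit Types (F G phi K : R[i] -> R[i]) (z w : R[i]).

Lemma cmodX_gt1 z n : (0 < n)%N -> 1 < cmod z -> 1 < cmod (z ^+ n).
Proof. by move=> n0 z1; rewrite cmodX exprn_egt1// -lt0n. Qed.

(** Conjugating by a rotation keeps the transform in [Sigma'], so the branch remains the right one.
    One transform thus provides those for all angles, in a way continuous in the angle. *)
Lemma rotate_koebe n phi K a b : (0 < n)%N -> is_koebe_transform n (rotate phi a) K ->
  is_koebe_transform n (rotate phi b) (rotate K ((b - a) / n%:R)).
Proof.
move=> n0 [sK KE]; split; first exact: rotate_Sigma'.
move=> z z1; have nn0 : n%:R != 0 :> R by rewrite pnatr_eq0 -lt0n.
have z1' : Dminus (expi (- ((b - a) / n%:R)) * z).
  by rewrite /Dminus /= cmodM cmod_expi mul1r.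
have e1 : n%:R * ((b - a) / n%:R) = b - a by rewrite mulrC divfK.
rewrite {1}/rotate exprMn KE// exprMn !expiX mulrN e1.
rewrite /rotate !mulrA -!expiD.
by congr (expi _ * phi (expi _ * _)); ring.
Qed.

(** The quotient [q] of two branches satisfies [q^n = 1], so its derivative vanishes and it is
    constant along rays. Its limit at infinity [b1 / b2] is positive, and the only positive [n]-th
    root of 1 is 1. *)
Lemma koebe_unique n phi K1 K2 : (0 < n)%N ->
  is_koebe_transform n phi K1 -> is_koebe_transform n phi K2 ->
  forall z, 1 < cmod z -> K1 z = K2 z.
Proof.
move=> n0 [[d1 _ D1 [b1 b10 l1]] E1] [[d2 _ D2 [b2 b20 l2]] E2].
have K2n0 z : 1 < cmod z -> K2 z != 0 by move=> /D2; rewrite /Dminus /= -cmod_gt0; lra.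
have K1n0 z : 1 < cmod z -> K1 z != 0 by move=> /D1; rewrite /Dminus /= -cmod_gt0; lra.
pose q z := K1 z / K2 z.
have qn z : 1 < cmod z -> q z ^+ n = 1.
  by move=> z1; rewrite /q expr_div_n E1// E2// divff// -E2// expf_neq0// K2n0.
have q0 z : 1 < cmod z -> q z != 0.
  by move=> z1; rewrite mulf_neq0 ?K1n0// invr_eq0 K2n0.
have dq z : 1 < cmod z -> cderiv q z 0.
  move=> z1; have dd1 := derivable_cderiv (d1 _ z1).
  have dd2 := derivable_cderiv (d2 _ z1).
  have dq := cderivM dd1 (cderivV (K2n0 z z1) dd2).
  have := cderivX n dq.
  have /cderiv_unique H : cderiv (fun w => q w ^+ n) z 0.
    apply: (cderiv_near _ (cderiv_cst 1 z)).
    by apply: filterS (Dminus_near z1) => w w1; rewrite qn.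
  move=> /H /eqP; rewrite eq_sym mulf_eq0 mulf_eq0 pnatr_eq0 (negbTE (lt0n_neq0 n0)) /=.
  rewrite (negbTE (expf_neq0 _ (q0 z z1))) /= => /eqP e.
  by rewrite e in dq.
have b2n0 : b2%:C != 0 :> R[i] by rewrite -cmod_eq0 cmodR normr_eq0 gt_eqF.
have ql : ctends (cnbhs' 0) (fun w => q w^-1) (b1%:C / b2%:C).
  move/cvg_ctends' : l1 => l1; move/cvg_ctends' : l2 => l2.
  have near1 : \forall w \near cnbhs' (0 : R[i]), cmod w < 1.
    by exists 1; [rewrite /= ltr01|move=> v /= + _; rewrite subr0].
  have : ctends (cnbhs' 0) (fun w => (w * K1 w^-1) * (w * K2 w^-1)^-1) (b1%:C / b2%:C).
    by apply: ctendsM => //; exact: ctendsV.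
  apply: ctends_near; near=> w.
  have w0 : w != 0 by near: w; exact: cnbhs'_neq.
  have w1 : 1 < cmod w^-1.
    by apply: cmodV_gt1 => //; near: w; exact: near1.
  by rewrite /q; field; rewrite w0 K2n0.
have qc z : 1 < cmod z -> q z = b1%:C / b2%:C.
  move=> z1; apply/eqP; rewrite -subr_eq0 -cmod_eq0 eq_le cmod_ge0 andbT.
  apply/ler_addgt0Pl => e e0; rewrite addr0.
  have [d /= d0 H] := ql e e0.
  have [x _ zx] := circ_surj 0 z; rewrite subr0 in zx.
  pose T := cmod z + d^-1 + 1.
  have dV0 : 0 < d^-1 by rewrite invr_gt0.
  have T0 : 0 < T by rewrite /T; lra.
  have cT : cmod (circ 0 T x) = T by rewrite /circ add0r cmodM cmod_expi mulr1 cmodR gtr0_norm.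
  have -> : q z = q (circ 0 T x).
    rewrite {1}zx; apply: cst_of_deriv0; first by rewrite /T; lra.
    move=> s /andP[zs sT]; apply: dq.
    rewrite /circ add0r cmodM cmod_expi mulr1 cmodR ger0_norm; lra.
  apply: ltW; have := H (circ 0 T x)^-1; rewrite /= invrK; apply; last first.
    by rewrite invr_eq0 -cmod_gt0 cT.
  rewrite subr0 cmodV cT -[d]invrK ltf_pV2 ?posrE// /T; lra.
move=> z z1; suff : q z = 1.
  by move=> /(congr1 (fun u => u * K2 z)); rewrite mul1r /q divfK// K2n0.
have bb0 : 0 <= b1 / b2 by rewrite divr_ge0 ?ltW.
have bE : b1%:C / b2%:C = (b1 / b2)%:C by rewrite rmorphM fmorphV.
have := qn z z1; rewrite qc// bE -rmorphXn => /complexI /eqP.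
by rewrite pexpr_eq1// => /eqP ->.
Unshelve. all: by end_near. Qed.

(** Obtained by differentiating the [n]-th power relation; the factors [n] and [expi a * expi (- a)]
    cancel. *)
Definition koebe_deriv (dphi : R[i] -> R[i]) (n : nat) (a : R) (K : R[i] -> R[i]) z :=
  dphi (expi (- a) * z ^+ n) * z ^+ n.-1 / K z ^+ n.-1.

Lemma koebe_derivP phi dphi n a K : (0 < n)%N ->
  (forall z, 1 < cmod z -> cderiv phi z (dphi z) /\ ccont dphi z) ->
  is_koebe_transform n (rotate phi a) K ->
  [/\ univalent_ext K (koebe_deriv dphi n a K),
      forall z, 1 < cmod z -> 1 < cmod (K z) &
      forall z, 1 < cmod z -> cmod (K z) ^+ n = cmod (phi (expi (- a) * z ^+ n))].
Proof.
move=> n0 dphiP [[dK iK DK _] KE].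
have K0 z : 1 < cmod z -> K z != 0 by move=> /DK; rewrite /Dminus /= -cmod_gt0; lra.
have arg z : 1 < cmod z -> 1 < cmod (expi (- a) * z ^+ n).
  by move=> z1; rewrite cmodM cmod_expi mul1r cmodX_gt1.
have dKE z : 1 < cmod z -> cderiv K z (koebe_deriv dphi n a K z).
  move=> z1; have dd := derivable_cderiv (dK _ z1).
  have [dp _] := dphiP _ (arg z z1).
  have := cderivX n dd.
  have /cderiv_unique H : cderiv (fun w => K w ^+ n) z
     (0 * phi (expi (- a) * z ^+ n) + expi a * (dphi (expi (- a) * z ^+ n) *
        (0 * z ^+ n + expi (- a) * (n%:R * z ^+ n.-1 * 1)))).
    apply: (@cderiv_near _ (rotate phi a \o (fun w => w ^+ n))).
      by apply: filterS (Dminus_near z1) => w w1; rewrite /= KE.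
    apply: cderivM; first exact: cderiv_cst.
    apply: (cderiv_comp (G := fun w => expi (- a) * w ^+ n)); last exact: dp.
    by apply: cderivM; [exact: cderiv_cst|apply: cderivX; exact: cderiv_id].
  move=> /H e; suff <- : (K^`())%classic z = koebe_deriv dphi n a K z by [].
  have nn0 : n%:R != 0 :> R[i] by rewrite pnatr_eq0 -lt0n.
  have e1 : expi a * expi (- a) = 1 :> R[i] by rewrite -expiD subrr expi0.
  have K0' := expf_neq0 n.-1 (K0 z z1).
  apply: (mulfI (mulf_neq0 nn0 K0')); rewrite -e /koebe_deriv.
  rewrite !mul0r !add0r mulr1; move: (dphi (expi (- a) * z ^+ n)) => D.
  move: (z ^+ n.-1) (K z ^+ n.-1) K0' => Z W W0.
  rewrite (_ : _ * _ = (expi a * expi (- a)) * (D * n%:R * Z)); last by ring.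
  by rewrite e1; field.
split.
- split=> [z z1|z w z1 w1 /iK]; last by apply; rewrite inE.
  split; first exact: dKE.
  have [_ cp] := dphiP _ (arg z z1).
  have cX m : ccont (fun w : R[i] => w ^+ m) z by apply: ctendsX; exact: ccont_id.
  have cin : ctends (cnbhs z) (fun w => expi (- a) * w ^+ n) (expi (- a) * z ^+ n).
    by apply: ctendsM; [exact: ctends_cst|exact: cX].
  apply: ctendsM; first by apply: ctendsM; [exact: (ctends_comp cin cp)|exact: cX].
  apply: ctendsV; first by rewrite expf_neq0// K0.
  by apply: ctendsX; exact: cderiv_cont (dKE z z1).
- by move=> z /DK.
- by move=> z z1; rewrite -cmodX KE// /rotate cmodM cmod_expi mul1r.
Qed.

End KoebeTransform.

(** * Snowflakes *)

Section InclusionBound.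
Context {R : realType}.

(** The first bound is the inclusion read through [phi]. The second is immediate from it for small
    [|z|], and for the other [z] follows from the maximum principle for [phi z / z] outside a circle
    covered by the first. *)
Lemma phi_le (phi psi : R[i] -> R[i]) (k : nat) (rad : R) : (0 < k)%N ->
  Sigma' phi -> smooth_up_to_boundary phi ->
  (forall z : R[i], Dminus z -> psi (phi z) = z) -> 1 < rad ->
  (forall w u : R[i], DR rad w -> u ^+ k = w ->
     exists2 z : R[i], (DR rad `&` phi @` Dminus) z & u = psi z) ->
  (forall u : R[i], 1 < cmod u -> cmod u ^+ k < rad -> 1 < cmod (phi u) < rad) /\
  (forall z : R[i], 1 < cmod z -> cmod (phi z) <= rad * cmod z).
Proof.
move=> k0 sphi smphi hpsi rad1 hincl.
have small u : 1 < cmod u -> cmod u ^+ k < rad -> 1 < cmod (phi u) < rad.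
  move=> u1 uk.
  have wD : DR rad (u ^+ k) by rewrite /DR /= cmodX uk andbT -cmodX cmodX_gt1.
  have [z [zD [z' z'D z'E]] uE] := hincl _ _ wD erefl.
  by rewrite uE -z'E hpsi// z'E.
split=> // z z1.
have [zk|zk] := ltrP (cmod z ^+ k) rad.
  have /andP[_ /ltW h] := small z z1 zk; apply: le_trans h _.
  by apply: ler_peMr; lra.
have p1 (e : R) : 1 `^ e = 1 :> R by rewrite powR1.
(* With [s^k] the square root of [rad], the circle of radius [s] lies strictly inside the range of
   [small]. *)
pose s := rad `^ (2 * k%:R)^-1.
have kr : 0 < k%:R :> R by rewrite ltr0n.
have s1 : 1 < s.
  rewrite -(p1 (2 * k%:R)^-1) /s; apply: gt0_ltr_powR => //.
  - by rewrite invr_gt0 mulr_gt0.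
  - by rewrite nnegrE.
  - by rewrite nnegrE; lra.
have sk : s ^+ k = rad `^ 2^-1.
  rewrite -powR_mulrn ?powR_ge0// /s -powRrM invfM -mulrA mulVf ?mulr1// gt_eqF//.
have skr : s ^+ k < rad.
  rewrite sk; set w := rad `^ 2^-1.
  have w1 : 1 < w.
    rewrite -(p1 2^-1) /w; apply: gt0_ltr_powR; rewrite ?invr_gt0 ?nnegrE//; lra.
  have <- : w * w = rad.
    rewrite /w -powRD; last by apply/implyP => _; rewrite gt_eqF//; lra.
    have -> : 2^-1 + 2^-1 = 1 :> R by lra. rewrite powRr1//; lra.
  by rewrite ltr_pMl//; lra.
have s0 : 0 < s by lra.
have sz : s <= cmod z.
  rewrite leNgt; apply/negP => zs.
  have : cmod z ^+ k < s ^+ k by rewrite ltrXn2r ?nnegrE ?cmod_ge0 ?ltW// -lt0n.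
  by move: skr zk; lra.
have [uphi _] := Sigma'_univalent sphi smphi.
have [_ _ _ [b1 _ /cvg_ctends' lim]] := sphi.
apply: (at_infinity_bound uphi lim s1) sz => w ws.
have /andP[_ /ltW h] : 1 < cmod (phi w) < rad by apply: small; rewrite ws.
by apply: le_trans h _; apply: ler_peMr; lra.
Qed.

End InclusionBound.

Section Snowflake.
Context {R : realType}.
Variables (phi : R[i] -> R[i]) (k : nat) (rad : R).
Hypothesis k2 : (2 <= k)%N.
Hypothesis sphi : Sigma' phi.
Hypothesis smphi : smooth_up_to_boundary phi.
Hypothesis rad1 : 1 < rad.
Hypothesis phi_ub : forall z : R[i], 1 < cmod z -> cmod (phi z) <= rad * cmod z.
Variables (tau : nat -> R) (Kb : nat -> R[i] -> R[i]).
Hypothesis KbP : forall j, is_koebe_transform (k ^ j) (rotate phi (tau j)) (Kb j).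

Local Notation dphi := (phi^`()%classic).

Lemma phi_uni : univalent_ext phi dphi.
Proof. exact: Sigma'_univalent. Qed.

Lemma phi_lb (z : R[i]) : 1 < cmod z -> cmod z <= cmod (phi z).
Proof.
have [dP _] := phi_uni; have [_ _ D1 [b b0 /cvg_ctends' lim]] := sphi.
exact: at_infinity_ge dP D1 b0 lim z.
Qed.

Lemma kj0 j : (0 < k ^ j)%N.
Proof. by rewrite expn_gt0 (leq_trans _ k2). Qed.

(** Rotations of the fixed transforms [Kb j], normalised at the angles [tau j]: a separate choice of
    transform for each [x] would say nothing about continuity in [x], on which measurability of the
    random composition rests. *)
Definition Phi j (x : R) : R[i] -> R[i] := rotate (Kb j) ((x - tau j) / (k ^ j)%:R).
Definition dPhi j (x : R) : R[i] -> R[i] := koebe_deriv dphi (k ^ j) x (Phi j x).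

Lemma PhiP j x : is_koebe_transform (k ^ j) (rotate phi x) (Phi j x).
Proof. exact: (rotate_koebe _ (kj0 j) (KbP j)). Qed.

Lemma Phi_facts j x : [/\ univalent_ext (Phi j x) (dPhi j x),
  forall z, 1 < cmod z -> 1 < cmod (Phi j x z) &
  forall z, 1 < cmod z -> cmod (Phi j x z) ^+ (k ^ j) = cmod (phi (expi (- x) * z ^+ (k ^ j)))].
Proof. by have [dP _] := phi_uni; exact: koebe_derivP (kj0 j) dP (PhiP j x). Qed.

Lemma arg_gt1 j (x : R) (z : R[i]) : 1 < cmod z -> 1 < cmod (expi (- x) * z ^+ (k ^ j)).
Proof. by move=> z1; rewrite cmodM cmod_expi mul1r; exact: cmodX_gt1 (kj0 j) z1. Qed.

Lemma Phi_ge j (x : R) (z : R[i]) : 1 < cmod z -> cmod z <= cmod (Phi j x z).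
Proof.
move=> z1; have [_ _ E] := Phi_facts j x.
rewrite -(ler_pXn2r (kj0 j)) ?nnegrE ?cmod_ge0// E//.
by have := phi_lb (arg_gt1 j x z1); rewrite cmodM cmod_expi mul1r cmodX.
Qed.

(** The root of order [k^j] turns [rad] into its power [1 / k^j]. This exponent is relaxed to
    [2^-j], which makes the sum over [j] explicit in [snow_facts]. *)
Lemma Phi_le j (x : R) (z : R[i]) : 1 < cmod z -> cmod (Phi j x z) <= rad `^ (2^-1 ^+ j) * cmod z.
Proof.
move=> z1; have [_ _ E] := Phi_facts j x.
rewrite -(ler_pXn2r (kj0 j)) ?nnegrE ?mulr_ge0 ?powR_ge0 ?cmod_ge0// E//.
have := phi_ub (arg_gt1 j x z1); rewrite cmodM cmod_expi mul1r cmodX => h.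
apply: le_trans h _; rewrite exprMn ler_wpM2r ?exprn_ge0 ?cmod_ge0//.
rewrite -powR_mulrn ?powR_ge0// -powRrM -[X in X <= _]powRr1; last by have := rad1; lra.
rewrite ler_powR ?(ltW rad1)// natrX -exprMn; apply: exprn_ege1.
by rewrite mulrC ler_pdivlMr// mul1r ler_nat.
Qed.

(** [snow th n] has [n] factors, so that it starts at the identity, and [snow th n.+1] is the
    composition [f_n] of the definition. The innermost factor is the one split off, since its angle
    is the one averaged first. *)
Fixpoint snow (th : nat -> R) n : R[i] -> R[i] :=
  if n is m.+1 then fun z => snow th m (Phi m (th m) z) else fun z => z.

Fixpoint dsnow (th : nat -> R) n : R[i] -> R[i] :=
  if n is m.+1 then fun z => dsnow th m (Phi m (th m) z) * dPhi m (th m) z else fun=> 1.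

Lemma snow_facts th n :
  [/\ univalent_ext (snow th n) (dsnow th n),
      forall z, 1 < cmod z -> cmod z <= cmod (snow th n z) &
      forall z, 1 < cmod z -> cmod (snow th n z) <= rad `^ (2 - 2 * 2^-1 ^+ n) * cmod z].
Proof.
elim: n => [|n [[d inj] lb ub]].
  split=> /= [|z _|z _]; [split=> [z z1|//]|by []|].
    by split; [exact: cderiv_id|exact: ccont_cst].
  by rewrite expr0 mulr1 subrr powRr0 mul1r.
have [[dP injP] P1 _] := Phi_facts n (th n).
split=> /= [|z z1|z z1].
- split=> [z z1|z w z1 w1 /inj]; last first.
    by move=> /(_ (P1 z z1) (P1 w w1)); exact: injP.
  have [dz cz] := dP z z1; have [dn cn] := d _ (P1 z z1).
  split; first exact: (cderiv_comp dz dn).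
  apply: ctendsM => //; exact: (ctends_comp (cderiv_cont dz) cn).
- by apply: le_trans (Phi_ge n (th n) z1) _; apply: lb; exact: P1.
- apply: le_trans (ub _ (P1 z z1)) _.
  apply: (@le_trans _ _ (rad `^ (2 - 2 * 2^-1 ^+ n) * (rad `^ (2^-1 ^+ n) * cmod z))).
    by rewrite ler_wpM2l ?powR_ge0// Phi_le.
  rewrite mulrA -powRD; last by apply/implyP => _; rewrite gt_eqF//; have := rad1; lra.
  suff -> : 2 - 2 * 2^-1 ^+ n + 2^-1 ^+ n = 2 - 2 * 2^-1 ^+ n.+1 :> R by [].
  by rewrite exprS mulrA divff ?pnatr_eq0// mul1r; move: (2^-1 ^+ n) => q; ring.
Qed.

Lemma rad0 : 0 < rad. Proof. by have := rad1; lra. Qed.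

Lemma good_snow th n : good (rad ^+ 2) (snow th n) (dsnow th n).
Proof.
have [u lb ub] := snow_facts th n; split=> // z z1; rewrite lb//=.
apply: le_trans (ub z z1) _; rewrite ler_wpM2r ?cmod_ge0// -powR_mulrn ?(ltW rad0)//.
by rewrite ler_powR ?(ltW rad1)// gerBl mulr_ge0// exprn_ge0// invr_ge0.
Qed.

Lemma good_Phi j x : good (rad ^+ 2) (Phi j x) (dPhi j x).
Proof.
have [u _ _] := Phi_facts j x; split=> // z z1; rewrite Phi_ge//=.
apply: le_trans (Phi_le j x z1) _; rewrite ler_wpM2r ?cmod_ge0// -powR_mulrn ?(ltW rad0)//.
rewrite ler_powR ?(ltW rad1)//; apply: (@le_trans _ _ 1); last by rewrite ler1n.
by rewrite exprn_ile1// invf_le1// ler1n.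
Qed.

(* With [r = |z|^(k^(j+1))], the modulus of [Phi_j] and of its derivative at
   [z] only involve [phi] at a point of modulus [r^(1/k)]. *)
Lemma Phi_modulus j x (rho a : R) : 1 < rho ->
  let z := circ 0 rho a in
  let u := (rho ^+ (k ^ j))%:C * expi ((k ^ j)%:R * a - x) in
  cmod (Phi j x z) ^+ (k ^ j) = cmod (phi u) /\
  cmod (dPhi j x z) = cmod (dphi u) * (rho ^+ (k ^ j) / rho) * (cmod (Phi j x z) / cmod (phi u)).
Proof.
move=> r1 z u; have r0 : 0 < rho by lra.
have cz : cmod z = rho by rewrite /z /circ add0r cmodM cmod_expi mulr1 cmodR gtr0_norm.
have z1 : 1 < cmod z by rewrite cz.
have uE : expi (- x) * z ^+ (k ^ j) = u.
  rewrite /z /u /circ add0r exprMn expiX expiD (rmorphXn (real_complex R)) /=; ring.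
have [_ P1 E] := Phi_facts j x.
split; first by rewrite E// uE.
have P0 : 0 < cmod (Phi j x z) by apply: lt_trans (P1 z z1).
have dE : cmod (dPhi j x z) = cmod (dphi u) * rho ^+ (k ^ j).-1 / cmod (Phi j x z) ^+ (k ^ j).-1.
  rewrite /dPhi /koebe_deriv uE -[in RHS]cz.
  by move: (Phi j x z) (dphi u) => P D; rewrite cmodM cmodM cmodV !cmodX.
have PE : cmod (phi u) = cmod (Phi j x z) ^+ (k ^ j) by rewrite -uE -E.
rewrite dE PE -mulrA -[RHS]mulrA; congr (_ * _).
have X1 (y : R) : 0 < y -> y ^+ (k ^ j).-1 = y ^+ (k ^ j) / y.
  move=> y0; rewrite -{2}(prednK (kj0 j)) exprSr mulfK//; by rewrite gt_eqF.
rewrite !X1//; congr (_ * _); by rewrite invfM invrK mulrC.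
Qed.

Lemma Phi_cont_x j (z : R[i]) (x : R) : 1 < cmod z ->
  ctends (nbhs x) (fun y => Phi j y z) (Phi j x z).
Proof.
move=> z1; rewrite /Phi /rotate.
have c1 : (y - tau j) / (k ^ j)%:R @[y --> x] --> (x - tau j) / (k ^ j)%:R.
  apply: (@cvgRM _ _ (nbhs x)); last exact: cvg_cst.
  by apply: (@cvgRB _ _ (nbhs x)); [exact: cvg_id|exact: cvg_cst].
have c2 : - ((y - tau j) / (k ^ j)%:R) @[y --> x] --> - ((x - tau j) / (k ^ j)%:R).
  exact: (@cvgRN _ _ (nbhs x)).
apply: ctendsM; first exact: ctends_expi.
have [dK _ _ _] := (KbP j).1.
have arg1 : 1 < cmod (expi (- ((x - tau j) / (k ^ j)%:R)) * z).
  by rewrite cmodM cmod_expi mul1r.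
have Kc := cderiv_cont (derivable_cderiv (dK _ arg1)).
apply: (ctends_comp _ Kc); apply: ctendsM; last exact: ctends_cst.
exact: ctends_expi.
Qed.

Lemma dPhi_cont_x j (z : R[i]) (x : R) : 1 < cmod z ->
  ctends (nbhs x) (fun y => dPhi j y z) (dPhi j x z).
Proof.
move=> z1; have [_ P1 _] := Phi_facts j x.
have [dP _] := phi_uni; have [_ cp] := dP _ (arg_gt1 j x z1).
have cN : - y @[y --> x] --> - x by apply: (@cvgRN _ _ (nbhs x)); exact: cvg_id.
apply: ctendsM.
  apply: ctendsM; last exact: ctends_cst.
  apply: (ctends_comp _ cp); apply: ctendsM; last exact: ctends_cst.
  exact: ctends_expi.
apply: ctendsV; first by rewrite expf_neq0// -cmod_gt0 (lt_trans _ (P1 z z1)).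
by apply: ctendsX; exact: Phi_cont_x.
Qed.

End Snowflake.

(** * Integral means of random snowflakes *)

Section StepApproximation.
Context {R : realType}.

(** A grid of mesh [1 / (n + 1)] on [[-(n + 1), n + 1)], hence with [2 (n + 1)^2] cells. In [step]
    the angle is frozen at the left node of its cell, so that only finitely many values of it
    occur. *)
Definition node (n i : nat) : R := (i%:R - n.+1%:R ^+ 2) / n.+1%:R.
Definition cell (n i : nat) : set R := `[node n i, node n i.+1[%classic.
Definition step (n : nat) (x : R) (a : R -> R) : R :=
  \sum_(i < (2 * n.+1 ^ 2)%N) \1_(cell n i) x * a (node n i).
Definition node_of (n : nat) (x : R) : R :=
  node n (Num.truncn (n.+1%:R * x + n.+1%:R ^+ 2)).

Lemma cellE (n i : nat) (x : R) : 0 <= n.+1%:R * x + n.+1%:R ^+ 2 ->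
  (x \in cell n i) = (Num.truncn (n.+1%:R * x + n.+1%:R ^+ 2) == i).
Proof.
move=> y0; rewrite truncn_eq// /cell /node; have n0 : 0 < n.+1%:R :> R by rewrite ltr0n.
rewrite mem_setE in_itv /= ler_pdivrMr// ltr_pdivlMr// lerBlDr ltrBrDr.
by rewrite (mulrC x).
Qed.

Lemma step_in n x a : - n.+1%:R <= x < n.+1%:R -> step n x a = a (node_of n x).
Proof.
move=> /andP[xl xr]; have n0 : 0 < n.+1%:R :> R by rewrite ltr0n.
set y := n.+1%:R * x + n.+1%:R ^+ 2.
have y0 : 0 <= y.
  have -> : y = n.+1%:R * (x + n.+1%:R) by rewrite /y; ring.
  by apply: mulr_ge0; [exact: ltW|lra].
have iy : (Num.truncn y < 2 * n.+1 ^ 2)%N.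
  rewrite truncn_lt_nat// natrM natrX.
  have -> : y = n.+1%:R * (x + n.+1%:R) by rewrite /y; ring.
  rewrite (_ : 2%:R * _ = n.+1%:R * (n.+1%:R + n.+1%:R)); last by ring.
  by rewrite ltr_pM2l// ltrD2r.
rewrite /step (bigD1 (Ordinal iy)) //= big1 ?addr0.
  by rewrite indicE cellE// eqxx mul1r.
move=> i inz; rewrite indicE cellE//.
by rewrite (_ : (_ == _) = false) ?mul0r//; apply: contra_neqF inz => /eqP h; apply/val_inj.
Qed.

Lemma step_out n x a : ~~ (- n.+1%:R <= x < n.+1%:R) -> step n x a = 0.
Proof.
move=> xn; have n0 : 0 < n.+1%:R :> R by rewrite ltr0n.
rewrite /step big1// => i _; rewrite indicE (_ : (x \in _) = false) ?mul0r//.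
apply: contraNF xn; rewrite /cell /node mem_setE in_itv /= ler_pdivrMr// ltr_pdivlMr//.
move=> /andP[h1 h2]; apply/andP; split.
  rewrite -(ler_pM2r n0); have : 0 <= i%:R :> R by []. lra.
rewrite -(ltr_pM2r n0); apply: lt_le_trans h2 _.
have : (i.+1 <= 2 * n.+1 ^ 2)%N by [].
by rewrite -(ler_nat R) natrM natrX; lra.
Qed.

Lemma node_of_close n x : - n.+1%:R <= x -> `|node_of n x - x| <= n.+1%:R^-1.
Proof.
move=> xl; have n0 : 0 < n.+1%:R :> R by rewrite ltr0n.
set y := n.+1%:R * x + n.+1%:R ^+ 2.
have y0 : 0 <= y.
  have -> : y = n.+1%:R * (x + n.+1%:R) by rewrite /y; ring.
  by apply: mulr_ge0; [exact: ltW|lra].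
have /andP[h1 h2] := truncn_itv y0.
rewrite /node_of -/y /node (_ : _ - x = ((Num.truncn y)%:R - y) / n.+1%:R); last first.
  by rewrite /y; field; rewrite gt_eqF.
rewrite normrM normfV (gtr0_norm n0) ler_piMl// ?invr_ge0 ?(ltW n0)//.
by rewrite ler_norml; move: h1 h2; rewrite -natr1 => h1 h2; apply/andP; split; lra.
Qed.

Lemma node_of_cvg (x : R) : node_of n x @[n --> \oo] --> x.
Proof.
apply/cvgrPdist_le => e e0.
have h1 : \forall n \near \oo, `|x| <= n.+1%:R.
  near=> n; apply: (@le_trans _ _ n%:R); last by rewrite ler_nat.
  by near: n; exact: nbhs_infty_ger.
have h2 : \forall n \near \oo, n.+1%:R^-1 <= e.
  near=> n; rewrite -[e]invrK lef_pV2 ?posrE ?invr_gt0//.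
  apply: (@le_trans _ _ n%:R); last by rewrite ler_nat.
  by near: n; exact: nbhs_infty_ger.
apply: filterS2 h1 h2 => n h1 h2; rewrite distrC; apply: le_trans h2.
by apply: node_of_close; move: h1; rewrite ler_norml => /andP[].
Unshelve. all: by end_near. Qed.

Lemma step_cvg (x : R) (a : R -> R) : a y @[y --> x] --> a x -> step n x a @[n --> \oo] --> a x.
Proof.
move=> ac; have : a (node_of n x) @[n --> \oo] --> a x by exact: (cvg_comp _ _ (@node_of_cvg x) ac).
apply: cvg_trans.
apply: near_eq_cvg; near=> n; rewrite /= step_in//.
have : `|x| < n.+1%:R.
  near: n; near=> n; apply: (@lt_le_trans _ _ n%:R); last by rewrite ler_nat.
  by near: n; exact: nbhs_infty_gtr.
by rewrite ltr_norml => /andP[h1 h2]; rewrite (ltW h1).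
Unshelve. all: by end_near. Qed.

Lemma step_bound n x a (C : R) : 0 <= C -> (forall y, 0 <= a y <= C) -> 0 <= step n x a <= C.
Proof.
move=> C0 aC; have [h|h] := boolP (- n.+1%:R <= x < n.+1%:R); first by rewrite step_in.
by rewrite step_out// lexx C0.
Qed.

(** Freezing the parameter at grid nodes gives finite sums of measurable functions, and continuity
    at the parameter [X w] makes them converge pointwise. *)
Lemma caratheodory_measurable {d : measure_display} {T : measurableType d}
  (J : R -> T -> R) (X : T -> R) (D : set T) : measurable D ->
  measurable_fun D X -> (forall x, measurable_fun D (J x)) ->
  (forall w, D w -> J y w @[y --> X w] --> J (X w) w) ->
  measurable_fun D (fun w => J (X w) w).
Proof.
move=> mD mX mJ cJ.
apply: (measurable_fun_cvg (h := fun n w => step n (X w) (J ^~ w))) => // [n|w Dw].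
  apply: measurable_sum => i; apply: measurable_funM => //.
  apply: (@measurableT_comp _ _ _ _ _ _ (\1_(cell n i) : R -> R)) => //.
  by apply: measurable_indic; exact: measurable_itv.
by apply: (@step_cvg (X w) (J ^~ w)); exact: cJ.
Qed.

Lemma prob_bounded_cvg {d : measure_display} {Omega : measurableType d} (Pr : probability Omega R)
  (D : set Omega) (F_ : nat -> Omega -> R) (F : Omega -> R) (C : R) : measurable D ->
  (forall n, measurable_fun setT (F_ n)) -> measurable_fun setT F ->
  (forall n w, 0 <= F_ n w <= C) -> (forall w, F_ n w @[n --> \oo] --> F w) ->
  (\int[Pr]_(w in D) (F_ n w)%:E @[n --> \oo] --> \int[Pr]_(w in D) (F w)%:E)%E.
Proof.
move=> mD mF_ mF FC cF.
have [|||||_ _ //] := @dominated_convergence _ _ _ Pr D mD (fun n w => (F_ n w)%:E)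
  (EFin \o F) (fun=> C%:E).
- by move=> n; apply/measurable_EFinP; exact: measurable_funTS.
- by apply/measurable_EFinP; exact: measurable_funTS.
- by apply: (@aeW _ _ _ Pr) => w _; apply: cvg_EFin; [exact: nearW|exact: cF].
- exact: finite_measure_integrable_cst.
- by apply: (@aeW _ _ _ Pr) => w n _; rewrite lee_fin ger0_norm; have /andP[] := FC n w.
Qed.

End StepApproximation.

Section Independence.
Context {R : realType} {d : measure_display} {Omega : measurableType d}.
Variable (Pr : probability Omega R).
Variables (J : R -> Omega -> R) (g : R -> R) (X : {RV Pr >-> R}) (E : set Omega) (C : R).
Hypothesis mE : measurable E.
Hypothesis mJ : forall x, measurable_fun setT (J x).
Hypothesis JC : forall x w, 0 <= J x w <= C.
Hypothesis cJ : forall w (x : R), J y w @[y --> x] --> J x w.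
Hypothesis gC : forall x, 0 <= g x <= C.
Hypothesis cg : continuous g.
Hypothesis indep : forall x (I : set R), measurable I ->
  (\int[Pr]_(w in E `&` X @^-1` I) (J x w)%:E = Pr E * Pr (X @^-1` I) * (g x)%:E)%E.

Let C0 : 0 <= C. Proof. by have /andP[h1 h2] := gC 0; exact: le_trans h2. Qed.

Let mcell n i : measurable (X @^-1` (cell n i : set R)).
Proof. by apply: measurable_funPTI; exact: measurable_itv. Qed.

Let mind n i : measurable_fun setT (fun w => \1_(cell n i) (X w) : R).
Proof. by apply: measurableT_comp; [apply: measurable_indic; exact: measurable_itv|exact: measurable_funPT]. Qed.

Let mstepJ n : measurable_fun setT (fun w => step n (X w) (J ^~ w)).
Proof. by apply: measurable_sum => i; apply: measurable_funM. Qed.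

Let mstepg n : measurable_fun setT (fun w => step n (X w) g).
Proof. by apply: measurable_sum => i; apply: measurable_funM. Qed.

Let mgX : measurable_fun setT (fun w => g (X w)).
Proof.
apply: (measurable_fun_cvg (h := fun n w => step n (X w) g)) => // w _.
apply: step_cvg; exact: cg.
Qed.

Let int_ind (D : set Omega) n i (f : Omega -> R) : measurable D ->
  (\int[Pr]_(w in D) (\1_(cell n i) (X w) * f w)%:E =
   \int[Pr]_(w in D `&` X @^-1` (cell n i)) (f w)%:E)%E.
Proof.
move=> mD; rewrite integral_mkcondr; apply: eq_integral => w _.
rewrite /patch indicE (_ : (X w \in cell n i) = (w \in X @^-1` cell n i)); last first.
  by apply/idP/idP; rewrite !inE.
by case: ifP => _; rewrite ?mul1r ?mul0r.
Qed.

Let int_step (D : set Omega) n (a : R -> Omega -> R) : measurable D ->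
  (forall x, measurable_fun setT (a x)) -> (forall x w, 0 <= a x w) ->
  (\int[Pr]_(w in D) (step n (X w) (a ^~ w))%:E =
   \sum_(i < (2 * n.+1 ^ 2)%N) \int[Pr]_(w in D `&` X @^-1` (cell n i)) (a (node n i) w)%:E)%E.
Proof.
move=> mD ma a0; under eq_integral do rewrite /step -sumEFin.
rewrite ge0_integral_sum//.
- by apply: eq_bigr => i _; exact: int_ind.
- move=> i; apply/measurable_EFinP; apply: measurable_funTS.
  exact: measurable_funM.
- by move=> i w _; rewrite lee_fin mulr_ge0// indicE.
Qed.

(** Here [g x] is the mean of [J x], and [indep] says that [J x] is independent of [X], tested on
    cells. On step functions both sides are the same finite sum over cells; dominated convergence
    gives the rest. *)
Lemma integral_indep :
  (\int[Pr]_(w in E) (J (X w) w)%:E = Pr E * \int[Pr]_w (g (X w))%:E)%E.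
Proof.
have h1 : (\int[Pr]_(w in E) (step n (X w) (J ^~ w))%:E @[n --> \oo] --> \int[Pr]_(w in E) (J (X w) w)%:E)%E.
  apply: (prob_bounded_cvg (C := C)) => //; first exact: caratheodory_measurable.
    by move=> n w; apply: step_bound => // y; exact: JC.
  by move=> w; apply: (@step_cvg _ (X w) (J ^~ w)); exact: cJ.
have h2 : (\int[Pr]_w (step n (X w) g)%:E @[n --> \oo] --> \int[Pr]_w (g (X w))%:E)%E.
  apply: (prob_bounded_cvg (C := C)) => //; first by move=> n w; exact: (step_bound n (X w) C0 gC).
  by move=> w; apply: step_cvg; exact: cg.
have fE : (Pr E \is a fin_num)%E by exact: fin_num_measure.
have h3 : (Pr E * (\int[Pr]_w (step n (X w) g)%:E) @[n --> \oo] --> Pr E * (\int[Pr]_w (g (X w))%:E))%E.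
  by apply: cvgeZl.
apply: (cvg_unique _ h1) => //.
suff -> : (fun n => \int[Pr]_(w in E) (step n (X w) (J ^~ w))%:E)%E =
          (fun n => Pr E * (\int[Pr]_w (step n (X w) g)%:E))%E by exact: h3.
apply/funext => n.
rewrite int_step//; last by move=> x w; have /andP[] := JC x w.
rewrite (@int_step setT n (fun x _ => g x))//; last by move=> x w; have /andP[] := gC x.
rewrite ge0_sume_distrr//; last first.
  by move=> i _; apply: integral_ge0 => w _; rewrite lee_fin; have /andP[] := gC (node n i).
apply: eq_bigr => i _; rewrite indep; last exact: measurable_itv.
rewrite setTI integral_cst; last exact: mcell.
by rewrite -muleA; congr (_ * _)%E; exact: muleC.
Qed.

End Independence.

Section RealLemmas.
Context {R : realType}.
Local Notation mu := (@lebesgue_measure R).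

Lemma cvg_powR {T : Type} (F : set_system T) {FF : Filter F} (f : T -> R) (l t : R) :
  0 < l -> f x @[x --> F] --> l -> f x `^ t @[x --> F] --> l `^ t.
Proof.
move=> l0 fl; have H : {for l, continuous (fun y : R => y `^ t)}.
  apply: differentiable_continuous; apply/derivable1_diffP.
  by have := is_derive1_powR t l0; case.
exact: (cvg_comp _ _ fl H).
Qed.

Lemma Rintegral_FTC (f H : R -> R) (a b : R) : a < b -> continuous f ->
  (forall x, a <= x <= b -> is_derive x 1 H (f x)) ->
  \int[mu]_(x in `[a, b]) f x = H b - H a.
Proof.
move=> ab fc dH.
have Hc x : a <= x <= b -> {for x, continuous H}.
  by move=> /dH dx; apply: differentiable_continuous; apply/derivable1_diffP; case: dx.
rewrite /Rintegral (@continuous_FTC2 R f H a b ab)//.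
- exact: continuous_subspaceT.
- split.
  + by move=> x; rewrite in_itv /= => /andP[/ltW ax /ltW xb]; have := dH x; rewrite ax xb => /(_ isT); case.
  + by apply: cvg_at_right_filter; apply: Hc; rewrite lexx ltW.
  + by apply: cvg_at_left_filter; apply: Hc; rewrite lexx ltW.
- by move=> x; rewrite in_itv /= => /andP[/ltW ax /ltW xb]; rewrite derive1E; apply: derive_val; apply: dH; rewrite ax.
Qed.

(** Both integrals are increments, over intervals of length [p], of a primitive [H] based far enough
    to the left; by periodicity such an increment [D s] has zero derivative in [s]. *)
Lemma periodic_integral (G : R -> R) (c : R) : continuous G ->
  (forall x, G (x + 2 * pi) = G x) ->
  \int[mu]_(x in `[0, 2 * pi]) G (c - x) = \int[mu]_(x in `[0, 2 * pi]) G x.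
Proof.
move=> Gc Gper; have p0 := @pi2_gt0 R; set p := 2 * pi in p0 Gper *.
pose L := `|c| + 2 * p + 1.
have cL : - L < c - p /\ c < L /\ -L < 0.
  have := ler_norm c; have := ler_norm (- c); rewrite normrN /L => h1 h2.
  by split; [|split]; have := normr_ge0 c; lra.
have intG : mu.-integrable `[- L, L] (EFin \o G).
  by apply: continuous_compact_integrable; [exact: segment_compact|exact: continuous_subspaceT].
pose H x := \int[mu]_(t in `[- L, x]) G t.
have dH x : - L < x < L -> is_derive x 1 H (G x).
  move=> /andP[xl xr]; have [h1 h2] := continuous_FTC1_closed xr intG xl (Gc x).
  by apply: DeriveDef h1 _; rewrite -derive1E.
have -> : \int[mu]_(x in `[0, p]) G x = H p - H 0.
  apply: Rintegral_FTC => //.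
  by move=> x /andP[x0 xp]; apply: dH; have h0 := normr_ge0 c; rewrite /L; apply/andP; split; lra.
have Gcc : continuous (fun x => G (c - x)).
  move=> x; apply: (cvg_comp _ _ (G := nbhs (c - x))); last exact: Gc.
  by apply: (@cvgRB _ _ (nbhs x)); [exact: cvg_cst|exact: cvg_id].
have dHc x : 0 <= x <= p -> is_derive x 1 (fun y => - H (c - y)) (G (c - x)).
  move=> /andP[x0 xp]; have := dH (c - x).
  have -> : - L < c - x < L by have [? [? ?]] := cL; apply/andP; split; lra.
  move=> /(_ isT) dHx.
  have dc : is_derive x 1 (fun y : R => c - y) (-1).
    by apply: is_derive_eq; ring.
  have := @is_derive1_comp R H (fun y => c - y) x _ _ dHx dc => dcomp.
  have := is_deriveN dcomp => dN.
  by apply: is_derive_eq dN _; rewrite mulrN1 opprK.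
have -> : \int[mu]_(x in `[0, p]) G (c - x) = H c - H (c - p).
  by rewrite (Rintegral_FTC p0 Gcc dHc) subr0 opprK addrC.
pose D s := H (s + p) - H s.
have dD s : - L < s -> s + p < L -> is_derive s 1 D 0.
  move=> s1 s2; have h1 := dH s; have h2 := dH (s + p).
  have e1 : - L < s < L by apply/andP; split; lra.
  have e2 : - L < s + p < L by apply/andP; split; lra.
  have {}h1 := h1 e1; have {}h2 := h2 e2.
  have dc : is_derive s 1 (fun y : R => y + p) 1.
    by apply: is_derive_eq; ring.
  have dcomp := @is_derive1_comp R H (fun y => y + p) s _ _ h2 dc.
  have dB := is_deriveB dcomp h1.
  by apply: is_derive_eq dB _; rewrite mulr1 Gper subrr.
have Dcst (a b : R) : a <= b -> - L < a -> b + p < L -> D a = D b.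
  move=> ab aL bL.
  have d x : a <= x <= b -> is_derive x 1 D 0 by move=> /andP[? ?]; apply: dD; lra.
  have [||c0 _] := @MVT_segment _ D (fun=> 0) a b ab.
  - by move=> x; rewrite in_itv /= => /andP[/ltW h1 /ltW h2]; apply: d; rewrite h1.
  - apply/continuous_in_subspaceT => x; rewrite inE /= in_itv /= => xab.
    by apply: differentiable_continuous; apply/derivable1_diffP; case: (d x xab).
  - by rewrite mul0r => /eqP; rewrite subr_eq0 => /eqP.
have -> : H c - H (c - p) = D (c - p) by rewrite /D subrK.
have -> : H p - H 0 = D 0 by rewrite /D add0r.
have [? [? ?]] := cL; have := normr_ge0 c; have := ler_norm c => h1 h2.
have [cp|cp] := lerP (c - p) 0; first by apply: Dcst => //; rewrite /L; lra.
by apply/esym; apply: Dcst; rewrite ?ltW//; rewrite /L; lra.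
Qed.

End RealLemmas.

Section GoodPowers.
Context {R : realType}.

Lemma good_powR_bounds (B a b t : R) : 1 < a -> a <= b -> 0 <= B ->
  exists c C : R, [/\ 0 < c, 0 < C & forall h dh, good B h dh ->
    forall z, a <= cmod z <= b -> c <= cmod (dh z) `^ t <= C].
Proof.
move=> a1 ab B0; have [c0 c00 lb] := good_deriv_ge a1 ab B0.
pose C0 := 16 * B * b / (a - 1).
have p0 : 0 < Num.max C0 c0^-1 + 1.
  have : c0^-1 <= Num.max C0 c0^-1 by rewrite le_max lexx orbT.
  by have : 0 < c0^-1; [rewrite invr_gt0|lra].
exists ((Num.max C0 c0^-1 + 1) `^ (- `|t|)), ((Num.max C0 c0^-1 + 1) `^ `|t|).
split; rewrite ?powR_gt0// => h dh gh z zab.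
apply: powR_bounds => //; rewrite (lb h dh gh z zab)/=.
have /andP[az zb] := zab; have z1 : 1 < cmod z by lra.
apply: le_trans (good_deriv_le gh z1) _.
rewrite ler_pdivrMr ?subr_gt0// (_ : C0 * _ = 16 * B * (b * ((cmod z - 1) / (a - 1)))); last first.
  by rewrite /C0; ring.
apply: ler_wpM2l; first by apply: mulr_ge0.
rewrite -[X in X <= _]mulr1 ler_pM ?cmod_ge0//.
by rewrite ler_pdivlMr ?subr_gt0// mul1r; lra.
Qed.

End GoodPowers.

Section Probability.
Context {R : realType} {d : measure_display} {Omega : measurableType d}.
Variable (Pr : probability Omega R).

Lemma uniform_rv_integral (X : {RV Pr >-> R}) (g : R -> R) :
  (forall A, measurable A -> distribution Pr X A = uniform_prob (@lt0_2pi R) A) ->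
  continuous g -> (forall x, 0 <= g x) ->
  (\int[Pr]_w (g (X w))%:E = ((2 * pi)^-1 * \int[lebesgue_measure]_(x in `[0%R, (2 * pi)%R]) g x)%R%:E)%E.
Proof.
move=> dX cg g0.
pose Z : Omega -> measurableTypeR R := X.
have mX : @measurable_fun d _ Omega (measurableTypeR R) setT Z.
  exact: (measurable_funPT X).
have mg : @measurable_fun _ _ (measurableTypeR R) _ setT (EFin \o g).
  apply/measurable_EFinP; exact: (continuous_measurable_fun cg).
have g0' x : (0 <= (EFin \o g) x)%E by rewrite lee_fin.
have h1 := @ge0_integral_pushforward _ _ _ (measurableTypeR R) R Z mX Pr setT (EFin \o g) measurableT mg.
have h2 := @eq_measure_integral _ (measurableTypeR R) R setT (uniform_prob (@lt0_2pi R)) (pushforward Pr Z) (EFin \o g).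
rewrite preimage_setT in h1; rewrite -[LHS]h1; last by move=> x _; exact: g0'.
rewrite (h2 mX (fun A mA _ => dX A mA)).
rewrite (integral_uniform _ mg g0') subr0 EFinM; congr (_ * _)%E.
rewrite /Rintegral fineK//; apply: integrable_fin_num => //.
exact: integrable_D.
Qed.

Definition rv_event (X : nat -> {RV Pr >-> R}) N (A : nat -> set R) : set Omega :=
  \bigcap_(j < N) (X j @^-1` A j).

Lemma measurable_rv_event X N A : (forall j, measurable (A j)) -> measurable (rv_event X N A).
Proof.
move=> mA;apply: fin_bigcap_measurable => [|j _]; first exact: finite_II.
by apply: measurable_funPTI.
Qed.

(** Since [A] leaves the angle [n] free, constraining it gives an event of the same kind, with the
    product rule between the two. This keeps the induction in [mean_claimS] within such events. *)
Lemma rv_event_split X N A n (I : set R) : mutually_independent X ->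
  (forall j, measurable (A j)) -> A n = setT -> measurable I ->
  let A' j := if j == n then I else if (j < N)%N then A j else setT in
  let M := maxn N n.+1 in
  rv_event X N A `&` X n @^-1` I = rv_event X M A' /\
  Pr (rv_event X M A') = (Pr (rv_event X N A) * Pr (X n @^-1` I))%E.
Proof.
move=> indX mA An mI A' M.
have nM : (n < M)%N by rewrite /M leq_max ltnSn orbT.
have mA' j : measurable (A' j).
  by rewrite /A'; case: ifP => // _; case: ifP.
have EI : rv_event X N A `&` X n @^-1` I = rv_event X M A'.
  apply/seteqP; split => w /=.
    move=> [wA wI] j /= jM; rewrite /A'; case: ifP => [/eqP ->//|_].
    by case: ifP => // jN; exact: wA.
  move=> wA'; split; last by have := wA' n nM; rewrite /A' eqxx.
  move=> j jN; have jM : (j < M)%N by rewrite /M leq_max jN.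
  have := wA' j jM; rewrite /A' jN /=; case: ifP => [/eqP -> _|//].
  by rewrite /= An.
split=> //.
pose A0 j := if (j < N)%N then A j else setT.
have E0 : rv_event X N A = rv_event X M A0.
  apply/seteqP; split => w wA j /= jM.
    by rewrite /A0; case: ifP => // jN; exact: wA.
  have jM' : (j < M)%N by rewrite /M leq_max jM.
  by have := wA j jM'; rewrite /A0 jM.
have mA0 j : measurable (A0 j) by rewrite /A0; case: ifP.
rewrite E0 /rv_event (indX _ _ mA') (indX _ _ mA0).
rewrite (bigD1 (Ordinal nM))//= [in RHS](bigD1 (Ordinal nM))//=.
have -> : Pr (X n @^-1` A0 n) = 1%E.
  by rewrite /A0; case: ifP => _; rewrite ?An preimage_setT probability_setT.
rewrite mul1e muleC /A' eqxx; congr (_ * _)%E.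
by apply: eq_bigr => j jn; rewrite /A' /A0 (_ : (_ == n) = false)//; apply/negbTE.
Qed.

End Probability.

(** * The operator and the mean of the derivative *)

Section MeanDeriv.
Context {R : realType}.
Variables (phi : R[i] -> R[i]) (k : nat) (t : R).
Local Notation dphi := (phi^`()%classic).

Definition opP_iter n : R -> R := iter n (opP phi k t) id.

Definition mean_deriv n (rho : R) : R :=
  rho `^ (- t) * (rho ^+ (k ^ n)) `^ (t - 1) * opP_iter n (rho ^+ (k ^ n)).

Lemma opP_ge0 nu r : (forall s : R, 0 <= s -> 0 <= nu s) -> 0 <= opP phi k t nu r.
Proof.
move=> nu0; rewrite /opP mulr_ge0 ?powR_ge0//.
apply: Rintegral_ge0 => x _; rewrite !mulr_ge0 ?invr_ge0 ?mulr_ge0 ?powR_ge0 ?cmod_ge0 ?pi_ge0//.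
by apply: nu0; exact: cmod_ge0.
Qed.

Lemma opP_iter_ge0 n r : 0 <= r -> 0 <= opP_iter n r.
Proof.
case: n => [//|n] r0; elim: n r r0 => [|n IHn] r r0; first exact: opP_ge0.
by apply: opP_ge0 => s s0; exact: IHn.
Qed.

Lemma mean_deriv_ge0 n rho : 0 <= rho -> 0 <= mean_deriv n rho.
Proof.
move=> r0; rewrite /mean_deriv mulr_ge0 ?mulr_ge0 ?powR_ge0//.
by apply: opP_iter_ge0; exact: exprn_ge0.
Qed.

Lemma powR_VE (x s : R) : 0 < x -> x^-1 `^ s = x `^ (- s).
Proof.
move=> x0; rewrite powRN -[RHS]div1r; apply: (canRL (mulfK _)); first by rewrite gt_eqF// powR_gt0.
by rewrite -powRM ?invr_ge0 ?(ltW x0)// mulVf ?gt_eqF// powR1.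
Qed.

Hypothesis k2 : (2 <= k)%N.
Hypothesis sphi : Sigma' phi.
Hypothesis smphi : smooth_up_to_boundary phi.
Variables (tau : nat -> R) (Kb : nat -> R[i] -> R[i]).
Hypothesis KbP : forall j, is_koebe_transform (k ^ j) (rotate phi (tau j)) (Kb j).
Local Notation Ph := (Phi k tau Kb).
Local Notation dPh := (dPhi phi k tau Kb).

Lemma mean_deriv_Phi n (x rho a : R) : 1 < rho ->
  let z := circ 0 rho a in let q := rho ^+ (k ^ n) in
  let u := q%:C * expi ((k ^ n)%:R * a - x) in
  mean_deriv n (cmod (Ph n x z)) * cmod (dPh n x z) `^ t =
  rho `^ (- t) * q `^ t * (opP_iter n (cmod (phi u)) / cmod (phi u) * cmod (dphi u) `^ t).
Proof.
move=> r1 z q u; have [E1 E2] := Phi_modulus k2 sphi smphi KbP n x a r1.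
have r0 : 0 < rho by lra.
have z1 : 1 < cmod z by rewrite /z /circ add0r cmodM cmod_expi mulr1 cmodR gtr0_norm.
have [_ P1 _] := Phi_facts k2 sphi smphi KbP n x.
have := P1 z z1; rewrite -/q -/u -/z in E1 E2 *.
rewrite E2 /mean_deriv E1; move: (cmod (Ph n x z)) E1 => F E1 F1.
have F0 : 0 < F by lra.
have p0 : 0 < cmod (phi u) by rewrite -E1 exprn_gt0.
move: (cmod (phi u)) p0 => p p0; move: (opP_iter n p) => U.
move: (cmod (dphi u)) (cmod_ge0 (dphi u)) => D D0.
have q0 : 0 < q by rewrite /q exprn_gt0.
clearbody q.
have r0' := ltW r0; have F0' := ltW F0; have p0' := ltW p0; have q0' := ltW q0.
rewrite !powRM ?mulr_ge0 ?invr_ge0//.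
rewrite !powR_VE//.
have e1 : F `^ (- t) * F `^ t = 1 by rewrite powRN mulVf// gt_eqF// powR_gt0.
have e2 : p `^ (t - 1) * p `^ (- t) = p^-1.
  rewrite -powRD; last by apply/implyP => _; rewrite gt_eqF.
  by rewrite (_ : t - 1 - t = -1) ?powR_inv1//; ring.
rewrite -e2 -[RHS]mul1r -e1; ring.
Qed.

(** The angle [x] enters only through the argument [k^n a - x], so by periodicity its average is the
    circle average in [opP], at radius [q = r^(1/k)]. The exponents match because
    [(t - 1) + (1 - (k - 1) t / k) = t / k]. *)
Lemma mean_deriv_step n (rho a : R) : 1 < rho -> let z := circ 0 rho a in
  let g x := mean_deriv n (cmod (Ph n x z)) * cmod (dPh n x z) `^ t in
  continuous g ->
  (2 * pi)^-1 * \int[lebesgue_measure]_(x in `[0, 2 * pi]) g x = mean_deriv n.+1 rho.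
Proof.
move=> r1 z g cg; pose q := rho ^+ (k ^ n).
have r0 : 0 < rho by lra.
have q0 : 0 < q by rewrite /q exprn_gt0.
pose c0 := (k ^ n)%:R * a; pose u y := q%:C * expi y : R[i].
pose G0 y := opP_iter n (cmod (phi (u y))) / cmod (phi (u y)) * cmod (dphi (u y)) `^ t.
pose c := rho `^ (- t) * q `^ t.
have c_neq0 : c != 0 by rewrite gt_eqF// mulr_gt0 ?powR_gt0.
have gE x : g x = c * G0 (c0 - x) by rewrite /g mean_deriv_Phi.
have cG : continuous (fun y => c * G0 y).
  have -> : (fun y => c * G0 y) = (fun y => g (c0 - y)).
    by apply/funext => y; rewrite gE; congr (_ * G0 _); ring.
  move=> x; apply: (cvg_comp _ _ (G := nbhs (c0 - x))); last exact: cg.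
  by apply: (@cvgRB _ _ (nbhs x)); [exact: cvg_cst|exact: cvg_id].
have per x : c * G0 (x + 2 * pi) = c * G0 x by rewrite /G0 /u expi_2pi.
have cG0 : continuous G0.
  have -> : G0 = (fun y => c^-1 * (c * G0 y)) by apply/funext => y; rewrite mulKf.
  by move=> x; apply: (@cvgRM _ _ (nbhs x)); [exact: cvg_cst|exact: cG].
have -> : \int[lebesgue_measure]_(x in `[0, 2 * pi]) g x = c * \int[lebesgue_measure]_(x in `[0, 2 * pi]) G0 x.
  rewrite -RintegralZl//; last exact: integrable_D.
  rewrite -(periodic_integral c0 cG per).
  by apply: eq_Rintegral => x _; rewrite gE.
rewrite /mean_deriv [opP_iter _ _]/= /opP.
set r := rho ^+ (k ^ n.+1).
have rq : r = q ^+ k by rewrite /r /q expnSr exprM.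
have k0 : k%:R != 0 :> R by rewrite pnatr_eq0 -lt0n (leq_trans _ k2).
have rk : r `^ k%:R^-1 = q.
  by rewrite rq -powR_mulrn ?(ltW q0)// -powRrM mulfV// powRr1// ltW.
rewrite rk -/(opP_iter n).
have -> : \int[lebesgue_measure]_(x in `[0, 2 * pi]) (opP_iter n (cmod (phi (q%:C * expi x))) /
    cmod (phi (q%:C * expi x)) * cmod (dphi (q%:C * expi x)) `^ t / (2 * pi)) =
    (\int[lebesgue_measure]_(x in `[0, 2 * pi]) G0 x) / (2 * pi).
  rewrite -RintegralZr//; last exact: integrable_D.
move: (\int[_]_(_ in _) _) => I0.
have e : r `^ (t - 1) * r `^ (1 - k.-1%:R * t / k%:R) = q `^ t.
  rewrite -powRD; last by apply/implyP => _; rewrite rq gt_eqF// exprn_gt0.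
  rewrite rq -powR_mulrn ?(ltW q0)// -powRrM; congr (_ `^ _).
  rewrite -subn1 natrB ?(leq_trans _ k2)//; field; exact: k0.
rewrite /c -e; ring.
Qed.

End MeanDeriv.

Section Expectation.
Context {R : realType} {d : measure_display} {Omega : measurableType d}.
Variables (Pr : probability Omega R) (theta : nat -> {RV Pr >-> R}).
Hypothesis iid : iid_uniform_angles theta.
Variables (phi : R[i] -> R[i]) (k : nat) (t rad : R).
Hypothesis k2 : (2 <= k)%N.
Hypothesis sphi : Sigma' phi.
Hypothesis smphi : smooth_up_to_boundary phi.
Hypothesis rad1 : 1 < rad.
Hypothesis phi_ub : forall z : R[i], 1 < cmod z -> cmod (phi z) <= rad * cmod z.
Variables (tau : nat -> R) (Kb : nat -> R[i] -> R[i]).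
Hypothesis KbP : forall j, is_koebe_transform (k ^ j) (rotate phi (tau j)) (Kb j).
Local Notation Ph := (Phi k tau Kb).
Local Notation dPh := (dPhi phi k tau Kb).
Local Notation ds w n := (dsnow phi k tau Kb (fun j => theta j w) n).
Local Notation mean := (mean_deriv phi k t).

Let goodS := good_snow k2 sphi smphi rad1 phi_ub KbP.
Let goodP := good_Phi k2 sphi smphi rad1 phi_ub KbP.

(** The integral is localised to events that constrain only angles with index at least [n], on which
    the composition of [n] factors does not depend: this is the independence from the angle [n] used
    in the next step. *)
Definition mean_claim n := forall z : R[i], 1 < cmod z ->
  measurable_fun setT (fun w => cmod (ds w n z) `^ t) /\
  forall N A, (forall j, measurable (A j)) -> (forall j, (j < n)%N -> A j = setT) ->
    (\int[Pr]_(w in rv_event theta N A) (cmod (ds w n z) `^ t)%:E =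
     Pr (rv_event theta N A) * (mean n (cmod z))%:E)%E.

Lemma cmod_circ0 (rho x : R) : 0 <= rho -> cmod (circ 0 rho x) = rho.
Proof. by move=> r0; rewrite /circ add0r cmodM cmod_expi mulr1 cmodR ger0_norm. Qed.

Lemma mean_derivE n (z : R[i]) : mean_claim n -> 1 < cmod z ->
  (\int[Pr]_w (cmod (ds w n z) `^ t)%:E = (mean n (cmod z))%:E)%E.
Proof.
move=> cl z1; have [_ /(_ 0%N (fun=> setT))] := cl z z1.
have -> : rv_event theta 0 (fun=> setT) = setT by apply/seteqP; split => w // _ j.
by rewrite probability_setT mul1e; apply.
Qed.

Lemma mean_deriv_bounds n (z : R[i]) (c C : R) : mean_claim n -> 1 < cmod z ->
  (forall w, c <= cmod (ds w n z) `^ t <= C) -> c <= mean n (cmod z) <= C.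
Proof.
move=> cl z1 hC; have [mz _] := cl z z1.
have mE := mean_derivE cl z1.
have cst (x : R) : (\int[Pr]_w x%:E = x%:E)%E.
  rewrite integral_cst//.
  by transitivity (x%:E * 1)%E; [congr (_ * _)%E; exact: (probability_setT Pr)|exact: mule1].
have int x : Pr.-integrable setT (fun=> x%:E) by exact: finite_measure_integrable_cst.
rewrite -!lee_fin -mE -[c%:E]cst -[C%:E]cst.
have m : measurable_fun setT (fun w => (cmod (ds w n z) `^ t)%:E) by apply/measurable_EFinP.
have inth : Pr.-integrable setT (fun w => (cmod (ds w n z) `^ t)%:E).
  apply: (@le_integrable _ _ _ Pr setT measurableT _ (fun=> C%:E)) => // w _.
  have /andP[_ h] := hC w.
  by rewrite lee_fin ger0_norm ?powR_ge0//; apply: le_trans h (ler_norm _).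
by apply/andP; split; apply: le_integral => // w _; rewrite lee_fin; have /andP[] := hC w.
Qed.

(** Continuity is read off the expectation, by dominated convergence with the bounds uniform over
    [good]. *)
Lemma mean_deriv_cont n (rho : R) : mean_claim n -> 1 < rho ->
  mean n y @[y --> rho] --> mean n rho.
Proof.
move=> cl r1; pose a := (1 + rho) / 2; pose b := rho + 1.
have a1 : 1 < a by rewrite /a; lra.
have ar : a < rho by rewrite /a; lra.
have rb : rho < b by rewrite /b; lra.
have ab : a <= b by lra.
have B0 : 0 <= rad ^+ 2 by exact: exprn_ge0 (ltW (rad0 rad1)).
have [c [C [c0 C0 bnd]]] := good_powR_bounds t a1 ab B0.
apply/(@cvg_nbhsP _ R^o) => u ur.
(* The early terms of the sequence may leave the compact range on which the dominating bound holds;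
   they are replaced by [rho]. *)
pose v m := if a <= u m <= b then u m else rho.
have near : \forall m \near \oo, v m = u m.
  have h1 : \forall m \near \oo, a < u m by apply: cvgr_gt ur _ _.
  have h2 : \forall m \near \oo, u m < b by apply: cvgr_lt ur _ _.
  by apply: filterS2 h1 h2 => m h1 h2; rewrite /v (ltW h1) (ltW h2).
have vr : v m @[m --> \oo] --> rho.
  by apply: cvg_trans ur; apply: near_eq_cvg; apply: filterS near => m /= ->.
have vab m : a <= v m <= b by rewrite /v; case: ifP => // _; rewrite !ltW.
have v1 m : 1 < cmod (circ 0 (v m) 0 : R[i]).
  by have /andP[h _] := vab m; rewrite cmod_circ0; lra.
have r1' : 1 < cmod (circ 0 rho 0 : R[i]) by rewrite cmod_circ0; lra.
have cv : (\int[Pr]_w (cmod (ds w n (circ 0 (v m) 0)) `^ t)%:E @[m --> \oo] -->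
           \int[Pr]_w (cmod (ds w n (circ 0 rho 0)) `^ t)%:E)%E.
  apply: (prob_bounded_cvg (C := C) measurableT).
  - by move=> m; have [] := cl _ (v1 m).
  - by have [] := cl _ r1'.
  - move=> m w; rewrite powR_ge0/=.
    have vm : a <= cmod (circ 0 (v m) 0) <= b.
      by have := vab m => /andP[h1 h2]; rewrite cmod_circ0 ?h1 ?h2//; lra.
    by have /andP[] := bnd _ _ (goodS (fun j => theta j w) n) _ vm.
  - move=> w; have [uni _] := goodS (fun j => theta j w) n.
    have [_ cd] := (proj1 uni) _ r1'.
    apply: cvg_powR; first by rewrite cmod_gt0; exact: ext_deriv_neq0 uni r1'.
    apply: ctends_cmod; apply: (ctends_comp _ cd).
    by apply: ctends_circ => //; exact: cvg_cst.
rewrite mean_derivE// cmod_circ0 in cv; last by lra.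
have {}cv : (mean n (v m))%:E @[m --> \oo] --> (mean n rho)%:E.
  apply: cvg_trans cv; apply: near_eq_cvg; apply: nearW => m.
  by rewrite mean_derivE// cmod_circ0//; have /andP[h _] := vab m; lra.
move/fine_cvgP : cv => [_ cv].
apply: cvg_trans cv; apply: near_eq_cvg; apply: filterS near => m /= ->//.
Qed.

(** Starting the iteration from [id] is what makes [rho^(-t) rho^(t-1) rho] equal to 1, the mean for
    the identity map. *)
Lemma mean_claim0 : mean_claim 0.
Proof.
move=> z z1; have z0 : 0 < cmod z by lra.
have E w : cmod (ds w 0 z) `^ t = 1 by rewrite /= cmod1 powR1.
split=> [|N A mA _].
  by rewrite (_ : (fun w => _) = fun=> 1); [exact: measurable_cst|apply/funext].
under eq_integral do rewrite E.
rewrite integral_cst; last exact: measurable_rv_event.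
rewrite muleC; congr (_ * _%:E)%E.
rewrite /mean_deriv expn0 expr1 /opP_iter /=.
rewrite -powRD; last by apply/implyP => _; rewrite gt_eqF.
rewrite (_ : - t + (t - 1) = -1); last by ring.
by rewrite powR_inv1 ?(ltW z0)// mulVf// gt_eqF.
Qed.

(** With the innermost angle frozen at [x], the chain rule gives [J x], whose mean is [g x] by the
    induction hypothesis at the point [Phi n x z]. Then [integral_indep] restores the random angle
    and [mean_deriv_step] averages over it. *)
Lemma mean_claimS n : mean_claim n -> mean_claim n.+1.
Proof.
move=> cl z z1; set rho := cmod z.
have [a _] := circ_surj 0 z; rewrite subr0 -/rho => zE.
have r0 : 0 < rho by lra.
have P1 x : 1 < cmod (Ph n x z) by have [_ P1 _] := Phi_facts k2 sphi smphi KbP n x; exact: P1.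
have B0 : 0 <= rad ^+ 2 by exact: exprn_ge0 (ltW (rad0 rad1)).
have B1 : 1 <= rad ^+ 2 by rewrite exprn_ege1// ltW.
have rB : rho <= rad ^+ 2 * rho by rewrite ler_peMl// ltW.
have [c [C [c0 C0 bnd]]] := good_powR_bounds t z1 rB B0.
have Pab x : rho <= cmod (Ph n x z) <= rad ^+ 2 * rho by have [_ h] := goodP n x; exact: h.
have zab : rho <= cmod z <= rad ^+ 2 * rho by rewrite lexx.
pose J x w := cmod (ds w n (Ph n x z)) `^ t * cmod (dPh n x z) `^ t.
pose g x := mean n (cmod (Ph n x z)) * cmod (dPh n x z) `^ t.
have dsC w x : c <= cmod (ds w n (Ph n x z)) `^ t <= C by exact: bnd (goodS _ n) _ (Pab x).
have dPC x : c <= cmod (dPh n x z) `^ t <= C by exact: bnd (goodP n x) _ zab.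
have mJ x : measurable_fun setT (J x).
  by apply: measurable_funM; [have [] := cl _ (P1 x)|exact: measurable_cst].
have JC x w : 0 <= J x w <= C * C.
  have /andP[_ h1] := dsC w x; have /andP[_ h2] := dPC x.
  by rewrite /J mulr_ge0 ?powR_ge0//= ler_pM ?powR_ge0.
have cdP x : cmod (dPh n y z) `^ t @[y --> x] --> cmod (dPh n x z) `^ t.
  apply: cvg_powR; last by apply: ctends_cmod; exact: dPhi_cont_x.
  by have [uni _] := goodP n x; rewrite cmod_gt0; exact: ext_deriv_neq0 uni z1.
have cJ w (x : R) : J y w @[y --> x] --> J x w.
  apply: (@cvgRM _ _ (nbhs x)); last exact: cdP.
  have [uni _] := goodS (fun j => theta j w) n; have [_ cd] := (proj1 uni) _ (P1 x).
  apply: cvg_powR; first by rewrite cmod_gt0; exact: ext_deriv_neq0 uni (P1 x).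
  by apply: ctends_cmod; apply: (ctends_comp _ cd); exact: (Phi_cont_x KbP).
have gC x : 0 <= g x <= C * C.
  have /andP[_ h2] := dPC x.
  have /andP[_ h1] := mean_deriv_bounds cl (P1 x) (fun w => dsC w x).
  have h0 : 0 <= mean n (cmod (Ph n x z)) by apply: mean_deriv_ge0; exact: cmod_ge0.
  by rewrite /g mulr_ge0 ?powR_ge0//= ler_pM ?powR_ge0.
have cg : continuous g.
  move=> x; apply: (@cvgRM _ _ (nbhs x)); last exact: cdP.
  have cP : cmod (Ph n y z) @[y --> x] --> cmod (Ph n x z).
    by apply: ctends_cmod; exact: (Phi_cont_x KbP).
  exact: (cvg_comp _ _ cP (mean_deriv_cont cl (P1 x))).
have JE w : cmod (ds w n.+1 z) `^ t = J (theta n w) w.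
  by rewrite /J /= cmodM powRM ?cmod_ge0.
have -> : (fun w => cmod (ds w n.+1 z) `^ t) = fun w => J (theta n w) w by apply/funext => w; exact: JE.
split; first by apply: (@caratheodory_measurable _ _ _ J (theta n) setT).
move=> N A mA An; have [indX dX] := iid.
under eq_integral do rewrite JE.
have An' : A n = setT by exact: An.
rewrite (@integral_indep _ _ _ Pr J g (theta n) _ (C * C))//.
- rewrite (uniform_rv_integral (dX n) cg) => [|x]; last by have /andP[] := gC x.
  have r1 : 1 < rho by [].
  have := @mean_deriv_step R phi k t k2 sphi smphi tau Kb KbP n rho a r1.
  by rewrite -zE => /(_ cg) ->.
- exact: measurable_rv_event.
move=> x I mI; have [E1 E2] := rv_event_split N indX mA An' mI.
have [_ clx] := cl _ (P1 x); rewrite E1 -E2.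
set A' := fun j => _ in E1 E2 *; set M := maxn _ _ in E1 E2 *.
have mA' j : measurable (A' j) by rewrite /A'; case: ifP => // _; case: ifP.
have A'T j : (j < n)%N -> A' j = setT.
  move=> jn; rewrite /A' (ltn_eqF jn); case: ifP => // _.
  by apply: An; exact: ltnW.
under eq_integral do rewrite /J EFinM.
rewrite ge0_integralZr//.
- by rewrite clx// -muleA -EFinM.
- exact: measurable_rv_event.
- by apply: measurable_funTS; apply/measurable_EFinP; have [] := cl _ (P1 x).
- by move=> w _; rewrite lee_fin powR_ge0.
- by rewrite lee_fin powR_ge0.
Qed.

Lemma mean_claim_all n : mean_claim n.
Proof. by elim: n => [|n]; [exact: mean_claim0|exact: mean_claimS]. Qed.

End Expectation.

(** * Null sets and the moduli of holomorphic maps *)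

Section Expanding.
Context {R : realType}.
Local Notation mu := (@lebesgue_measure R).
Local Notation l := (@wlength R idfun).
Implicit Types (g : R -> R) (y c e : R).

(** A quantitative form of a nonzero derivative: near [y] the inverse of [g] is Lipschitz, which is
    what pulls null sets back to null sets. *)
Definition expanding_at g y := exists2 c : R, 0 < c & exists2 e : R, 0 < e &
  forall x x', `|x - y| < e -> `|x' - y| < e -> c * `|x - x'| <= `|g x - g x'|.

Lemma deriv_expanding g (dg : R -> R) y : (\forall x \near y, is_derive (x : R) 1 g (dg x)) ->
  dg x @[x --> y] --> dg y -> dg y != 0 -> expanding_at g y.
Proof.
move=> /nbhs_ballP[e1 /= e10 h1] /cvgrPdist_lt cdg dy0.
have c0 : 0 < `|dg y| / 2 by rewrite divr_gt0// normr_gt0.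
have /nbhs_ballP[e2 /= e20 h2] := cdg _ c0.
exists (`|dg y| / 2) => //; exists (Num.min e1 e2); first by rewrite lt_min e10.
move=> x x'; wlog xx' : x x' / x <= x'.
  move=> H; have [xx'|/ltW xx'] := leP x x'; first exact: H.
  by move=> h h'; rewrite distrC (distrC (g x)); exact: H.
rewrite !lt_min => /andP[x1 x2] /andP[x1' x2'].
have near s : x <= s <= x' -> `|s - y| < e1 /\ `|s - y| < e2.
  move: x1 x1' x2 x2'; rewrite !ltr_norml => /andP[? ?] /andP[? ?] /andP[? ?] /andP[? ?] /andP[? ?].
  by split; apply/andP; split; lra.
have ds s : x <= s <= x' -> is_derive s 1 g (dg s).
  by move=> /near[sy _]; apply: h1; rewrite /ball /= distrC.
have [||s sI E] := @MVT_segment _ g dg x x' xx'.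
- by move=> s; rewrite in_itv /= => /andP[/ltW ? /ltW ?]; apply: ds; apply/andP.
- apply/continuous_in_subspaceT => s; rewrite inE /= in_itv /= => sI.
  by apply: differentiable_continuous; apply/derivable1_diffP; case: (ds s sI).
rewrite (distrC (g x)) E normrM (distrC x) ler_wpM2r//.
move: sI; rewrite in_itv /= => /near[_ sy].
have := h2 s; rewrite /ball /= distrC => /(_ sy) hs.
have := ler_distD (dg s) 0 (dg y); rewrite !sub0r !normrN => h3.
by move: hs; rewrite distrC => hs; lra.
Qed.

(** A cover of [N] by open intervals of total length at most [c e / 2] pulls back to sets of
    diameter at most length over [c]. Each lies in an interval around one of its points of twice
    that length, which adds up to [e]. *)
Lemma expanding_itv_negligible g (p q c : R) (N : set R) : 0 < c ->
  (forall x x', p < x < q -> p < x' < q -> c * `|x - x'| <= `|g x - g x'|) ->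
  mu.-negligible N -> mu.-negligible [set y | p < y < q /\ N (g y)].
Proof.
move=> c0 ex /negligible_outer_measure N0; apply/negligible_outer_measure.
apply/eqP; rewrite eq_le outer_measure_ge0 andbT.
apply/lee_addgt0Pr => e e0; rewrite add0e.
have [F [Fo NF] Fe] : exists2 F, open_itv_cover N F & (\sum_(0 <= i <oo) l (F i) <= (c * e / 2)%:E)%E.
  have ce : 0 < c * e / 2 by rewrite divr_gt0// mulr_gt0.
  have fin : (l^* N)%mu \is a fin_num by rewrite N0.
  move: (N0); rewrite outer_measure_open_itv_cover => N0'.
  rewrite outer_measure_open_itv_cover in fin.
  have [_ [F FN <-]] := lb_ereal_inf_adherent ce fin.
  by rewrite N0' add0e => /ltW h; exists F.
pose E i := [set y | p < y < q /\ F i (g y)].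
have lE i : ((l^* (E i))%mu <= (2 / c)%:E * l (F i))%E.
  have [[a b] Fi] := Fo i.
  have [->|/set0P[y0 [y0pq y0F]]] := eqVneq (E i) set0.
    by rewrite outer_measure0 mule_ge0// ?lee_fin ?divr_ge0// ?(ltW c0)// Fi wlength_ge0.
  move: (y0F); rewrite Fi /= in_itv /= => /andP[ay yb].
  have ab : a < b by exact: lt_trans yb.
  have dE y : E i y -> `|y - y0| <= (b - a) / c.
    move=> [ypq]; rewrite Fi /= in_itv /= => /andP[h1 h2].
    rewrite ler_pdivlMr// mulrC; apply: le_trans (ex _ _ ypq y0pq) _.
    by rewrite ler_norml; apply/andP; split; lra.
  have sub : E i `<=` `[y0 - (b - a) / c, y0 + (b - a) / c]%classic.
    by move=> y /dE; rewrite /= in_itv /= ler_norml => /andP[h1 h2]; apply/andP; split; lra.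
  apply: (@le_trans _ _ (mu `[(y0 - (b - a) / c), (y0 + (b - a) / c)])).
    have h : ((l^* (E i))%mu <= (l^* `[(y0 - (b - a) / c)%R, (y0 + (b - a) / c)%R])%mu)%E.
      by apply: le_outer_measure.
    exact: h.
  have d0 : 0 < (b - a) / c by rewrite divr_gt0// subr_gt0.
  rewrite lebesgue_measure_itv /= lte_fin ifT; last by lra.
  rewrite wlength_itv /= lte_fin ab -!EFinB -EFinM lee_fin.
  by rewrite le_eqVlt; apply/orP; left; apply/eqP; field; rewrite gt_eqF.
have subE : [set y | p < y < q /\ N (g y)] `<=` \bigcup_i E i.
  by move=> y [ypq /NF[i _ Fi]]; exists i.
apply: (@le_trans _ _ ((l^* (\bigcup_i E i))%mu)); first by apply: le_outer_measure.
apply: (@le_trans _ _ (\sum_(0 <= i <oo) (l^* (E i))%mu)%E).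
  exact: outer_measure_sigma_subadditive.
apply: (@le_trans _ _ (\sum_(0 <= i <oo) (2 / c)%:E * l (F i))%E).
  by apply: lee_nneseries => i *; [exact: outer_measure_ge0|exact: lE].
rewrite nneseriesZl; last by move=> i _; have [[a b] ->] := Fo i; exact: wlength_ge0.
apply: (@le_trans _ _ ((2 / c)%:E * (c * e / 2)%:E)%E).
  by apply: lee_wpmul2l Fe; rewrite lee_fin divr_ge0// ltW.
rewrite -EFinM lee_fin (_ : 2 / c * (c * e / 2) = e)//.
by field; rewrite gt_eqF.
Qed.

(** The constant and the radius vary with the point, but each point lies in one of countably many
    rational intervals on which a single constant works. *)
Lemma expanding_negligible g (S N : set R) : (forall y, S y -> expanding_at g y) ->
  mu.-negligible N -> mu.-negligible (S `&` g @^-1` N).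
Proof.
move=> exS N0.
pose ex (pq : rat * rat) := exists2 c : R, 0 < c & forall x x', ratr pq.1 < x < ratr pq.2 ->
  ratr pq.1 < x' < ratr pq.2 -> c * `|x - x'| <= `|g x - g x'|.
pose G n : set R := if @unpickle (rat * rat)%type n is Some pq then
  if `[< ex pq >] then [set y | ratr pq.1 < y < ratr pq.2 /\ N (g y)] else set0 else set0.
have G0 n : mu.-negligible (G n).
  rewrite /G; case: unpickle => [pq|]; last exact: negligible_set0.
  case: ifPn => [/asboolP[c c0 h]|_]; last exact: negligible_set0.
  exact: expanding_itv_negligible c0 h N0.
apply: negligibleS (negligible_bigcup G0) => y [Sy Ny].
have [c c0 [e e0 h]] := exS y Sy.
have [p pI] := @rat_in_itvoo R (y - e) y ltac:(lra).
have [q qI] := @rat_in_itvoo R y (y + e) ltac:(lra).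
move: pI qI; rewrite !in_itv /= => /andP[p1 p2] /andP[q1 q2].
exists (pickle (p, q)); first exact: I.
rewrite /G pickleK; case: ifPn => [_|/asboolP[]].
  by split => //; apply/andP.
exists c => // x x' /= /andP[x1 x2] /andP[x1' x2'].
by apply: h; rewrite ltr_norml; apply/andP; split; lra.
Qed.

End Expanding.

Section NullSections.
Context {R : realType}.
Local Notation mu := (@lebesgue_measure R).

Let T2 := (measurableTypeR R * measurableTypeR R)%type.

Lemma caratheodory_measurable2 (h : R -> R -> R) (a b : R) :
  (forall r x, a < r < b -> h y x @[y --> r] --> h r x) ->
  (forall r, a < r < b -> continuous (h r)) ->
  measurable_fun (`]a, b[%classic `*` setT : set T2) (fun w : T2 => h w.1 w.2).
Proof.
move=> ch1 ch2; pose D : set T2 := `]a, b[%classic `*` setT.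
(* Extended by 0, since [caratheodory_measurable] wants measurability for every frozen first
   coordinate. *)
pose J y (w : T2) := if a < y < b then h y w.2 else 0.
have mD : measurable D by apply: measurableX => //; exact: measurable_itv.
have H : measurable_fun D (fun w => J w.1 w).
  apply: (@caratheodory_measurable _ _ T2 J (fun w : T2 => w.1) D mD).
  - by apply: measurable_funTS; exact: measurable_fst.
  - move=> y; rewrite /J; have := @ch2 y; case: (a < y < b) => [/(_ isT) cy|_]; last exact: measurable_cst.
    apply: measurable_funTS; apply: (measurableT_comp _ measurable_snd).
    by exact: continuous_measurable_fun cy.
  - move=> [r x] [rab' _]; have rab : a < r < b by move: rab'; rewrite /= in_itv.
    rewrite /J /= rab.
    apply: cvg_trans (ch1 r x rab); apply: near_eq_cvg.
    have rin : r \in `]a, b[ by rewrite in_itv.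
    have := near_in_itvoo rin; move=> nr.
    near=> s; have : s \in `]a, b[ by near: s.
    by rewrite in_itv /= => ->.
apply: eq_measurable_fun H => -[r x]; rewrite inE => -[/= rab _].
by rewrite /J /=; move: rab; rewrite in_itv /= => ->.
Unshelve. all: by end_near. Qed.

(** Pairs with [hr <> 0] have null sections in [r] for every [x], so by Fubini-Tonelli null sections
    in [x] for almost every [r]. Pairs with [hr = 0] have null sections in [x] for every [r], since
    there [h r] is expanding. *)
Lemma null_sections (h hr : R -> R -> R) (a b : R) (N : set R) :
  (forall r x, a < r < b -> h y x @[y --> r] --> h r x) ->
  (forall r, a < r < b -> continuous (h r)) ->
  (forall r x, a < r < b -> hr y x @[y --> r] --> hr r x) ->
  (forall r, a < r < b -> continuous (hr r)) ->
  (forall r x, a < r < b -> hr r x != 0 -> expanding_at (h ^~ x) r) ->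
  (forall r x, a < r < b -> hr r x = 0 -> expanding_at (h r) x) ->
  mu.-negligible N ->
  {ae mu, forall r, a < r < b -> mu.-negligible [set x | N (h r x)]}.
Proof.
(* The measurable hull [N'] makes the set [S] of pairs measurable, as Fubini-Tonelli demands. *)
move=> h1 h2 hr1 hr2 exr exx [N' [mN' N'0 NN']].
have N'n : mu.-negligible N' by exists N'; split.
pose D : set T2 := `]a, b[%classic `*` setT.
have mD : measurable D by apply: measurableX => //; exact: measurable_itv.
pose S : set T2 := D `&` (fun w => h w.1 w.2) @^-1` N' `&` (D `&` (fun w => hr w.1 w.2) @^-1` [set~ 0]).
have mS : measurable S.
  apply: measurableI; first by apply: (caratheodory_measurable2 h1 h2).
  apply: (caratheodory_measurable2 hr1 hr2) => //; apply: measurableC; exact: measurable_set1.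
have secr x : mu (ysection S x) = 0%E.
  apply: (@measure_negligible _ _ _ mu); first exact: measurable_ysection.
  have neg : mu.-negligible ([set r | a < r < b /\ hr r x != 0] `&` (h ^~ x) @^-1` N').
    by apply: expanding_negligible N'n => r [rab hr0]; exact: exr.
  apply: negligibleS neg.
  move=> r /ysectionP [[[/= rab _] hN] [_ hr0]].
  by split=> //; split; [move: rab; rewrite in_itv|apply/eqP].
have key := @indic_fubini_tonelli _ _ _ _ R mu mu S mS.
rewrite indic_fubini_tonelli_FE// indic_fubini_tonelli_GE// in key.
have sec0 : {ae mu, forall r, mu (xsection S r) = 0%E}.
  have m : measurable_fun setT (mu \o xsection S) by exact: measurable_fun_xsection.
  have /(ae_eq_integral_abs mu measurableT m) h0 : (\int[mu]_r `|(mu \o xsection S) r| = 0)%E.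
    under eq_integral do rewrite gee0_abs//.
    by rewrite key; apply: integral0_eq => x _; exact: secr.
  by apply: filterS h0 => r; apply.
apply: filterS sec0 => r S0 rab.
have n1 : mu.-negligible (xsection S r).
  by exists (xsection S r); split => //; exact: measurable_xsection.
have n2 : mu.-negligible ([set x | hr r x = 0] `&` h r @^-1` N').
  by apply: expanding_negligible => // x; exact: exx.
apply: negligibleS (negligibleU n1 n2) => x /= /NN' Nx.
have [hr0|hr0] := eqVneq (hr r x) 0; [by right|left].
have Drx : D (r, x) by split => //; rewrite /= in_itv.
by apply/xsectionP; split; split => //; exact/eqP.
Qed.

End NullSections.

Section ExpandingModulus.
Context {R : realType}.

Lemma expanding_sqr (g : R -> R) (y : R) : (forall x, 0 <= g x) -> g x @[x --> y] --> g y ->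
  expanding_at (fun x => g x ^+ 2) y -> expanding_at g y.
Proof.
move=> g0 gc [c c0 [e e0 H]].
have g1 : g y < g y + 1 by lra.
have /nbhs_ballP[e1 /= e10 h1] : \forall x \near y, g x < g y + 1 by apply: cvgr_lt gc _ _.
have M0 : 0 < 2 * (g y + 1) by have := g0 y; lra.
exists (c / (2 * (g y + 1))); first by rewrite divr_gt0.
exists (Num.min e e1); first by rewrite lt_min e0.
move=> x x'; rewrite !lt_min => /andP[x1 x2] /andP[x1' x2'].
have gx : g x < g y + 1 by apply: h1; rewrite /ball /= distrC.
have gx' : g x' < g y + 1 by apply: h1; rewrite /ball /= distrC.
have := H _ _ x1 x1'; rewrite subr_sqr normrM [`|g x + g x'|]ger0_norm ?addr_ge0// => h.
rewrite mulrAC ler_pdivrMr//; apply: le_trans h _.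
by rewrite ler_wpM2l//; lra.
Qed.

Lemma expanding_comp (g s : R -> R) (y : R) : s x @[x --> y] --> s y ->
  expanding_at s y -> expanding_at g (s y) -> expanding_at (fun x => g (s x)) y.
Proof.
move=> sc [c c0 [e e0 H]] [c' c'0 [e' e'0 H']].
have /nbhs_ballP[e1 /= e10 h1] : \forall x \near y, `|s x - s y| < e'.
  by move/cvgrPdist_lt : sc => /(_ _ e'0); apply: filterS => x; rewrite distrC.
exists (c' * c); first exact: mulr_gt0.
exists (Num.min e e1); first by rewrite lt_min e0.
move=> x x'; rewrite !lt_min => /andP[x1 x2] /andP[x1' x2'].
have sx : `|s x - s y| < e' by apply: h1; rewrite /ball /= distrC.
have sx' : `|s x' - s y| < e' by apply: h1; rewrite /ball /= distrC.
apply: le_trans (H' _ _ sx sx'); rewrite -mulrA ler_wpM2l ?(ltW c'0)//.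
exact: H.
Qed.

Lemma powR_expanding (p r : R) : p != 0 -> 0 < r -> expanding_at (fun x => x `^ p) r.
Proof.
move=> p0 r0; apply: (@deriv_expanding _ _ (fun x => p * x `^ (p - 1))).
- have idr : (x : R) @[x --> r] --> r by exact: cvg_id.
  have : \forall x \near r, 0 < x by apply: cvgr_gt idr _ _.
  by apply: filterS => x x0; exact: is_derive1_powR.
- by apply: (@cvgRM _ _ (nbhs r)); [exact: cvg_cst|apply: cvg_powR].
- by rewrite mulf_neq0// gt_eqF// powR_gt0.
Qed.

Variables F dF : R[i] -> R[i].
Hypothesis FP : forall z : R[i], 1 < cmod z -> cderiv F z (dF z) /\ ccont dF z.
Hypothesis F0 : forall z : R[i], 1 < cmod z -> F z != 0 /\ dF z != 0.

Let H (s x : R) := cmod (F (circ 0 s x)).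
(* The radial and the angular derivative of [|F|^2 / 2] (up to a factor [- s]). *)
Definition rad_deriv (s x : R) : R := let u := circ 0 s x in
  complex.Re (F u) * complex.Re (dF u * expi x) + complex.Im (F u) * complex.Im (dF u * expi x).
Definition ang_deriv (s x : R) : R := let u := circ 0 s x in
  complex.Re (F u) * complex.Im (dF u * expi x) - complex.Im (F u) * complex.Re (dF u * expi x).

Lemma cmod_circ01 (s x : R) : 1 < s -> 1 < cmod (circ 0 s x : R[i]).
Proof. by move=> s1; rewrite /circ add0r cmodM cmod_expi mulr1 cmodR gtr0_norm//; lra. Qed.

(** The two squares add up to [|F|^2 |F'|^2], so the modulus has no critical point. *)
Lemma rad_ang_deriv (s x : R) : 1 < s -> rad_deriv s x = 0 -> ang_deriv s x != 0.
Proof.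
move=> s1 r0; apply/eqP => a0.
have [f0 d0] := F0 (cmod_circ01 x s1).
have : (cmod (F (circ 0 s x)) * cmod (dF (circ 0 s x) * expi x)) ^+ 2 =
       rad_deriv s x ^+ 2 + ang_deriv s x ^+ 2.
  by rewrite exprMn !cmod_sqr /rad_deriv /ang_deriv; ring.
rewrite r0 a0 expr0n /= addr0 cmodM cmod_expi mulr1 => /eqP.
by rewrite sqrf_eq0 mulf_eq0 !cmod_eq0 (negbTE f0) (negbTE d0).
Qed.

(** Multiplication by [-i] exchanges real and imaginary parts up to sign, so the rules for [Re]
    along rays and [Im] along circles also yield the two remaining derivatives. *)
Let mi : R[i] := 0 +i* (-1).

Let Re_mi z : complex.Re (mi * z) = complex.Im z.
Proof. by rewrite ReM /=; ring. Qed.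
Let Im_mi z : complex.Im (mi * z) = - complex.Re z.
Proof. by rewrite ImM /=; ring. Qed.

Let miF z : 1 < cmod z -> cderiv (fun w => mi * F w) z (mi * dF z).
Proof.
move=> z1; have [dz _] := FP z1.
have := cderivM (cderiv_cst mi z) dz; by rewrite mul0r add0r.
Qed.

Lemma sqr_modulus_derive_s (s x : R) : 1 < s ->
  is_derive s 1 (fun y => H y x ^+ 2) (2 * rad_deriv s x).
Proof.
move=> s1; have z1 := cmod_circ01 x s1; have [dz _] := FP z1.
have d1 := circ_derive_s dz; have d2 := circ_derive_s (miF z1).
rewrite (_ : (fun y => _) = fun y => complex.Re (F (circ 0 y x)) ^+ 2 + complex.Re (mi * F (circ 0 y x)) ^+ 2); last first.
  by apply/funext => y; rewrite /H cmod_sqr Re_mi.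
apply: is_derive_eq; rewrite -mulrA !Re_mi /rad_deriv /GRing.scale /=; ring.
Qed.

Lemma sqr_modulus_derive_x (s x : R) : 1 < s ->
  is_derive x 1 (fun y => H s y ^+ 2) (- 2 * s * ang_deriv s x).
Proof.
move=> s1; have z1 := cmod_circ01 x s1; have [dz _] := FP z1.
have d1 := circ_derive_x dz; have d2 := circ_derive_x (miF z1).
rewrite -[mi * _ * _]mulrA Re_mi in d2.
rewrite (_ : (fun y => _) = fun y => complex.Im (F (circ 0 s y)) ^+ 2 + complex.Im (mi * F (circ 0 s y)) ^+ 2); last first.
  by apply/funext => y; rewrite /H cmod_sqr Im_mi sqrrN addrC.
apply: is_derive_eq; rewrite !Im_mi /ang_deriv /GRing.scale /=; ring.
Qed.

Let circ_cvg {T : Type} (Fil : set_system T) {FF : Filter Fil} (f g : T -> R) (a b : R) : 1 < a ->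
  f @ Fil --> a -> g @ Fil --> b ->
  ctends Fil (fun y => F (circ 0 (f y) (g y))) (F (circ 0 a b)) /\
  ctends Fil (fun y => dF (circ 0 (f y) (g y)) * expi (g y)) (dF (circ 0 a b) * expi b).
Proof.
move=> a1 fa gb; have [dz cz] := FP (cmod_circ01 b a1).
have c : ctends Fil (fun y => circ 0 (f y) (g y)) (circ 0 a b) by exact: ctends_circ.
split; first exact: (ctends_comp c (cderiv_cont dz)).
by apply: ctendsM; [exact: (ctends_comp c cz)|exact: ctends_expi].
Qed.

Lemma modulus_cvg {T : Type} (Fil : set_system T) {FF : Filter Fil} (f g : T -> R) (a b : R) : 1 < a ->
  f @ Fil --> a -> g @ Fil --> b -> H (f y) (g y) @[y --> Fil] --> H a b.
Proof. by move=> a1 fa gb; have [c _] := circ_cvg a1 fa gb; exact: ctends_cmod. Qed.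

Lemma rad_deriv_cvg {T : Type} (Fil : set_system T) {FF : Filter Fil} (f g : T -> R) (a b : R) : 1 < a ->
  f @ Fil --> a -> g @ Fil --> b -> rad_deriv (f y) (g y) @[y --> Fil] --> rad_deriv a b.
Proof.
move=> a1 fa gb; have [c1 c2] := circ_cvg a1 fa gb.
by apply: cvgRD; apply: cvgRM; first [exact: ctends_Re|exact: ctends_Im].
Qed.

Lemma ang_deriv_cvg {T : Type} (Fil : set_system T) {FF : Filter Fil} (f g : T -> R) (a b : R) : 1 < a ->
  f @ Fil --> a -> g @ Fil --> b -> ang_deriv (f y) (g y) @[y --> Fil] --> ang_deriv a b.
Proof.
move=> a1 fa gb; have [c1 c2] := circ_cvg a1 fa gb.
by apply: cvgRB; apply: cvgRM; first [exact: ctends_Re|exact: ctends_Im].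
Qed.

Lemma modulus_expanding_s (s x : R) : 1 < s -> rad_deriv s x != 0 -> expanding_at (H ^~ x) s.
Proof.
move=> s1 d0; have ids : (y : R) @[y --> s] --> s by exact: cvg_id.
have cx : x @[y --> s] --> x by exact: cvg_cst.
apply: expanding_sqr; first by move=> y; exact: cmod_ge0.
  exact: (@modulus_cvg _ (nbhs s)).
apply: (@deriv_expanding _ _ (fun y => 2 * rad_deriv y x)).
- have : \forall y \near s, 1 < y by apply: cvgr_gt ids _ _.
  by apply: filterS => y; exact: sqr_modulus_derive_s.
- by apply: (@cvgRM _ _ (nbhs s)); [exact: cvg_cst|exact: (@rad_deriv_cvg _ (nbhs s))].
- by rewrite mulf_neq0.
Qed.

Lemma modulus_expanding_x (s x : R) : 1 < s -> ang_deriv s x != 0 -> expanding_at (H s) x.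
Proof.
move=> s1 d0; have idx : (y : R) @[y --> x] --> x by exact: cvg_id.
have cs : s @[y --> x] --> s by exact: cvg_cst.
apply: expanding_sqr; first by move=> y; exact: cmod_ge0.
  exact: (@modulus_cvg _ (nbhs x)).
apply: (@deriv_expanding _ _ (fun y => - 2 * s * ang_deriv s y)).
- by apply: (@nearW _ (nbhs x)) => y; exact: sqr_modulus_derive_x.
- by apply: (@cvgRM _ _ (nbhs x)); [exact: cvg_cst|exact: (@ang_deriv_cvg _ (nbhs x))].
- by rewrite !mulf_neq0// ?oppr_eq0// gt_eqF//; lra.
Qed.

Lemma modulus_null_preimage (p b : R) (N : set R) : 0 < p ->
  (@lebesgue_measure R).-negligible N ->
  {ae lebesgue_measure, forall r : R, 1 < r < b ->
    (@lebesgue_measure R).-negligible [set x | N (H (r `^ p) x)]}.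
Proof.
move=> p0 N0.
have s1 r : 1 < r < b -> 1 < r `^ p.
  move=> /andP[r1 _]; have e1 : 1 `^ p = 1 :> R by rewrite powR1.
  by rewrite -[ltLHS]e1; apply: gt0_ltr_powR; rewrite ?nnegrE//; lra.
have cr r x : 1 < r < b -> (y `^ p @[y --> r] --> r `^ p) /\ (x @[y --> r] --> (x : R)).
  move=> /andP[r1 _]; split; last exact: cvg_cst.
  by apply: cvg_powR; [lra|exact: cvg_id].
apply: (@null_sections R (fun r x => H (r `^ p) x) (fun r x => rad_deriv (r `^ p) x)) => //.
- by move=> r x rb; have [c1 c2] := cr r x rb; apply: (@modulus_cvg _ (nbhs r)) => //; exact: s1.
- by move=> r rb x; apply: (@modulus_cvg _ (nbhs x)); [exact: s1|exact: cvg_cst|exact: cvg_id].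
- by move=> r x rb; have [c1 c2] := cr r x rb; apply: (@rad_deriv_cvg _ (nbhs r)) => //; exact: s1.
- by move=> r rb x; apply: (@rad_deriv_cvg _ (nbhs x)); [exact: s1|exact: cvg_cst|exact: cvg_id].
- move=> r x rb d0; have [c1 _] := cr r x rb; apply: (expanding_comp (g := H ^~ x) c1).
    by apply: powR_expanding; [rewrite gt_eqF|case/andP: rb; lra].
  by apply: modulus_expanding_s => //; exact: s1.
- move=> r x rb d0; apply: modulus_expanding_x; first exact: s1.
  by apply: rad_ang_deriv => //; exact: s1.
Qed.

End ExpandingModulus.

(** * Lower bounds *)

Section EigenBound.
Context {R : realType}.
Local Notation mu := (@lebesgue_measure R).
Variables (phi : R[i] -> R[i]) (k : nat) (t rad : R).
Hypothesis k2 : (2 <= k)%N.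
Hypothesis sphi : Sigma' phi.
Hypothesis smphi : smooth_up_to_boundary phi.
Hypothesis phi_small : forall u : R[i], 1 < cmod u -> cmod u ^+ k < rad -> 1 < cmod (phi u) < rad.
Local Notation dphi := (phi^`()%classic).
Local Notation U := (opP_iter phi k t).
Hypothesis cU : forall n (r : R), 1 < r -> U n y @[y --> r] --> U n r.

Let FP := (phi_uni sphi smphi).1.

Let F0 (z : R[i]) : 1 < cmod z -> phi z != 0 /\ dphi z != 0.
Proof.
move=> z1; split; last exact: ext_deriv_neq0 (phi_uni sphi smphi) z1.
by rewrite -cmod_gt0; have := phi_lb sphi smphi z1; lra.
Qed.

Lemma circ0E (s x : R) : circ 0 s x = s%:C * expi x.
Proof. by rewrite /circ add0r. Qed.

(** The base case is [|nu r| <= M <= M r], as [r > 1]. In the step [phi_small] keeps the arguments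
    of [nu] in [(1, rad)], and those that fall into the null set [N] of the previous step come from
    a null set of angles. *)
Lemma eigen_bound (nu : R -> R) (lam M : R) : 0 < lam -> measurable_fun `[1, rad] nu ->
  (forall r, r \in `[1, rad] -> `|nu r| <= M) ->
  {ae mu, forall r : R, r \in `[1, rad] -> opP phi k t nu r = lam * nu r} ->
  forall n, {ae mu, forall r : R, 1 < r < rad -> lam ^+ n * `|nu r| <= M * U n r}.
Proof.
move=> lam0 mnu nuM eig; elim=> [|n IHn].
  apply: (@aeW _ _ _ mu) => r /andP[r1 r2].
  have h : `|nu r| <= M by apply: nuM; rewrite in_itv /= !ltW.
  have M0 : 0 <= M by apply: le_trans h.
  rewrite expr0 mul1r /opP_iter /=; apply: le_trans h _.
  by rewrite ler_peMr ?(ltW r1).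
have kr : 0 < k%:R^-1 :> R by rewrite invr_gt0 ltr0n (leq_trans _ k2).
pose N := [set s : R | ~ (1 < s < rad -> lam ^+ n * `|nu s| <= M * U n s)].
have N0 : mu.-negligible N by exact: IHn.
have null := modulus_null_preimage FP F0 rad kr N0.
have both := @filterI _ _ (ae_filter_ringOfSetsType mu) _ _ eig null.
apply: (@filterS _ _ (ae_filter_ringOfSetsType mu) _ _ _ both) => r [eigr nullr] r1rad.
have /andP[r1 r2] := r1rad; have r0 : 0 < r by lra.
have rI : r \in `[1, rad] by rewrite in_itv /= !ltW.
have M0 : 0 <= M by apply: le_trans (nuM r rI).
pose s := r `^ k%:R^-1.
have sk : s ^+ k = r.
  rewrite -powR_mulrn ?powR_ge0// -powRrM mulVf ?powRr1 ?(ltW r0)//.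
  by rewrite pnatr_eq0 -lt0n (leq_trans _ k2).
have s1 : 1 < s.
  have e1 : 1 `^ k%:R^-1 = 1 :> R by rewrite powR1.
  by rewrite /s -[ltLHS]e1; apply: gt0_ltr_powR; rewrite ?nnegrE//; lra.
pose p x := cmod (phi (circ 0 s x)); pose D x := cmod (dphi (circ 0 s x)).
have z1 x : 1 < cmod (circ 0 s x : R[i]) by exact: cmod_circ01.
have pI x : 1 < p x < rad.
  by apply: phi_small => //; rewrite cmod_circ0 ?sk//; lra.
have D0 x : 0 < D x by rewrite cmod_gt0; have [] := F0 (z1 x).
have cp : continuous p.
  by move=> x; apply: (@modulus_cvg _ _ _ FP _ (nbhs x) _ (fun=> s) id) => //; exact: cvg_cst.
have cD : continuous D.
  move=> x; apply: ctends_cmod; apply: circ_continuous => y.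
  by have [] := FP (z1 y).
pose w x := (p x)^-1 * D x `^ t / (2 * pi).
have w0 x : 0 <= w x.
  by rewrite /w !mulr_ge0 ?invr_ge0 ?powR_ge0 ?cmod_ge0// mulr_ge0// pi_ge0.
have cw : continuous w.
  move=> x; apply: (@cvgRM _ _ (nbhs x)); last exact: cvg_cst.
  apply: (@cvgRM _ _ (nbhs x)); last by apply: cvg_powR => //; exact: cD.
  apply: (@cvgRV _ _ (nbhs x)); last exact: cp.
  by rewrite gt_eqF//; have /andP[h _] := pI x; lra.
have cUp : continuous (fun x => U n (p x) * w x).
  move=> x; apply: (@cvgRM _ _ (nbhs x)); last exact: cw.
  by have /andP[h _] := pI x; exact: (cvg_comp _ _ (cp x) (cU h)).
have opPE (v : R -> R) : opP phi k t v r =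
    r `^ (1 - k.-1%:R * t / k%:R) * \int[mu]_(x in `[0, 2 * pi]) (v (p x) * w x).
  rewrite /opP -/s; congr (_ * _); apply: eq_Rintegral => x _.
  by rewrite -circ0E /w /p /D; ring.
have mDD : measurable (`[0, 2 * pi]%classic : set R) by exact: measurable_itv.
have mp : measurable_fun `[0, 2 * pi] p by apply: measurable_funTS; exact: continuous_measurable_fun.
have mw : measurable_fun `[0, 2 * pi] w by apply: measurable_funTS; exact: continuous_measurable_fun.
have mf : measurable_fun `[0, 2 * pi] (fun x => nu (p x) * w x).
  apply: measurable_funM => //; apply: (@measurable_comp _ _ _ _ _ _ `[1, rad]%classic) => //.
  by move=> _ [x _ <-] /=; have /andP[/ltW h1 /ltW h2] := pI x; rewrite in_itv /= h1.
have intU : mu.-integrable `[0, 2 * pi] (EFin \o (fun x => U n (p x) * w x)) by exact: integrable_D.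
have ln0 : 0 < lam ^+ n by exact: exprn_gt0.
have ptw : {ae mu, forall x, `[0, 2 * pi]%classic x ->
    (`|(nu (p x) * w x)%:E| <= ((M / lam ^+ n) * (U n (p x) * w x))%:E)%E}.
  apply: (@filterS _ _ (ae_filter_ringOfSetsType mu) _ _ _ (nullr r1rad)) => x /= xN _.
  rewrite lee_fin normrM (ger0_norm (w0 x)) mulrA ler_wpM2r//.
  have h : lam ^+ n * `|nu (p x)| <= M * U n (p x).
    exact: (xN (pI x)).
  by rewrite mulrAC ler_pdivlMr// mulrC.
have U0 x : 0 <= U n (p x) by apply: opP_iter_ge0; exact: cmod_ge0.
have le1 : `|\int[mu]_(x in `[0, 2 * pi]) (nu (p x) * w x)| <=
    M / lam ^+ n * \int[mu]_(x in `[0, 2 * pi]) (U n (p x) * w x).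
  rewrite -RintegralZl//.
  have intU' : mu.-integrable `[0, 2 * pi] (EFin \o (fun x => M / lam ^+ n * (U n (p x) * w x))).
    by apply: integrable_D => x; apply: (@cvgRM _ _ (nbhs x)); [exact: cvg_cst|exact: cUp].
  have h : (`|\int[mu]_(x in `[0%R, (2 * pi)%R]) (nu (p x) * w x)%:E| <=
      \int[mu]_(x in `[0%R, (2 * pi)%R]) (M / lam ^+ n * (U n (p x) * w x))%:E)%E.
    apply: le_trans (le_abse_integral mu mDD _) _; first exact/measurable_EFinP.
    apply: ae_ge0_le_integral => //.
    - by apply: measurableT_comp => //; exact/measurable_EFinP.
    - by move=> x _; rewrite lee_fin; apply: mulr_ge0; [exact: divr_ge0 M0 (ltW ln0)|exact: mulr_ge0].
    - by case/integrableP : intU'.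
  rewrite /Rintegral -lee_fin [X in (_ <= X)%E]fineK; last exact: integrable_fin_num.
  apply: le_trans h.
  (* [fine] sends infinite values to 0, so the bound survives in each case. *)
  by case: (\int[mu]_(x in _) _)%E => [a||] //=; rewrite ?normr0 ?leey.
rewrite -(ler_pM2l ln0).
have -> : lam ^+ n * (lam ^+ n.+1 * `|nu r|) = lam ^+ n * (lam ^+ n * `|opP phi k t nu r|).
  by rewrite eigr// normrM (gtr0_norm lam0) exprSr; ring.
rewrite [U n.+1 r]/= -/(opP_iter phi k t n) !opPE normrM [`|_ `^ _|]ger0_norm ?powR_ge0//.
move: le1; set I1 := `|_|; set I2 := \int[mu]_(_ in _) _; set c := r `^ _ => le1.
have c0 : 0 <= c by exact: powR_ge0.
have h : lam ^+ n * I1 <= M * I2.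
  by move: le1; rewrite mulrAC ler_pdivlMr// mulrC.
rewrite ler_pM2l// (_ : lam ^+ n * (c * I1) = c * (lam ^+ n * I1)); last by ring.
by rewrite (_ : M * (c * I2) = c * (M * I2)); [exact: ler_wpM2l|ring].
Qed.

End EigenBound.

Section Roots.
Context {R : realType}.

Lemma root_exp (K : nat) (r : R) : (0 < K)%N -> 0 < r -> (r `^ K%:R^-1) ^+ K = r.
Proof.
move=> K0 r0; rewrite -powR_mulrn ?powR_ge0// -powRrM mulVf ?powRr1 ?(ltW r0)//.
by rewrite pnatr_eq0 -lt0n.
Qed.

Lemma root_gt1 (K : nat) (r : R) : (0 < K)%N -> 1 < r -> 1 < r `^ K%:R^-1.
Proof.
move=> K0 r1; have e1 : 1 `^ K%:R^-1 = 1 :> R by rewrite powR1.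
by rewrite -[ltLHS]e1; apply: gt0_ltr_powR; rewrite ?nnegrE ?invr_gt0 ?ltr0n//; lra.
Qed.

Lemma root_sub1_le (K : nat) (rho : R) : 1 <= rho -> K%:R * (rho - 1) <= rho ^+ K - 1.
Proof.
move=> r1; elim: K => [|K IHK]; first by rewrite mul0r expr0 subrr.
rewrite -natr1 exprS; have : 1 <= rho ^+ K by rewrite exprn_ege1.
move: IHK; move: (rho ^+ K) => X IHK X1.
have : 0 <= (rho - 1) * (X - 1) by apply: mulr_ge0; lra.
lra.
Qed.

Lemma root_diff_le (K : nat) (a b : R) : 1 <= a -> a <= b -> b ^+ K - a ^+ K <= K%:R * b ^+ K * (b - a).
Proof.
move=> a1 ab; elim: K => [|K IHK]; first by rewrite !expr0 subrr !mul0r.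
have bK : 1 <= b ^+ K by rewrite exprn_ege1//; lra.
have aK : a ^+ K <= b ^+ K by rewrite lerXn2r// nnegrE; lra.
rewrite -natr1 !exprS; move: IHK bK aK; move: (b ^+ K) (a ^+ K) => X Y IHK X1 YX.
have KX : 0 <= K%:R * X :> R by rewrite mulr_ge0//; lra.
have h1 : 0 <= (b - a) * X * (b - 1) by rewrite !mulr_ge0//; lra.
have h2 : a * (X - Y) <= a * (K%:R * X * (b - a)) by rewrite ler_wpM2l//; lra.
have h3 : 0 <= (b - a) * (K%:R * X * (b - a)) by rewrite !mulr_ge0//; lra.
rewrite (_ : b * X - a * Y = (b - a) * X + a * (X - Y)); last by ring.
rewrite (_ : (K%:R + 1) * (b * X) * (b - a) =
  (b - a) * X * (b - 1) + (b - a) * X + a * (K%:R * X * (b - a)) + (b - a) * (K%:R * X * (b - a))); last by ring.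
lra.
Qed.

(* For given [K]-th powers, the ratio of [rho - 1] to [sigma - 1] is bounded
   uniformly in [K]. *)
Lemma root_ratio (K : nat) (rho sigma : R) : (0 < K)%N -> 1 < rho -> 1 < sigma ->
  rho - 1 <= (rho ^+ K - 1) * sigma ^+ K / (sigma ^+ K - 1) * (sigma - 1).
Proof.
move=> K0 r1 s1; have k0 : 0 < K%:R :> R by rewrite ltr0n.
have h1 := root_sub1_le K (ltW r1).
have h2 := root_diff_le K (lexx 1) (ltW s1); rewrite expr1n in h2.
have sK : 1 < sigma ^+ K by rewrite exprn_egt1// -lt0n.
have rK : 1 < rho ^+ K by rewrite exprn_egt1// -lt0n.
move: h1 h2 sK rK; move: (sigma ^+ K) (rho ^+ K) => S Q h1 h2 sK rK.
rewrite mulrAC ler_pdivlMr ?subr_gt0//.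
have h3 : (rho - 1) * (S - 1) <= (rho - 1) * (K%:R * S * (sigma - 1)) by rewrite ler_wpM2l//; lra.
apply: le_trans h3 _; rewrite (_ : (rho - 1) * _ = (K%:R * (rho - 1)) * (S * (sigma - 1))); last by ring.
apply: (@le_trans _ _ ((Q - 1) * (S * (sigma - 1)))); last by rewrite mulrA.
by apply: ler_wpM2r => //; apply: mulr_ge0; lra.
Qed.

End Roots.

Section LowerBound.
Context {R : realType} {d : measure_display} {Omega : measurableType d}.
Variables (Pr : probability Omega R) (theta : nat -> {RV Pr >-> R}).
Hypothesis iid : iid_uniform_angles theta.
Variables (phi : R[i] -> R[i]) (k : nat) (t rad : R).
Hypothesis k2 : (2 <= k)%N.
Hypothesis sphi : Sigma' phi.
Hypothesis smphi : smooth_up_to_boundary phi.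
Hypothesis rad1 : 1 < rad.
Hypothesis phi_ub : forall z : R[i], 1 < cmod z -> cmod (phi z) <= rad * cmod z.
Variables (tau : nat -> R) (Kb : nat -> R[i] -> R[i]).
Hypothesis KbP : forall j, is_koebe_transform (k ^ j) (rotate phi (tau j)) (Kb j).
Local Notation dphi := (phi^`()%classic).
Local Notation ds w n := (dsnow phi k tau Kb (fun j => theta j w) n).
Local Notation mean := (mean_deriv phi k t).
Local Notation U := (opP_iter phi k t).

Let claim := mean_claim_all iid t k2 sphi smphi rad1 phi_ub KbP.
Let goodS := good_snow k2 sphi smphi rad1 phi_ub KbP.

Let B0 : 0 <= rad ^+ 2. Proof. exact: exprn_ge0 (ltW (rad0 rad1)). Qed.

Lemma opP_iterE n (rho : R) : 0 < rho ->
  U n (rho ^+ (k ^ n)) = mean n rho * (rho `^ t * (rho ^+ (k ^ n)) `^ (1 - t)).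
Proof.
move=> r0; rewrite /mean_deriv; set r := _ ^+ _.
have r'0 : 0 < r by exact: exprn_gt0.
have e1 : rho `^ (- t) * rho `^ t = 1 by rewrite powRN mulVf// gt_eqF// powR_gt0.
have e2 : r `^ (t - 1) * r `^ (1 - t) = 1.
  rewrite -powRD; last by apply/implyP => _; rewrite gt_eqF.
  by rewrite (_ : t - 1 + (1 - t) = 0) ?powRr0//; ring.
transitivity ((rho `^ (- t) * rho `^ t) * (r `^ (t - 1) * r `^ (1 - t)) * U n r); first by rewrite e1 e2 !mul1r.
ring.
Qed.

(** [P^n id] is continuous because, by [opP_iterE], it is a power factor times an expectation
    already known to be continuous. *)
Lemma opP_iter_cont n (r : R) : 1 < r -> U n y @[y --> r] --> U n r.
Proof.
move=> r1; have r0 : 0 < r by lra.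
pose p : R := (k ^ n)%:R^-1.
have UE y : 0 < y -> U n y = mean n (y `^ p) * ((y `^ p) `^ t * y `^ (1 - t)).
  by move=> y0; have := opP_iterE n (powR_gt0 p y0); rewrite root_exp ?kj0.
have idr : (y : R) @[y --> r] --> r by exact: cvg_id.
have near0 : \forall y \near r, 0 < y by apply: cvgr_gt idr _ _.
rewrite UE//.
have rp1 : 1 < r `^ p by apply: root_gt1 => //; exact: kj0.
have cp : y `^ p @[y --> r] --> r `^ p by exact: cvg_powR.
have cm : mean n (y `^ p) @[y --> r] --> mean n (r `^ p).
  exact: (cvg_comp _ _ cp (mean_deriv_cont k2 sphi smphi rad1 phi_ub KbP (claim n) rp1)).
have ct : (y `^ p) `^ t @[y --> r] --> (r `^ p) `^ t.
  by apply: cvg_powR cp; rewrite powR_gt0.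
have H : mean n (y `^ p) * ((y `^ p) `^ t * y `^ (1 - t)) @[y --> r] -->
    mean n (r `^ p) * ((r `^ p) `^ t * r `^ (1 - t)).
  apply: (@cvgRM _ _ (nbhs r)); first exact: cm.
  by apply: (@cvgRM _ _ (nbhs r)); [exact: ct|exact: cvg_powR].
apply: cvg_trans H; apply: near_eq_cvg; apply: filterS near0 => y y0; exact/esym/UE.
Qed.

(** When the [k^n]-th powers lie in [[a, b]], both [rho - 1] and [sigma - 1] are of order [k^(-n)]
    and their ratio is at most [L]. So a number [N] of distortion steps independent of [n] joins the
    two radii. *)
Lemma mean_deriv_compare (a b : R) : 1 < a -> a <= b -> exists2 C : R, 0 < C &
  forall n (rho sigma : R), 1 < rho -> 1 < sigma ->
    a <= rho ^+ (k ^ n) <= b -> a <= sigma ^+ (k ^ n) <= b -> mean n rho <= C * mean n sigma.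
Proof.
move=> a1 ab; pose L := (b - 1) * b / (a - 1).
have q1 : 1 < 1 + koebe_step :> R by rewrite ltrDl koebe_step_gt0.
have [N HN] := bernoulli_unbounded L q1.
pose A : R := koebe_const ^+ N.
have A1 : 1 <= A by rewrite /A exprn_ege1// /koebe_const ler1n.
have ratio n rho sigma : 1 < rho -> 1 < sigma -> a <= rho ^+ (k ^ n) <= b ->
    a <= sigma ^+ (k ^ n) <= b -> rho - 1 <= (1 + koebe_step) ^+ N * (sigma - 1).
  move=> r1 s1 /andP[ra rb] /andP[sa sb].
  apply: le_trans (root_ratio (kj0 k2 n) r1 s1) _.
  rewrite ler_wpM2r//; first by lra.
  apply: le_trans HN; rewrite /L.
  have d1 : 0 < sigma ^+ (k ^ n) - 1 by lra.
  have d2 : 0 < a - 1 by lra.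
  rewrite ler_pdivrMr// mulrAC ler_pdivlMr//.
  move: ra rb sa sb d1; move: (rho ^+ _) (sigma ^+ _) => r s ra rb sa sb d1.
  have h1 : (r - 1) * s <= (b - 1) * b by apply: ler_pM; lra.
  have h2 : 0 <= (b - 1) * b by apply: mulr_ge0; lra.
  apply: (@le_trans _ _ ((b - 1) * b * (a - 1))); first by rewrite ler_wpM2r//; lra.
  by rewrite ler_wpM2l//; lra.
exists (A `^ `|t|); first by rewrite powR_gt0; lra.
move=> n rho sigma r1 s1 rab sab.
have z1 (x : R) : 1 < x -> 1 < cmod (circ 0 x 0 : R[i]) by move=> x1; rewrite cmod_circ0; lra.
have cz (x : R) : 1 < x -> cmod (circ 0 x 0 : R[i]) = x by move=> x1; rewrite cmod_circ0; lra.
have pt w : cmod (ds w n (circ 0 rho 0)) `^ t <= A `^ `|t| * cmod (ds w n (circ 0 sigma 0)) `^ t.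
  have [uni _] := goodS (fun j => theta j w) n.
  have p1 : 0 < cmod (ds w n (circ 0 rho 0)) by rewrite cmod_gt0; exact: ext_deriv_neq0 uni (z1 _ r1).
  have p2 : 0 < cmod (ds w n (circ 0 sigma 0)) by rewrite cmod_gt0; exact: ext_deriv_neq0 uni (z1 _ s1).
  have [rs|/ltW sr] := lerP rho sigma.
    have [h1 h2] := ext_chain 0 uni r1 rs (ratio n sigma rho s1 r1 sab rab).
    exact: powR_ratio.
  have [h1 h2] := ext_chain 0 uni s1 sr (ratio n rho sigma r1 s1 rab sab).
  exact: powR_ratio.
have m (x : R) : 1 < x -> measurable_fun setT (fun w => (cmod (ds w n (circ 0 x 0)) `^ t)%:E).
  by move=> x1; apply/measurable_EFinP; have [] := claim n (z1 x x1).
have E1 := mean_derivE (claim n) (z1 _ r1); rewrite cz// in E1.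
have E2 := mean_derivE (claim n) (z1 _ s1); rewrite cz// in E2.
rewrite -lee_fin -E1 EFinM -E2 -ge0_integralZl//; first last.
- by rewrite lee_fin powR_ge0.
- by move=> w _; rewrite lee_fin powR_ge0.
- exact: m.
apply: ge0_le_integral => //.
- by move=> w _; rewrite lee_fin powR_ge0.
- exact: m.
- by apply: measurable_funeM; exact: m.
- by move=> w _; rewrite -EFinM lee_fin.
Qed.

Lemma powR_prod_bounds (b p q : R) : 1 <= b -> exists c C : R, [/\ 0 < c, 0 < C &
  forall x y : R, 1 <= x <= b -> 1 <= y <= b -> c <= x `^ p * y `^ q <= C].
Proof.
move=> b1; pose A := Num.max b 1^-1 + 1.
have A0 : 0 < A.
  have : b <= Num.max b 1^-1 by rewrite le_max lexx.
  by rewrite /A; lra.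
exists (A `^ (- `|p|) * A `^ (- `|q|)), (A `^ `|p| * A `^ `|q|).
split; rewrite ?mulr_gt0 ?powR_gt0// => x y xb yb.
have /andP[h1 h2] := powR_bounds p ltr01 xb; have /andP[h3 h4] := powR_bounds q ltr01 yb.
by rewrite !ler_pM ?powR_ge0.
Qed.

Lemma opP_iter_compare (a b : R) : 1 < a -> a <= b -> exists2 C : R, 0 < C &
  forall n (r s : R), a <= r <= b -> a <= s <= b -> U n r <= C * U n s.
Proof.
move=> a1 ab; have b1 : 1 <= b by lra.
have [D D0 HD] := mean_deriv_compare a1 ab.
have [c [C [c0 C0 HC]]] := powR_prod_bounds t (1 - t) b1.
exists (D * C / c); first by rewrite divr_gt0// mulr_gt0.
move=> n r s rab sab; have K0 := kj0 k2 n.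
have fac x : a <= x <= b -> exists rho : R, [/\ 1 < rho, rho ^+ (k ^ n) = x & 1 <= rho <= b].
  move=> /andP[xa xb]; have x1 : 1 < x by lra.
  have rho1 := root_gt1 K0 x1; have rhoK := root_exp K0 (lt_trans ltr01 x1).
  exists (x `^ (k ^ n)%:R^-1); split => //; rewrite (ltW rho1)/=; apply: le_trans xb.
  by rewrite -[leRHS]rhoK; apply: ler_eXnr K0 (ltW rho1).
have [rho [r1 rE rb]] := fac r rab; have [sigma [s1 sE sb]] := fac s sab.
have in1 x : a <= x <= b -> 1 <= x <= b by move=> /andP[h1 ->]; rewrite andbT; lra.
have Ur := opP_iterE n (lt_trans ltr01 r1); have Us := opP_iterE n (lt_trans ltr01 s1).
rewrite rE in Ur; rewrite sE in Us; rewrite Ur Us.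
have /andP[_ h1] := HC _ _ rb (in1 _ rab); have /andP[h2 _] := HC _ _ sb (in1 _ sab).
have hm : mean n rho <= D * mean n sigma by apply: HD; rewrite ?rE ?sE.
have m0 : 0 <= mean n rho by apply: mean_deriv_ge0; lra.
have m1 : 0 <= mean n sigma by apply: mean_deriv_ge0; lra.
have f0 : 0 <= rho `^ t * r `^ (1 - t) by rewrite mulr_ge0 ?powR_ge0.
apply: (@le_trans _ _ (D * mean n sigma * C)); first exact: ler_pM.
rewrite (_ : D * C / c * _ = (D * mean n sigma * C) * ((sigma `^ t * s `^ (1 - t)) / c)); last by ring.
apply: ler_peMr; last by rewrite ler_pdivlMr// mul1r.
by apply: mulr_ge0; [apply: mulr_ge0 => //|]; exact: ltW.
Qed.

Section Propagation.
Variables (lam c0 : R).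
Hypothesis lam0 : 0 < lam.
Hypothesis c00 : 0 < c0.
Hypothesis base : forall n (r : R), 2 <= r <= 3 * rad ^+ 2 -> c0 * lam ^+ n <= U n r.

(* The set [2^(k^j), rad^2 3^(k^j)] is mapped into its predecessor, hence a
   lower bound for [U n] propagates through the monotone operator. *)
Lemma opP_iter_propagate n j (r : R) :
  2 ^+ (k ^ j) <= r <= rad ^+ 2 * 3 ^+ (k ^ j) ->
  c0 / (3 * rad ^+ 2) * lam ^+ n * U j r <= U (n + j) r.
Proof.
have B1 : 0 < 3 * rad ^+ 2 by rewrite mulr_gt0// exprn_gt0// (rad0 rad1).
set c := _ / _; have cp : 0 < c by rewrite divr_gt0.
elim: j r => [|j IHj] r.
  rewrite expn0 !expr1 addn0 => /andP[h1 h2].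
  apply: le_trans (base n _); last by rewrite h1 mulrC h2.
  rewrite (_ : U 0 r = r)// (_ : c * lam ^+ n * r = c0 * lam ^+ n * (r / (3 * rad ^+ 2))); last by rewrite /c; ring.
  apply: ler_piMr; first by rewrite mulr_ge0 ?exprn_ge0 ?ltW.
  by rewrite ler_pdivrMr// mul1r mulrC.
move=> /andP[h1 h2].
have k0 : (0 < k)%N by rewrite (leq_trans _ k2).
have r1 : 1 < r by apply: lt_le_trans h1; rewrite exprn_egt1// -?lt0n ?kj0// ltr1n.
have r0 : 0 < r by lra.
pose q := r `^ k%:R^-1; have q1 : 1 < q by exact: root_gt1.
have qk : q ^+ k = r by exact: root_exp.
have q0 : 0 <= q by lra.
have ql : 2 ^+ (k ^ j) <= q.
  by rewrite -(ler_pXn2r k0) ?nnegrE ?exprn_ge0// -exprM -expnSr qk.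
(* The factor [rad^2] reproduces itself: as [k >= 2], its [k]-th root is at most [rad], and applying
   [phi] costs one more [rad]. *)
have qu : q <= rad * 3 ^+ (k ^ j).
  have R0 := ltW (rad0 rad1).
  rewrite -(ler_pXn2r k0) ?nnegrE ?mulr_ge0 ?exprn_ge0// qk exprMn -exprM -expnSr.
  apply: le_trans h2 _; rewrite ler_wpM2r ?exprn_ge0//.
  by rewrite ler_weXn2l// ltW.
have z1 x : 1 < cmod (circ 0 q x : R[i]) by rewrite cmod_circ0.
pose p x := cmod (phi (circ 0 q x)); pose D x := cmod (dphi (circ 0 q x)).
have [FP inj] := phi_uni sphi smphi.
have pl x : q <= p x by have := phi_lb sphi smphi (z1 x); rewrite cmod_circ0.
have pI x : 2 ^+ (k ^ j) <= p x <= rad ^+ 2 * 3 ^+ (k ^ j).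
  rewrite (le_trans ql (pl x))/=; have := phi_ub (z1 x); rewrite cmod_circ0// -/(p x) => h.
  apply: le_trans h _; rewrite expr2 -mulrA ler_wpM2l// ltW// (rad0 rad1)//.
have p1 x : 1 < p x by apply: lt_le_trans (pl x).
have D0 x : 0 < D x by rewrite cmod_gt0; exact: ext_deriv_neq0 (phi_uni sphi smphi) (z1 x).
have cpp : continuous p.
  move=> x; apply: ctends_cmod; apply: circ_continuous => y.
  by have [dz _] := FP _ (z1 y); exact: cderiv_cont dz.
have cD : continuous D.
  by move=> x; apply: ctends_cmod; apply: circ_continuous => y; have [] := FP _ (z1 y).
pose w x := (p x)^-1 * D x `^ t / (2 * pi).
have w0 x : 0 <= w x.
  by rewrite /w !mulr_ge0 ?invr_ge0 ?powR_ge0 ?cmod_ge0// mulr_ge0// pi_ge0.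
have cw : continuous w.
  move=> x; apply: (@cvgRM _ _ (nbhs x)); last exact: cvg_cst.
  apply: (@cvgRM _ _ (nbhs x)); last by apply: cvg_powR => //; exact: cD.
  apply: (@cvgRV _ _ (nbhs x)); last exact: cpp.
  by rewrite gt_eqF//; have := p1 x; lra.
have cUp m : continuous (fun x => U m (p x) * w x).
  move=> x; apply: (@cvgRM _ _ (nbhs x)); last exact: cw.
  have cm : U m y @[y --> p x] --> U m (p x) by exact: opP_iter_cont (p1 x).
  exact: (cvg_comp _ _ (cpp x) cm).
have opPE m : U m.+1 r = r `^ (1 - k.-1%:R * t / k%:R) *
    \int[lebesgue_measure]_(x in `[0, 2 * pi]) (U m (p x) * w x).
  rewrite [LHS]/= /opP -/q; congr (_ * _); apply: eq_Rintegral => x _.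
  by rewrite -[q%:C * expi x]add0r -/(circ 0 q x) /w /p /D; ring.
rewrite addnS !opPE mulrCA ler_wpM2l ?powR_ge0// -RintegralZl//; last exact: integrable_D.
apply: le_Rintegral => //.
- by apply: integrable_D => x; apply: (@cvgRM _ _ (nbhs x)); [exact: cvg_cst|exact: cUp].
- exact: integrable_D.
- by move=> x _; rewrite mulrA ler_wpM2r// IHj.
Qed.

(** For [sigma = rho^(k^n)] the propagated bound reduces the claim to a lower bound for [U j] at
    [sigma^(k^j)], that is, for the mean of [j] factors at radius [sigma]. Since [sigma] is in
    [[2, 3]], away from the unit circle, this mean is bounded below uniformly in [j]. *)
Lemma mean_deriv_lower : exists2 c : R, 0 < c & forall n j (rho : R), 1 < rho ->
  2 <= rho ^+ (k ^ n) <= 3 -> c * lam ^+ n <= mean (n + j) rho.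
Proof.
have B1 : 0 < 3 * rad ^+ 2 by rewrite mulr_gt0// exprn_gt0// (rad0 rad1).
have [c1 [C1 [c10 C10 H1]]] := @good_powR_bounds R (rad ^+ 2) 2 3 t ltac:(lra) ltac:(lra) B0.
have [c2 [C2 [c20 C20 H2]]] := @powR_prod_bounds 3 (- t) t ltac:(lra).
exists (c0 / (3 * rad ^+ 2) * c1 * c2); first by rewrite !mulr_gt0// invr_gt0.
move=> n j rho r1 s23; pose sigma := rho ^+ (k ^ n).
have /andP[s2 s3] : 2 <= sigma <= 3 by [].
have s1 : 1 < sigma by lra.
have r3 : 1 <= rho <= 3.
  rewrite (ltW r1)/=; apply: le_trans s3; exact: ler_eXnr (kj0 k2 n) (ltW r1).
have rE : rho ^+ (k ^ (n + j)) = sigma ^+ (k ^ j) by rewrite /sigma -exprM expnD.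
pose r := sigma ^+ (k ^ j); have r0 : 0 < r by rewrite exprn_gt0//; lra.
have rI : 2 ^+ (k ^ j) <= r <= rad ^+ 2 * 3 ^+ (k ^ j).
  have h3 : r <= 3 ^+ (k ^ j) by apply: lerXn2r; rewrite ?nnegrE//; lra.
  rewrite {1}/r lerXn2r ?nnegrE//=; last by lra.
  apply: le_trans h3 _; rewrite ler_peMl ?exprn_ge0//.
  by rewrite exprn_ege1// ltW.
have hp := opP_iter_propagate n rI.
have ms : c1 <= mean j sigma.
  have z1 : 1 < cmod (circ 0 sigma 0 : R[i]) by rewrite cmod_circ0; lra.
  have := mean_deriv_bounds (c := c1) (C := C1) (claim j) z1.
  rewrite cmod_circ0 => [H|]; last by lra.
  suff /H/andP[] : forall w, c1 <= cmod (ds w j (circ 0 sigma 0)) `^ t <= C1 by [].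
  by move=> w; apply: (H1 _ _ (goodS _ j)); rewrite cmod_circ0 ?s2 ?s3//; lra.
have Uj := opP_iterE j (lt_trans ltr01 s1); rewrite -/r in Uj.
have e1 : sigma `^ t * sigma `^ (- t) = 1 by rewrite powRN mulfV// gt_eqF// powR_gt0//; lra.
have e2 : r `^ (1 - t) * r `^ (t - 1) = 1.
  rewrite -powRD; last by apply/implyP => _; rewrite gt_eqF.
  by rewrite (_ : 1 - t + (t - 1) = 0) ?powRr0//; ring.
have mE : mean (n + j) rho = rho `^ (- t) * r `^ (t - 1) * U (n + j) r by rewrite /mean_deriv rE.
rewrite mE; set c := c0 / _ in hp *.
have cp : 0 < c by rewrite divr_gt0.
have f0 : 0 <= rho `^ (- t) * r `^ (t - 1) by rewrite mulr_ge0 ?powR_ge0.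
apply: le_trans (ler_wpM2l f0 hp); rewrite Uj.
rewrite (_ : _ * _ * (c * _ * _) = c * lam ^+ n * (rho `^ (- t) * sigma `^ t) * mean j sigma *
  (r `^ (1 - t) * r `^ (t - 1))); last by ring.
rewrite e2 mulr1 (_ : c * c1 * c2 * _ = c * lam ^+ n * c2 * c1); last by ring.
have /andP[h2 _] : c2 <= rho `^ (- t) * sigma `^ t <= C2 by apply: H2 => //; rewrite (ltW s1).
have cl0 : 0 <= c * lam ^+ n by rewrite mulr_ge0 ?exprn_ge0 ?ltW.
apply: ler_pM ms; [|exact: ltW|exact: ler_wpM2l].
by apply: mulr_ge0 cl0 _; exact: ltW.
Qed.

End Propagation.

End LowerBound.

(** * The limit map and the spectrum *)

Section IntegralLowerBound.
Context {R : realType} {d : measure_display} {T : measurableType d}.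
Variable (m : {measure set T -> \bar R}).

(** Both integrals are suprema over the simple functions below, so monotonicity holds without
    establishing that the integral means are measurable in the radius. *)
Lemma ge0_le_integral_any (f g : T -> \bar R) :
  (forall x, (0 <= f x)%E) -> (forall x, (f x <= g x)%E) ->
  (\int[m]_x f x <= \int[m]_x g x)%E.
Proof.
move=> f0 fg; have g0 x : (0 <= g x)%E by exact: le_trans (fg x).
rewrite !ge0_integralTE//; apply: le_ereal_sup => _ [h hf <-].
by exists h => // x; exact: le_trans (hf x) (fg x).
Qed.

Lemma integral_ge_cst (A D : set T) (f : T -> \bar R) (c : R) :
  measurable A -> A `<=` D -> 0 <= c -> (forall x, D x -> (0 <= f x)%E) ->
  (forall x, A x -> (c%:E <= f x)%E) -> (c%:E * m A <= \int[m]_(x in D) f x)%E.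
Proof.
move=> mA AD c0 f0 fc; rewrite -integral_cst// integral_mkcond [X in (_ <= X)%E]integral_mkcond.
apply: ge0_le_integral_any => x; rewrite !patchE.
  by case: ifP => // _; rewrite lee_fin.
case: ifPn => [/set_mem xA|_]; first by rewrite (mem_set (AD x xA)) fc.
by case: ifPn => // /set_mem; exact: f0.
Qed.

End IntegralLowerBound.

Section UniformLimit.
Context {R : realType}.

Lemma uniform_ctends (V : set R[i]) (F : nat -> R[i] -> R[i]) (f : R[i] -> R[i]) (z : R[i]) :
  V z -> {uniform V, F @ \oo --> f} -> ctends \oo (fun n => F n z) (f z).
Proof.
move=> Vz Ff e e0.
have := Ff [set h | forall y, V y -> ball (f y) (e%:C) (h y)].
have ent : nbhs (f : {uniform` V -> R[i]}) [set h | forall y, V y -> ball (f y) (e%:C) (h y)].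
  apply/uniform_nbhs; exists [set xy | ball xy.1 (e%:C) xy.2]; split => //.
  by rewrite -entourage_ballE; exists e%:C => //=; rewrite ltcR.
move=> /(_ ent) h; apply: (@filterS _ \oo _ _ _ _ h) => n /= /(_ z Vz).
by rewrite /ball /= normE ltcR cmodB.
Qed.

End UniformLimit.

Section SnowflakeLimit.
Context {R : realType} {d : measure_display} {Omega : measurableType d}.
Variables (Pr : probability Omega R) (theta : nat -> {RV Pr >-> R}).
Hypothesis iid : iid_uniform_angles theta.
Variables (phi : R[i] -> R[i]) (k : nat) (t rad : R).
Hypothesis k2 : (2 <= k)%N.
Hypothesis sphi : Sigma' phi.
Hypothesis smphi : smooth_up_to_boundary phi.
Hypothesis rad1 : 1 < rad.
Hypothesis phi_ub : forall z : R[i], 1 < cmod z -> cmod (phi z) <= rad * cmod z.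
Variables (tau : nat -> R) (Kb : nat -> R[i] -> R[i]).
Hypothesis KbP : forall j, is_koebe_transform (k ^ j) (rotate phi (tau j)) (Kb j).
Local Notation ds w n := (dsnow phi k tau Kb (fun j => theta j w) n).
Local Notation mean := (mean_deriv phi k t).

(** The transforms provided by [is_snowflake] are arbitrary for each sample; uniqueness identifies
    them with the rotated ones, with the index shift of [snow]. *)
Lemma snowflake_limit (th : nat -> R) (g : R[i] -> R[i]) : is_snowflake phi k th g ->
  Sigma' g /\ forall z : R[i], 1 < cmod z -> ctends \oo (fun m => snow k tau Kb th m z) (g z).
Proof.
move=> [Psi [PsiP sg lim]]; split=> // z z1.
have PsiE j (w : R[i]) : 1 < cmod w -> Psi j w = Phi k tau Kb j (th j) w.
  by move=> w1; apply: (koebe_unique (kj0 k2 j) (PsiP j) (PhiP k2 KbP j (th j))).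
have E n (w : R[i]) : 1 < cmod w -> iter_comp Psi n w = snow k tau Kb th n.+1 w.
  elim: n w => [|n IHn] w w1; first exact: PsiE.
  have [_ P1 _] := Phi_facts k2 sphi smphi KbP n.+1 (th n.+1).
  by rewrite [LHS]/= PsiE// IHn//; exact: P1.
have [V Vz Vlim] := lim z z1.
have := uniform_ctends (nbhs_singleton Vz) Vlim.
move=> lz e e0; have [N _ HN] := lz e e0.
by exists N.+1 => // -[|n] //= Nn; rewrite -[X in cmod (X - _)]/(snow k tau Kb th n.+1 z) -E//; exact: HN.
Qed.

Variable f : Omega -> R[i] -> R[i].
Hypothesis fP : forall w, is_snowflake phi k (fun j => theta j w) (f w).

Lemma snowflake_mean_ge (z : R[i]) (c : R) (n0 : nat) : 1 < cmod z ->
  (forall n, (n0 <= n)%N -> c <= mean n (cmod z)) ->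
  (c%:E <= 'E_Pr[fun w => (cmod ((f w)^`()%classic z) `^ t)%R])%E.
Proof.
move=> z1 hc.
have claim n := mean_claim_all iid t k2 sphi smphi rad1 phi_ub KbP n.
have goodS := good_snow k2 sphi smphi rad1 phi_ub KbP.
have B0 : 0 <= rad ^+ 2 by exact: exprn_ge0 (ltW (rad0 rad1)).
have [c1 [C1 [c10 C10 H1]]] := good_powR_bounds t z1 (lexx (cmod z)) B0.
have zz : cmod z <= cmod z <= cmod z by rewrite lexx.
have dsb n w : c1 <= cmod (ds w n z) `^ t <= C1 by exact: H1 (goodS _ n) _ zz.
have dlim w : ctends \oo (fun n => ds w n z) ((f w)^`()%classic z).
  have [[df _ _ _] lim] := snowflake_limit (fP w).
  have dz := derivable_cderiv (df _ z1).
  exact: good_deriv_cvg (goodS (fun j => theta j w)) z1 lim dz.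
(* For negative [t] the power is not continuous at 0, so the limit derivative must be kept off 0;
   the bound uniform in [n], taken at exponent 1, does it. *)
have d0 w : 0 < cmod ((f w)^`()%classic z).
  have [cl [cu [cl0 cu0 Hl]]] := good_powR_bounds 1 z1 (lexx (cmod z)) B0.
  have lb n : cl <= cmod (ds w n z).
    by have /andP[h _] := Hl _ _ (goodS (fun j => theta j w) n) _ zz; rewrite powRr1 ?cmod_ge0// in h.
  apply: lt_le_trans cl0 _.
  have cv : cmod (ds w n z) @[n --> \oo] --> cmod ((f w)^`()%classic z) by exact: ctends_cmod.
  rewrite leNgt; apply/negP => lt; have : \forall n \near \oo, cmod (ds w n z) < cl by apply: cvgr_lt cv _ lt.
  by move=> [N _ /(_ N (leqnn N))] /=; have := lb N; lra.
have plim w : cmod (ds w n z) `^ t @[n --> \oo] --> cmod ((f w)^`()%classic z) `^ t.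
  by apply: cvg_powR => //; exact: ctends_cmod.
have mds n : measurable_fun setT (fun w => cmod (ds w n z) `^ t) by have [] := claim n z z1.
have mf : measurable_fun setT (fun w => cmod ((f w)^`()%classic z) `^ t).
  by apply: (measurable_fun_cvg (h := fun n w => cmod (ds w n z) `^ t)).
have cv : (\int[Pr]_w (cmod (ds w n z) `^ t)%R%:E @[n --> \oo] -->
    \int[Pr]_w (cmod ((f w)^`()%classic z) `^ t)%R%:E)%E.
  apply: (prob_bounded_cvg (C := C1) measurableT) => // n w.
  by have /andP[h1 h2] := dsb n w; rewrite h2 powR_ge0.
rewrite unlock; apply: (cvge_ge _ cv).
by exists n0 => // n /= nn; rewrite mean_derivE// lee_fin hc.
Qed.

End SnowflakeLimit.

Section Final.
Context {R : realType}.
Local Notation mu := (@lebesgue_measure R).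

(** The exceptional sets and the two endpoints form a null set, which cannot contain all points
    where [nu] is nonzero. *)
Lemma ae_good_point (nu : R -> R) (rad : R) (P : nat -> set R) :
  ~ {ae mu, forall r : R, r \in `[1, rad] -> nu r = 0} ->
  (forall n, {ae mu, forall r, 1 < r < rad -> P n r}) ->
  exists r, [/\ 1 < r < rad, nu r != 0 & forall n, P n r].
Proof.
move=> nz aeP; apply: contrapT => H; apply: nz.
pose N n := ~` [set r | 1 < r < rad -> P n r].
have N0 n : mu.-negligible (N n) by exact: aeP.
have p0 (x : R) : mu.-negligible [set x].
  by exists [set x]; split => //; exact: lebesgue_measure_set1.
apply: negligibleS (negligibleU (negligibleU (p0 1) (p0 rad)) (negligible_bigcup N0)).
move=> r /= nr; apply: contrapT => /not_orP[/not_orP[r1 rr] rN]; apply: nr => rI.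
apply/eqP; apply: contrapT => /negP nu0; apply: H; exists r.
have rI' : 1 < r < rad.
  move: rI; rewrite in_itv /= !lt_neqAle => /andP[-> ->]; rewrite !andbT.
  by apply/andP; split; apply/eqP => e; [apply: r1|apply: rr].
split => // n; apply: contrapT => nP; apply: rN; exists n => // h; apply: nP; exact: h.
Qed.

Section Bound.
Context {d : measure_display} {Omega : measurableType d}.
Variables (Pr : probability Omega R) (t : R) (k : nat) (f : Omega -> R[i] -> R[i]).
Variables (lam c : R).
Hypothesis k2 : (2 <= k)%N.
Hypothesis lam0 : 0 < lam.
Hypothesis c0 : 0 < c.
Hypothesis mean_ge : forall n (z : R[i]), 1 < cmod z -> 2 <= cmod z ^+ (k ^ n) <= 3 ->
  ((c * lam ^+ n)%:E <= 'E_Pr[fun w => (cmod ((f w)^`()%classic z) `^ t)%R])%E.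

Let K0 n : (0 < k ^ n)%N. Proof. by rewrite expn_gt0 (leq_trans _ k2). Qed.

Lemma integral_means_ge0 r : (0 <= integral_means Pr t f r)%E.
Proof.
apply: integral_ge0 => x _; apply: expectation_ge0 => w; exact: powR_ge0.
Qed.

Lemma integral_means_ge n (r : R) : 1 < r -> 2 <= r ^+ (k ^ n) <= 3 ->
  ((c * lam ^+ n * (2 * pi))%:E <= integral_means Pr t f r)%E.
Proof.
move=> r1 rI; rewrite /integral_means.
have mD : measurable (`[0, 2 * pi]%classic : set R) by exact: measurable_itv.
have cl0 : 0 <= c * lam ^+ n by rewrite mulr_ge0 ?exprn_ge0 ?ltW.
have muD : mu (`[0, 2 * pi]%classic : set R) = (2 * pi)%:E.
  by rewrite lebesgue_measure_itv /= lte_fin pi2_gt0 -EFinB subr0.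
rewrite EFinM -muD; apply: integral_ge_cst => //.
- by move=> x _; apply: expectation_ge0 => w; exact: powR_ge0.
- move=> x _; have cz : cmod (r%:C * expi x) = r by rewrite cmodM cmod_expi mulr1 cmodR gtr0_norm//; lra.
  by apply: mean_ge; rewrite cz.
Qed.

Lemma annulus_bounds n (r : R) : 1 <= r -> 2 <= r ^+ (k ^ n) <= 3 ->
  2^-1 <= (k ^ n)%:R * (r - 1) <= 2.
Proof.
move=> r1 /andP[r2 r3].
have h1 := root_sub1_le (k ^ n) r1.
have h2 := root_diff_le (k ^ n) (lexx 1) r1; rewrite expr1n in h2.
have {}h2 : r ^+ (k ^ n) - 1 <= (k ^ n)%:R * (r - 1) * r ^+ (k ^ n) by rewrite mulrAC.
move: h1 h2 r2 r3; move: (r ^+ _) ((k ^ n)%:R * _) => S y h1 h2 r2 r3.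
apply/andP; split; last by lra.
rewrite leNgt; apply/negP => y2.
have : 0 < (2^-1 - y) * S by apply: mulr_gt0; lra.
by rewrite mulrBl; lra.
Qed.

(** With [K = k^n], on the radii between [2^(1/K)] and [3^(1/K)] the weight is at least of order
    [K^(1-beta)]. Their interval has length at least [1 / (3 K)], since the [K]-th powers of its
    ends differ by 1. The product is of order [K^(-beta) lam^n]. *)
Lemma spectrum_integral_ge (beta r0 : R) : 1 < r0 -> exists2 C : R, 0 < C & exists N : nat,
  forall n, (N <= n)%N -> ((C * (lam * k%:R `^ (- beta)) ^+ n)%:E <=
    \int[mu]_(r in `]1%R, r0[%classic) (((r - 1) `^ (beta - 1))%R%:E * integral_means Pr t f r))%E.
Proof.
move=> r01; pose A : R := Num.max 2 (2^-1)^-1 + 1; pose cb := A `^ (- `|beta - 1|).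
have cb0 : 0 < cb.
  by rewrite powR_gt0// /A; have : 2 <= Num.max 2 (2^-1)^-1 :> R; [rewrite le_max lexx|lra].
have pi0 : 0 < 2 * pi :> R by exact: pi2_gt0.
exists (cb * c * (2 * pi) / 3); first by rewrite divr_gt0// !mulr_gt0// pi_gt0.
(* As [K (r - 1) <= 2] on the chosen radii, this puts them inside [(1, r0)]. *)
have [N HN] : exists N : nat, 2 / (r0 - 1) < (k ^ N)%:R :> R.
  have k1 : 1 < k%:R :> R by rewrite ltr1n.
  have [N HN] := bernoulli_unbounded (2 / (r0 - 1) + 1) k1.
  by exists N; rewrite natrX; lra.
exists N => n Nn; pose K : R := (k ^ n)%:R.
have Kp : 0 < K by rewrite ltr0n.
have KN : 2 / (r0 - 1) < K.
  by apply: lt_le_trans HN _; rewrite ler_nat leq_pexp2l// (leq_trans _ k2).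
pose a : R := 2 `^ K^-1; pose b : R := 3 `^ K^-1.
have a1 : 1 < a by apply: root_gt1 => //; lra.
have aK : a ^+ (k ^ n) = 2 by apply: root_exp => //; lra.
have bK : b ^+ (k ^ n) = 3 by apply: root_exp => //; lra.
have ab : a < b by apply: gt0_ltr_powR; rewrite ?invr_gt0 ?nnegrE//; lra.
have rI r : a <= r <= b -> 2 <= r ^+ (k ^ n) <= 3.
  by move=> /andP[ar rb]; rewrite -aK -bK !lerXn2r// nnegrE; lra.
have len : (3 * K)^-1 <= b - a.
  have := root_diff_le (k ^ n) (ltW a1) (ltW ab); rewrite aK bK -/K => h.
  rewrite -[leLHS]mul1r ler_pdivrMr; last by apply: mulr_gt0.
  by rewrite (_ : (b - a) * (3 * K) = K * 3 * (b - a)); [lra|ring].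
pose low := cb * K `^ (1 - beta) * (c * lam ^+ n * (2 * pi)).
have low0 : 0 <= low.
  by rewrite /low !mulr_ge0 ?powR_ge0 ?exprn_ge0 ?(ltW lam0) ?(ltW c0)// pi_ge0.
have sub r : a <= r <= b -> 1 < r < r0.
  move=> rab; have /andP[ar rb] := rab; have r1 : 1 < r by lra.
  rewrite r1 /=; have /andP[_ h] := annulus_bounds (ltW r1) (rI r rab).
  have : K * (r - 1) < K * (r0 - 1).
    by apply: le_lt_trans h _; rewrite -ltr_pdivrMr// subr_gt0.
  by rewrite ltr_pM2l//; lra.
have step1 : (low%:E * mu `[a, b] <= \int[mu]_(r in `]1%R, r0[%classic)
    (((r - 1) `^ (beta - 1))%R%:E * integral_means Pr t f r))%E.
  apply: integral_ge_cst => //.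
  - by move=> r _; rewrite mule_ge0 ?lee_fin ?powR_ge0 ?integral_means_ge0.
  move=> r; rewrite /= in_itv /= => rab.
  have /andP[r1 _] := sub r rab; have y := annulus_bounds (ltW r1) (rI r rab).
  have /andP[yb _] := powR_bounds (beta - 1) (ltac:(lra) : 0 < 2^-1 :> R) y.
  rewrite /low EFinM; apply: lee_pmul => //.
  - by rewrite lee_fin mulr_ge0 ?powR_ge0.
  - by rewrite lee_fin !mulr_ge0 ?exprn_ge0 ?(ltW lam0) ?(ltW c0) ?pi_ge0.
  - rewrite lee_fin; have -> : r - 1 = (K * (r - 1)) * K^-1 by field; rewrite gt_eqF.
    have K1 : 0 <= K * (r - 1) by rewrite mulr_ge0//; lra.
    rewrite powRM ?invr_ge0 ?(ltW Kp)// powR_VE// opprB.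
    by rewrite ler_wpM2r ?powR_ge0.
  - exact: integral_means_ge r1 (rI r rab).
apply: le_trans step1; rewrite lebesgue_measure_itv /= lte_fin ab -EFinB -EFinM lee_fin.
apply: le_trans (ler_wpM2l low0 len).
rewrite le_eqVlt; apply/orP; left; apply/eqP.
have e1 : K `^ (1 - beta) = K * K `^ (- beta).
  by rewrite powRD ?powRr1 ?(ltW Kp)//; apply/implyP => _; rewrite gt_eqF.
have e2 : (k%:R `^ (- beta)) ^+ n = K `^ (- beta) :> R.
  rewrite -powR_mulrn ?powR_ge0// -powRrM mulrC powRrM powR_mulrn ?ler0n// -natrX.
  by [].
rewrite exprMn e2 /low e1; field; rewrite gt_eqF//.
Qed.

Lemma spectrum_ge : ((ln lam / ln k%:R)%:E <= avg_spectrum Pr t f)%E.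
Proof.
have k1 : 1 < k%:R :> R by rewrite ltr1n.
have k0 : 0 < k%:R :> R by lra.
have lnk : 0 < ln k%:R :> R by rewrite ln_gt0.
apply: le_ereal_inf_tmp => _ [beta [r0 r01 fin] <-].
have [C C0 [N HN]] := spectrum_integral_ge beta r01.
set I := (\int[_]_(_ in _) _)%E in fin HN.
pose q := lam * k%:R `^ (- beta).
have q1 : q <= 1.
  rewrite leNgt; apply/negP => q1.
  have I0 : (0 <= I)%E.
    by apply: integral_ge0 => r _; rewrite mule_ge0 ?lee_fin ?powR_ge0 ?integral_means_ge0.
  have If : I \is a fin_num by rewrite ge0_fin_numE.
  have [n Hn] := bernoulli_unbounded (fine I / C + 1) q1.
  have := HN (N + n)%N (leq_addr _ _); rewrite -(fineK If) lee_fin -/q leNgt => /negP; apply.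
  have h : q ^+ n <= q ^+ (N + n) by apply: ler_weXn2l; [exact: ltW|exact: leq_addl].
  have h2 : fine I / C < q ^+ (N + n) by lra.
  by rewrite mulrC -ltr_pdivrMr.
rewrite lee_fin ler_pdivrMr// -ln_powR.
rewrite ler_ln ?posrE ?powR_gt0//.
by move: q1; rewrite /q powRN ler_pdivrMr ?powR_gt0// mul1r.
Qed.

End Bound.

End Final.

Theorem lemma3p4 (R : realType) (t : R) (k : nat) (hk : (2 <= k)%N)
  (phi psi : R[i] -> R[i])
  (hphi : Sigma' phi) (hsmooth : smooth_up_to_boundary phi)
  (hpsi : forall z : R[i], Dminus z -> psi (phi z) = z)
  (rad : R) (hrad : 1 < rad)
  (hincl : forall w u : R[i], DR rad w -> u ^+ k = w ->
     exists2 z : R[i], (DR rad `&` phi @` Dminus) z & u = psi z)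
  (lam : R) (hlam : opP_max_eigenvalue phi k t rad lam) (hlam0 : 0 < lam)
  (d : measure_display) (Omega : measurableType d) (Pr : probability Omega R)
  (theta : nat -> {RV Pr >-> R}) (htheta : iid_uniform_angles theta)
  (f : Omega -> R[i] -> R[i])
  (hf : forall omega : Omega,
     is_snowflake phi k (fun j => theta j omega) (f omega)) :
  ((ln lam / ln k%:R)%:E <= avg_spectrum Pr t f)%E.
Proof.
have [phi_small phi_ub] := phi_le (ltnW hk) hphi hsmooth hpsi hrad hincl.
(* One sample supplies the transforms [Kb] and their reference angles [tau]; the transforms for all
   other angles are rotations of these. *)
have w0 : Omega by exact: point.
have [Kb [KbP _ _]] := hf w0.
pose tau j := theta j w0.
have cU n r := @opP_iter_cont _ _ _ _ _ htheta phi k t rad hk hphi hsmooth hrad phi_ub tau Kb KbP n r.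
have [[nu [mnu [M nuM] nz eig]] _] := hlam.
have bound := eigen_bound hk hphi hsmooth phi_small cU hlam0 mnu nuM eig.
have [r [rI nu0 Hr]] := ae_good_point nz bound.
have /andP[r1 r2] := rI.
have nup : 0 < `|nu r| by rewrite normr_gt0.
have Mp : 0 < M by apply: lt_le_trans nup _; apply: nuM; rewrite in_itv /= !ltW.
(* [[a, b]] contains both the good radius [r] and [[2, 3 rad^2]], so that a single comparison
   constant carries the bound from [r] to the base range of the propagation. *)
pose a := Num.min r 2; pose b := Num.max r (3 * rad ^+ 2).
have rad2 : 1 < rad ^+ 2 by rewrite exprn_egt1.
have a1 : 1 < a by rewrite lt_min r1; lra.
have ar : a <= r by rewrite ge_min lexx.
have a2 : a <= 2 by rewrite ge_min lexx orbT.
have rb : r <= b by rewrite le_max lexx.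
have b2 : 3 * rad ^+ 2 <= b by rewrite le_max lexx orbT.
have ab : a <= b by lra.
have [C C0 HC] := opP_iter_compare htheta t hk hphi hsmooth hrad phi_ub KbP a1 ab.
have c0 : 0 < `|nu r| / (M * C) by rewrite divr_gt0// mulr_gt0.
have base n (s : R) : 2 <= s <= 3 * rad ^+ 2 ->
    `|nu r| / (M * C) * lam ^+ n <= opP_iter phi k t n s.
  move=> /andP[s1 s2]; have rab : a <= r <= b by rewrite ar.
  have sab : a <= s <= b by apply/andP; split; lra.
  have h1 := HC n r s rab sab; have h2 := Hr n.
  rewrite mulrAC ler_pdivrMr ?mulr_gt0// mulrC.
  apply: le_trans h2 _; rewrite (_ : opP_iter phi k t n s * (M * C) = M * (C * opP_iter phi k t n s)); last by ring.
  by rewrite ler_pM2l.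
have [c cp Hc] := mean_deriv_lower htheta hk hphi hsmooth hrad phi_ub KbP hlam0 c0 base.
apply: (spectrum_ge hk hlam0 cp) => n z z1 zI.
apply: (snowflake_mean_ge htheta hk hphi hsmooth hrad phi_ub KbP hf (n0 := n) z1) => m nm.
by rewrite -(subnKC nm); exact: Hc.
Qed.
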